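(* Let $r\geq 9$ be an integer and let $G$ be a finite simple graph that is semi-planar (i.e., $G$ can be embedded into a surface with non-negative Euler characteristic) and satisfies $\Delta(G)\leq r$. Then $G$ has an equitable $r$-coloring.
   Context: $\Delta(G)$ denotes the maximum degree of $G$. An equitable $k$-coloring of a graph is a proper vertex coloring with $k$ colors (some color classes may be empty) such that any two color classes $V_i,V_j$ satisfy $||V_i|-|V_j||\leq 1$. A graph is called semi-planar if it is embeddable into a surface with non-negative Euler characteristic. *)

(* Defs.v *)
From HB Require Import structures.
From mathcomp Require Import all_boot all_order all_algebra.
From mathcomp Require Import all_classical all_reals all_analysis.
Set Implicit Arguments.
Unset Strict Implicit.
Unset Printing Implicit Defensive.
Import Order.TTheory GRing.Theory Num.Theory.
Import numFieldNormedType.Exports.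
Local Open Scope ring_scope.

Definition simple_graph (T : finType) (e : rel T) : Prop :=
  symmetric e /\ irreflexive e.

Definition max_degree (T : finType) (e : rel T) : nat :=
  \max_(v : T) #|[set w : T | e v w]%SET|.

Definition color_class (T : finType) (k : nat) (c : T -> 'I_k) (i : 'I_k) :
    {set T} :=
  [set v : T | c v == i]%SET.

Definition equitable_coloring (T : finType) (e : rel T) (k : nat)
    (c : T -> 'I_k) : Prop :=
  (forall u v : T, e u v -> c u <> c v) /\
  (forall i j : 'I_k,
     `| #|color_class c i|%:Z - #|color_class c j|%:Z | <= 1).

(* Closed surfaces are given by triangulations: F is the set of triangles of a
   pure 2-dimensional simplicial complex with vertex set 'I_n. *)

Definition tri_edges (n : nat) (F : {set {set 'I_n}}) : {set {set 'I_n}} :=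
  [set s : {set 'I_n} | (#|s| == 2%N) && [exists t in F, s \subset t]]%SET.

(* If every element of F has cardinality 3, [set v; x; y] \in F forces v, x
   and y to be distinct. *)
Definition link (n : nat) (F : {set {set 'I_n}}) (v : 'I_n) : rel 'I_n :=
  fun x y => [set v; x; y]%SET \in F.

(* By the third and fourth clauses the link of each vertex is a finite
   connected 2-regular graph, i.e. a cycle; this is the condition for the
   complex to triangulate a compact 2-manifold without boundary (orientable or
   not).  The last clause says that the surface is connected. *)
Definition closed_surface (n : nat) (F : {set {set 'I_n}}) : Prop :=
  [/\ (0 < n)%N /\ (forall v : 'I_n, exists2 t, t \in F & v \in t),
      forall t, t \in F -> #|t| = 3%N,
      forall s, s \in tri_edges F -> #|[set t in F | s \subset t]%SET| = 2%N,
      forall v x y : 'I_n,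
        [set v; x]%SET \in tri_edges F -> [set v; y]%SET \in tri_edges F ->
        connect (link F v) x y
    & forall x y : 'I_n,
        connect (fun a b : 'I_n => [set a; b]%SET \in tri_edges F) x y].

Definition euler_char (n : nat) (F : {set {set 'I_n}}) : int :=
  n%:Z - #|tri_edges F|%:Z + #|F|%:Z.

(* The topological space underlying the triangulation, in barycentric
   coordinates, as a subspace of R^n. *)
Definition realization (R : realType) (n : nat) (F : {set {set 'I_n}}) :
    set 'rV[R]_n :=
  [set p : 'rV[R]_n | [/\ forall i, 0 <= p ord0 i,
                          \sum_(i < n) p ord0 i = 1
                        & exists2 t, t \in F &
                            forall i, p ord0 i != 0 -> i \in t]]%classic.
Arguments realization R {n} F.

(* Topological embedding of a graph in a subspace X of S: pt places the
   vertices, and the edge uv is drawn as the simple arc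
   arc u v : [0, 1] -> X from pt u to pt v.  The reversal clause makes
   arc u v and arc v u two parametrizations of the same arc. *)
Definition graph_embedding (R : realType) (S : topologicalType) (X : set S)
    (T : finType) (e : rel T) (pt : T -> S) (arc : T -> T -> R -> S) : Prop :=
  [/\ injective pt /\ (forall v : T, X (pt v)),
      forall u v : T, e u v ->
        [/\ arc u v 0 = pt u /\ arc u v 1 = pt v,
            {within `[0, 1], continuous (arc u v)}%classic,
            {in `[0, 1] &, injective (arc u v)},
            forall t : R, t \in `[0, 1] -> X (arc u v t)
          & forall t : R, t \in `[0, 1] -> arc v u t = arc u v (1 - t)],
      forall (u v w : T) (t : R), e u v -> t \in `]0, 1[ -> arc u v t <> pt w
    & forall (u v u' v' : T) (s t : R), e u v -> e u' v' ->
        [set u; v]%SET <> [set u'; v']%SET ->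
        s \in `]0, 1[ -> t \in `]0, 1[ -> arc u v s <> arc u' v' t].

Definition semi_planar (R : realType) (T : finType) (e : rel T) : Prop :=
  exists (n : nat) (F : {set {set 'I_n}}),
    [/\ closed_surface F, 0 <= euler_char F
      & exists (pt : T -> 'rV[R]_n) (arc : T -> T -> R -> 'rV[R]_n),
          graph_embedding (realization R F) e pt arc].

(* Main.v *)
(* The proof uses only two consequences of semi-planarity: a vertex set X spans
   at most 3|X| edges, and disjoint sets X, Y are joined by at most 2(|X| + |Y|).

   A graph with these properties and maximum degree at most r, r >= 9, has an
   equitable r-colouring.  When r divides the order, remove the edges at a vertex
   x of degree at most 6 and colour the rest equitably; after x is uncoloured one
   class is too small.  Say that a class has an arc to another one if one of its
   vertices could be moved there.  If x misses a class from which the small class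
   can be reached, shifting vertices along the path makes room for x.  Otherwise
   the bipartite bound leaves at most two classes that reach the small one, and
   counting the private neighbours of the vertices of these classes gives two
   non-adjacent vertices whose exchange makes room for x.  Other orders reduce
   to this case by adding a disjoint clique or removing vertices of low degree.

   For the edge bounds, subdivide the triangulation with parameter N (m.+2 below): a lattice
   point a (coordinates in nat, sum N, support in a triangle) owns the open set
   of the p with |N p_i - a_i| < 1 for all i.  The lattice points whose sets meet
   a connected set are connected in the subdivision, and those of two disjoint
   compact sets are disjoint for large N.  Applied to neighbourhoods of the
   vertices and to the middle thirds of the arcs, this realises the graph as a
   minor of the 1-skeleton.  The bound on the edges of such a minor needs only
   the Euler inequality of the subdivision, the connectedness of its dual, and
   the parity of the incidences of edges with a face and a vertex. *)

(* The number 9 comes from the bipartite bound. Let [t] classes reach the small one, [l = r - t]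
   not. Every vertex of the latter has a neighbour in each of the former, so about [t * l * s] edges
   join the two groups, against fewer than [2 * r * s]: this is [(t - 2) * (l - 2) < 4]. As [x] has
   a neighbour in each of the [t] classes, [t <= 6], and for [r >= 9] only [t <= 2] survives. The
   hard case is [t = 1], where nothing can be moved into the small class; it is settled by
   recolouring several vertices so as to create an arc, that is, the case [t = 2] already excluded.
   On the topological side arcs may be wild, so the drawing is never straightened: only
   connectedness, compactness and a finite open cover enter. Moreover a closed curve need not
   separate a surface of Euler characteristic zero. A nonzero cycle cannot lie in a forest; hence it
   uses at least three edges of the minor, and four if the minor is bipartite. *)
Require Import Defs.
From mathcomp Require Import all_boot zify.
Set Implicit Arguments.
Unset Strict Implicit.
Unset Printing Implicit Defensive.

(** * Equitable colourings of sparse graphs *)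

Section Sparse.
Variables (T : finType) (e : rel T).
Hypotheses (esym : symmetric e) (eirr : irreflexive e).

Definition nb (v : T) (X : {set T}) : nat := #|[set u in X | e v u]|.

(** The first sum counts every edge inside [X] twice, so 6 stands for three edges per vertex; the
    second counts each edge between [X] and [Y] once. *)
Definition sparse : Prop :=
  (forall X : {set T}, \sum_(x in X) nb x X <= 6 * #|X|) /\
  (forall X Y : {set T}, [disjoint X & Y] ->
     \sum_(x in X) nb x Y <= 2 * (#|X| + #|Y|)).

Lemma nbS (v : T) (X Y : {set T}) : X \subset Y -> nb v X <= nb v Y.
Proof.
move=> sXY; apply: subset_leq_card; apply/subsetP=> u.
by rewrite !inE => /andP[/(subsetP sXY) -> ->].
Qed.

Lemma nbE (v : T) (X : {set T}) : nb v X = \sum_(u in X) e v u.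
Proof.
rewrite /nb -sum1_card big_mkcond [RHS]big_mkcond; apply: eq_bigr => u _.
by rewrite inE; case: (u \in X); case: (e v u).
Qed.

Lemma sum_nbC (X Y : {set T}) : \sum_(x in X) nb x Y = \sum_(y in Y) nb y X.
Proof.
under eq_bigr => x _ do rewrite nbE.
rewrite exchange_big; apply: eq_bigr => y _; rewrite nbE.
by apply: eq_bigr => x _; rewrite esym.
Qed.

Lemma nbU (v : T) (X Y : {set T}) :
  [disjoint X & Y] -> nb v (X :|: Y) = nb v X + nb v Y.
Proof.
move=> dXY; rewrite !nbE (eq_bigl [predU X & Y]) ?bigU // => u.
by rewrite !inE.
Qed.

Lemma nb_gt0 (v u : T) (X : {set T}) : u \in X -> e v u -> 0 < nb v X.
Proof. by move=> uX evu; apply/card_gt0P; exists u; rewrite inE uX. Qed.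

Lemma nb_gt0P (v : T) (X : {set T}) :
  reflect (exists2 u, u \in X & e v u) (0 < nb v X).
Proof.
apply: (iffP card_gt0P) => [[u]|[u uX evu]].
  by rewrite inE => /andP[uX evu]; exists u.
by exists u; rewrite inE uX.
Qed.

Lemma nb1_uniq (v u u' : T) (X : {set T}) :
  nb v X = 1 -> u \in X -> u' \in X -> e v u -> e v u' -> u = u'.
Proof.
move=> /eqP/cards1P[w wP] uX u'X evu evu'.
have: u \in [set w] by rewrite -wP inE uX.
have: u' \in [set w] by rewrite -wP inE u'X.
by rewrite !inE => /eqP-> /eqP->.
Qed.

(* Vertices of [B] whose only neighbour in [W] is [u]. *)
Definition solo (W B : {set T}) (u : T) : {set T} :=
  [set y in B | e u y & nb y W == 1].

Lemma soloP (W B : {set T}) (u y u' : T) :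
  y \in solo W B u -> u \in W -> u' \in W -> e y u' -> u' = u.
Proof.
rewrite inE => /and3P[_ euy /eqP nb1] uW u'W eyu'.
by apply: (nb1_uniq nb1) => //; rewrite esym.
Qed.

(** A vertex of [B] with one neighbour in [W] is counted once in a degree and once in a private set;
    one with more neighbours is counted at least twice in the degrees. Averaging over [W] will yield
    a vertex with many private neighbours. *)
Lemma solo_sum (W B : {set T}) :
  (forall y, y \in B -> 0 < nb y W) ->
  2 * #|B| <= \sum_(u in W) (nb u B + #|solo W B u|).
Proof.
move=> domB; rewrite big_split /= sum_nbC.
have -> : \sum_(u in W) #|solo W B u| = \sum_(y in B) (nb y W == 1) * nb y W.
  transitivity (\sum_(u in W) \sum_(y in B) (nb y W == 1) * e y u).
    apply: eq_bigr => u _; rewrite -sum1_card big_mkcond [RHS]big_mkcond.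
    apply: eq_bigr => y _; rewrite inE esym.
    by case: (y \in B); case: (e y u); case: (_ == 1).
  rewrite exchange_big; apply: eq_bigr => y _.
  by rewrite -big_distrr /= -nbE.
rewrite -big_split /= mulnC -sum_nat_const.
by apply: leq_sum => y /domB; case: (nb y W) => [|[|n]].
Qed.

End Sparse.

(** * Partial colourings and the movement of vertices between classes *)

Section Coloring.
Variables (T : finType) (e : rel T) (k : nat).
Hypotheses (esym : symmetric e) (eirr : irreflexive e).

(* [None] marks the uncoloured vertices. *)
Definition pcol := T -> option 'I_k.

Definition upd (f : pcol) (v : T) (o : option 'I_k) : pcol :=
  fun u => if u == v then o else f u.

Definition cls (f : pcol) (i : 'I_k) : {set T} := [set v | f v == Some i].

Definition colored_in (f : pcol) (I : {set 'I_k}) : {set T} :=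
  [set v | if f v is Some i then i \in I else false].

Definition proper_col (f : pcol) : Prop :=
  forall u v i, f u = Some i -> f v = Some i -> ~~ e u v.

Definition dominated (f : pcol) (i j : 'I_k) : Prop :=
  forall u, f u = Some i -> exists2 u', f u' = Some j & e u u'.

Definition movable (f : pcol) (i j : 'I_k) : bool :=
  [exists u, (f u == Some i) && [forall u', (f u' == Some j) ==> ~~ e u u']].

Lemma movableP (f : pcol) i j :
  reflect (exists2 u, f u = Some i & forall u', f u' = Some j -> ~~ e u u')
          (movable f i j).
Proof.
apply: (iffP existsP) => [[u /andP[/eqP fu /forallP h]]|[u fu h]].
  by exists u => // u' fu'; move: (h u'); rewrite fu' eqxx.
exists u; rewrite fu eqxx; apply/forallP=> u'; apply/implyP=> /eqP; exact: h.
Qed.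

Lemma nmovable f i j : ~~ movable f i j -> dominated f i j.
Proof.
move=> nm u fu; move: nm; rewrite negb_exists => /forallP/(_ u).
rewrite fu eqxx /= negb_forall => /existsP[u']; rewrite negb_imply negbK.
by case/andP=> /eqP fu' euu'; exists u'.
Qed.

Lemma dominated_nmovable f i j : dominated f i j -> ~~ movable f i j.
Proof.
move=> dom; apply/movableP=> -[u /dom[u' fu' euu'] h].
by move: (h _ fu'); rewrite euu'.
Qed.

Lemma upd_same f v o : upd f v o v = o.
Proof. by rewrite /upd eqxx. Qed.

Lemma upd_neq f v o u : u != v -> upd f v o u = f u.
Proof. by rewrite /upd => /negbTE->. Qed.

Lemma proper_updN f v : proper_col f -> proper_col (upd f v None).
Proof.
by move=> pf u u' i; rewrite /upd; do 2!case: eqP => // _; apply: pf.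
Qed.

Lemma proper_upd f v i :
  proper_col f -> (forall u, u != v -> f u = Some i -> ~~ e v u) ->
  proper_col (upd f v (Some i)).
Proof.
move=> pf h u u' j; rewrite /upd.
case: eqP => [->|/eqP nu]; case: eqP => [->|/eqP nu'] //; rewrite ?eirr //.
- by move=> [<-]; apply: h.
- by move=> fu [ij]; rewrite esym; apply: h; rewrite // ij.
- exact: pf.
Qed.

Lemma card_upd_some f v i j :
  f v = None -> #|cls (upd f v (Some i)) j| = #|cls f j| + (i == j).
Proof.
move=> fv; case: (eqVneq i j) => [<-|nij].
  rewrite (_ : cls _ _ = v |: cls f i) ?cardsU1 ?inE ?fv ?addn1 //=.
  by apply/setP=> u; rewrite !inE /upd; case: (eqVneq u v) => /= _; rewrite ?eqxx.
rewrite /= addn0; apply: eq_card => u; rewrite !inE /upd.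
case: (eqVneq u v) => [->|] //; rewrite fv; apply/eqP=> -[ij].
by rewrite ij eqxx in nij.
Qed.

Lemma card_upd_none f v i j :
  f v = Some i -> #|cls (upd f v None) j| + (i == j) = #|cls f j|.
Proof.
move=> fv; rewrite -(@card_upd_some (upd f v None) v) ?upd_same //; apply: eq_card => u.
by rewrite !inE /upd; case: (eqVneq u v) => [->|]; rewrite ?fv.
Qed.

Lemma cls_colored_in f i : cls f i = colored_in f [set i].
Proof.
apply/setP=> v; rewrite !inE; case: (f v) => [j|]; rewrite ?inE //.
Qed.

Lemma card_colored_in f I : #|colored_in f I| = \sum_(i in I) #|cls f i|.
Proof.
have -> : \sum_(i in I) #|cls f i| = \sum_v \sum_(i in I) (f v == Some i).
  rewrite exchange_big; apply: eq_bigr => i _.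
  by rewrite -sum1_card big_mkcond; apply: eq_bigr => v _; rewrite inE; case: eqP.
rewrite -sum1_card big_mkcond; apply: eq_bigr => v _; rewrite inE.
case: (f v) => [i|]; last by rewrite big1.
under eq_bigr => j _ do rewrite (inj_eq Some_inj) eq_sym.
case: ifP => iI; first by rewrite (bigD1 i) //= eqxx big1 // => j /andP[_ /negbTE->].
by rewrite big1 // => j jI; case: eqP => // ji; rewrite -ji jI in iI.
Qed.

Lemma colored_inU f I J : colored_in f (I :|: J) = colored_in f I :|: colored_in f J.
Proof. by apply/setP=> v; rewrite !inE; case: (f v) => [i|] //; rewrite inE. Qed.

Lemma colored_in_disjoint f (I J : {set 'I_k}) :
  [disjoint I & J] -> [disjoint colored_in f I & colored_in f J].
Proof.
move=> dIJ; rewrite disjoints_subset; apply/subsetP=> v; rewrite !inE.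
case: (f v) => [i|] // iI; apply/negP=> iJ.
by rewrite (disjointFr dIJ iI) in iJ.
Qed.

(* Each vertex of [Y] has a neighbour in each of the classes of [J]. *)
Lemma nb_classes f (J : {set 'I_k}) y :
  (forall j, j \in J -> exists2 u, f u = Some j & e y u) ->
  #|J| <= nb e y (colored_in f J).
Proof.
move=> h; have hJ j : exists u, j \in J -> f u = Some j /\ e y u.
  case jJ: (j \in J); last by exists y.
  by case: (h _ jJ) => u fu eyu; exists u.
have [g gP] : exists g : {ffun 'I_k -> T},
    forall j, j \in J -> f (g j) = Some j /\ e y (g j).
  by have [g gP] := fin_all_exists hJ; exists [ffun j => g j] => j; rewrite ffunE; apply: gP.
rewrite -(card_in_imset (f := g) (D := mem J)); last first.
  move=> i j iJ jJ gij; have [fi _] := gP _ iJ; have [fj _] := gP _ jJ.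
  by move: fi; rewrite gij fj => -[].
apply: subset_leq_card; apply/subsetP=> u /imsetP[j jJ ->].
by have [fj ej] := gP _ jJ; rewrite !inE fj jJ.
Qed.

Lemma sum_nb_classes f (Y : {set T}) (J : {set 'I_k}) :
  (forall y j, y \in Y -> j \in J -> exists2 u, f u = Some j & e y u) ->
  #|J| * #|Y| <= \sum_(y in Y) nb e y (colored_in f J).
Proof.
move=> h; rewrite mulnC -sum_nat_const; apply: leq_sum => y yY.
by apply: nb_classes => j; apply: h.
Qed.

(* Moving [v] into the class [z] and pushing one vertex along each arc of a
   path from [z] to [h] enlarges only the class [h]. *)
Lemma insert_along (K : {set 'I_k}) (p : seq 'I_k) :
  forall (f : pcol) (v : T) (z : 'I_k),
  proper_col f -> f v = None -> z \in K -> {subset p <= K} ->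
  path (movable f) z p -> uniq (z :: p) ->
  (forall u, f u = Some z -> ~~ e v u) ->
  exists f' : pcol,
    [/\ proper_col f',
        forall u, u != v -> u \notin colored_in f K -> f' u = f u,
        forall u, (u == v) || (u \in colored_in f K) -> u \in colored_in f' K
      & forall i, #|cls f' i| = #|cls f i| + (last z p == i)].
Proof.
elim: p => [|z1 p IH] f v z pf fv zK pK.
  move=> _ _ vz; exists (upd f v (Some z)); split.
  - by apply: proper_upd => // u _ /vz.
  - by move=> u nu _; rewrite upd_neq.
  - by move=> u; rewrite !inE /upd; case: eqP => //= _ _; rewrite zK.
  - by move=> i; rewrite card_upd_some.
rewrite /= => /andP[/movableP[u fu uz1] pth] /andP[znp unp] vz.
have nuv : u != v by apply/eqP=> uv; rewrite uv fv in fu.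
(* Putting [v] into [z] and uncolouring [u] keeps the size of every class. The rest of the path
   avoids [z], so its arcs are unaffected and [u] can be inserted along it. *)
pose f1 := upd (upd f v (Some z)) u None.
have f1z i w : i != z -> (f1 w == Some i) = (f w == Some i).
  move=> iz; rewrite /f1 /upd; case: (eqVneq w u) => [->|_].
    by rewrite fu (inj_eq Some_inj) (eq_sym z) (negbTE iz).
  case: (eqVneq w v) => [->|_] //.
  by rewrite fv (inj_eq Some_inj) (eq_sym z) (negbTE iz).
have pf1 : proper_col f1.
  by apply: proper_updN; apply: proper_upd => // w _ /vz.
have z1z : z1 != z by apply: contraNneq znp => <-; rewrite inE eqxx.
case: (IH f1 u z1) => //.
- by rewrite /f1 upd_same.
- by apply: pK; rewrite inE eqxx.
- by move=> i ip; apply: pK; rewrite inE ip orbT.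
- rewrite (eq_in_path (P := [in z1 :: p]) (e' := movable f)) //.
  move=> i j ip jp; have iz : i != z by apply: contraNneq znp => <-.
  have jz : j != z by apply: contraNneq znp => <-.
  rewrite /movable; apply: eq_existsb => w; rewrite f1z //; congr (_ && _).
  by apply: eq_forallb => w'; rewrite f1z.
- by move=> w /eqP; rewrite f1z // => /eqP /uz1.
move=> f' [pf' f'out f'in f'c]; exists f'; split=> //.
- move=> w nwv wK; case: (eqVneq w u) => [wu|nwu].
    by rewrite wu inE fu zK in wK.
  rewrite f'out // ?/f1 ?upd_neq //.
  by move: wK; rewrite !inE /f1 !upd_neq.
- move=> w wvK; apply: f'in; case: eqVneq => //= nwu.
  rewrite inE /f1 upd_neq //; case: (eqVneq w v) wvK => [->|nwv] /=.
    by rewrite upd_same zK.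
  by rewrite upd_neq // inE.
- move=> i; rewrite f'c; congr (_ + _).
  apply: (@addIn (z == i)); rewrite card_upd_none.
    by rewrite card_upd_some.
  by rewrite upd_neq.
Qed.

(* Either [v] can be inserted using only the classes of [K], so that the class
   [h] grows by one, or the set [R] of classes of [K] from which [h] can be
   reached is an obstruction. *)
Lemma insert_or (K : {set 'I_k}) (f : pcol) (v : T) (h : 'I_k) :
  proper_col f -> f v = None -> h \in K ->
  (exists f' : pcol,
    [/\ proper_col f',
        forall u, u != v -> u \notin colored_in f K -> f' u = f u,
        forall u, (u == v) || (u \in colored_in f K) -> u \in colored_in f' K
      & forall i, #|cls f' i| = #|cls f i| + (h == i)]) \/
  (exists R : {set 'I_k},
    [/\ R \subset K, h \in R,
        forall z, z \in R -> exists2 u, f u = Some z & e v u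
      & forall i j, i \in K :\: R -> j \in R -> dominated f i j]).
Proof.
move=> pf fv hK.
pose D i j := [&& i \in K, j \in K & movable f i j].
pose R := [set i in K | connect D i h].
have [/existsP[z /andP[zR /forallP vz]]|none] :=
  boolP [exists z, (z \in R) && [forall u, (f u == Some z) ==> ~~ e v u]].
  left; move: zR; rewrite inE => /andP[zK /connectP[p pth hp]].
  case/shortenP: pth hp => p' pth' unp' _ hp'.
  have [pm pK] : path (movable f) z p' /\ {subset p' <= K}.
    elim: p' z {zK vz unp' hp'} pth' => //= z1 p' IH z /andP[/and3P[_ z1K mv] /IH[-> sp]].
    by rewrite mv; split=> // i; rewrite inE => /predU1P[->|/sp].
  have [|f' [? ? ? f'c]] := insert_along pf fv zK pK pm unp'.
    by move=> u fu; move: (vz u); rewrite fu eqxx.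
  by exists f'; split=> // i; rewrite f'c hp'.
right; exists R; split.
- by apply/subsetP=> i; rewrite inE => /andP[].
- by rewrite inE hK connect0.
- move=> z zR; move: none; rewrite negb_exists => /forallP/(_ z).
  rewrite zR /= negb_forall => /existsP[u]; rewrite negb_imply negbK.
  by case/andP=> /eqP fu evu; exists u.
- move=> i j /setDP[iK iR]; rewrite inE => /andP[jK cj].
  apply: nmovable; apply: contra iR => mv; rewrite inE iK.
  by apply: connect_trans cj; apply: connect1; rewrite /D iK jK.
Qed.

End Coloring.

Lemma disjoint_setUl (U : finType) (A B C : {set U}) :
  [disjoint A :|: B & C] = [disjoint A & C] && [disjoint B & C].
Proof. by rewrite -!setI_eq0 setIUl setU_eq0. Qed.

(** * Edge counts between groups of classes *)

Section Density.
Variables (T : finType) (e : rel T) (k s : nat).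
Hypotheses (esym : symmetric e) (sp : sparse e).

(* [h] is a class of [R] with one vertex missing. *)
Lemma density (f : T -> option 'I_k) (P R : {set 'I_k}) (h : 'I_k) :
  [disjoint P & R] -> h \in R ->
  (forall i j, i \notin P :|: R -> j \in P :|: R -> dominated e f i j) ->
  (forall i j, i \in R -> j \in P -> dominated e f i j) ->
  (forall i, i \notin P -> #|cls f i| + (h == i) = s) ->
  2 * #|colored_in f P| + #|P| < 2 * (#|P| * s) + 2 ->
  (#|P| + #|R|) * (k - (#|P| + #|R|)) < 2 * k /\
  (#|P| + (k - (#|P| + #|R|))) * #|R| < 2 * k.
Proof.
move=> dPR hR domL domR sz smallP.
set L := ~: (P :|: R).
have cPR : #|P :|: R| = #|P| + #|R| by apply/eqP; rewrite (leq_card_setU _ _).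
have cL : #|L| + (#|P| + #|R|) = k by rewrite -cPR addnC cardsC card_ord.
have -> : k - (#|P| + #|R|) = #|L| by lia.
have domc (I J : {set 'I_k}) : (forall i j, i \in I -> j \in J -> dominated e f i j) ->
    #|J| * #|colored_in f I| <= \sum_(y in colored_in f I) nb e y (colored_in f J).
  move=> dom; apply: sum_nb_classes => y j; rewrite inE.
  by case fy: (f y) => [i|] // iI jJ; apply: (dom i j).
have cU (I J : {set 'I_k}) : [disjoint I & J] ->
    #|colored_in f (I :|: J)| = #|colored_in f I| + #|colored_in f J|.
  move=> dIJ; apply/eqP; rewrite colored_inU (leq_card_setU _ _) //.
  exact: colored_in_disjoint.
have szI (I : {set 'I_k}) : (forall i, i \in I -> i \notin P) ->
    #|colored_in f I| + (h \in I) = #|I| * s.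
  move=> IP; rewrite -sum_nat_const -(eq_bigr _ (fun i iI => sz i (IP i iI))).
  rewrite big_split /= -card_colored_in; congr (_ + _).
  case hI: (h \in I); first by rewrite (bigD1 h) //= eqxx big1 // => i /andP[_]; rewrite eq_sym => /negbTE->.
  by rewrite big1 // => i iI; case: eqP => // hi; rewrite hi iI in hI.
have cR : #|colored_in f R| + 1 = #|R| * s.
  by rewrite -szI ?hR // => i iR; rewrite (disjointFl dPR iR).
have cLs : #|colored_in f L| = #|L| * s.
  rewrite -szI; first by rewrite !inE hR orbT addn0.
  by move=> i; rewrite !inE negb_or => /andP[].
have dPRL : [disjoint P :|: R & L] by rewrite -setI_eq0 setICr.
have dRPL : [disjoint R & P :|: L].
  rewrite disjoint_sym disjoint_setUl dPR /= disjoint_sym.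
  by move: dPRL; rewrite disjoint_setUl => /andP[].
have dPL : [disjoint P & L] by move: dPRL; rewrite disjoint_setUl => /andP[].
have domL' i j : i \in L -> j \in P :|: R -> dominated e f i j.
  by rewrite in_setC; apply: domL.
have s0 : 0 < s by move: cR; case: (s) => //; rewrite muln0 addn1.
have tot : #|colored_in f P| + (#|R| + #|L|) * s + #|P| < 2 * (#|P| * s) + 2 + (#|R| + #|L|) * s.
  by move: smallP; lia.
have key : k * s = #|P| * s + #|R| * s + #|L| * s.
  have -> : k * s = (#|L| + (#|P| + #|R|)) * s by rewrite cL.
  by lia.
split.
  (* Edges between [L] and the rest: each of the [#|L| * s] vertices has a neighbour in every class
     of [P :|: R]. *)
  have := domc _ _ domL'; rewrite sum_nbC // cPR cLs.
  have := sp.2 _ _ (colored_in_disjoint f dPRL); rewrite cU // => h1 h2.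
  have h3 := leq_trans h2 h1.
  have: (#|P| + #|R|) * #|L| * s < 2 * k * s by rewrite -mulnA -[2 * k * s]mulnA key; lia.
  by rewrite ltn_mul2r => /andP[].
(* Edges between [R] and the rest. The vertex missing from [h] costs one edge for each class of [P];
   the last hypothesis of the lemma absorbs this loss. *)
have hP : #|P| * #|colored_in f R| <= \sum_(y in colored_in f R) nb e y (colored_in f P).
  exact: domc.
have hL : #|R| * #|colored_in f L| <= \sum_(y in colored_in f R) nb e y (colored_in f L).
  by rewrite -sum_nbC //; apply: domc => i j iL jR; apply: domL' => //; rewrite inE jR orbT.
have := sp.2 _ _ (colored_in_disjoint f dRPL); rewrite cU //.
under eq_bigr => y _ do rewrite colored_inU nbU ?colored_in_disjoint //.
rewrite big_split /= => le2; rewrite cLs in hL.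
have: (#|P| + #|L|) * #|R| * s < 2 * k * s.
  rewrite mulnDl mulnDl -[#|P| * _ * _]mulnA -cR mulnDr -[2 * k * s]mulnA key.
  have -> : #|L| * #|R| * s = #|R| * (#|L| * s) by lia.
  by move: hP hL le2 smallP cR cLs; lia.
by rewrite ltn_mul2r => /andP[].
Qed.

End Density.

(** This lemma and the next two are used with [t + l] at least [r], [r - 1] and [r - 2], after
    setting apart no, one or two dominating classes. The pairs [(3, 5)], [(2, 5)] and [(1, 5)] show
    that each fails with one class fewer; all three therefore call for [r >= 9]. *)
Lemma density0 t l : 9 <= t + l -> 3 <= t <= 6 -> t * l < 2 * (t + l) -> False.
Proof. by move=> h /andP[]; case: t h => [|[|[|[|[|[|[|t]]]]]]] // *; lia. Qed.

Lemma density1 t l : 8 <= t + l -> 0 < t -> 0 < l ->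
  (1 + t) * l < 2 * (1 + t + l) -> (1 + l) * t < 2 * (1 + t + l) -> t = 1 \/ l = 1.
Proof.
move=> h t0 l0 h1 h2.
have [t2|t2] := ltnP t 7; last by have [l2|l2] := ltnP l 3; nia.
by case: t t2 t0 h h1 h2 => [|[|[|[|[|[|[|t]]]]]]] // *; lia.
Qed.

Lemma density2 t l : 7 <= t + l -> 0 < t -> 0 < l ->
  (2 + t) * l < 2 * (2 + t + l) -> (2 + l) * t < 2 * (2 + t + l) -> False.
Proof.
move=> h t0 l0 h1 h2.
have [t2|t2] := ltnP t 6; last by nia.
by case: t t2 t0 h h1 h2 => [|[|[|[|[|[|t]]]]]] // *; lia.
Qed.

Lemma subset_of_card (T : finType) (A : {set T}) n :
  n <= #|A| -> exists2 S : {set T}, S \subset A & #|S| = n.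
Proof.
case/card_geqP=> s [us ss sA]; exists [set x in s].
  by apply/subsetP=> x; rewrite inE; apply: sA.
by rewrite -ss -(card_uniqP us); apply: eq_card => x; rewrite inE.
Qed.

(** * Dense configurations excluded by the edge bound *)

Section Local.
Variables (T : finType) (e : rel T).
Hypotheses (esym : symmetric e) (eirr : irreflexive e) (sp : sparse e).

Lemma nb_full (v : T) (X : {set T}) :
  (forall u, u \in X -> u != v -> e v u) -> #|X :\ v| <= nb e v X.
Proof.
move=> h; apply: subset_leq_card; apply/subsetP=> u.
by rewrite !inE => /andP[nuv uX]; rewrite uX h.
Qed.

(* [K_8] has 28 > 3 * 8 edges. *)
Lemma no_clique (w : T) (Q : {set T}) :
  7 <= #|Q| -> (forall q, q \in Q -> e w q) ->
  exists y1 y2, [/\ y1 \in Q, y2 \in Q, y1 != y2 & ~~ e y1 y2].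
Proof.
move=> Q7 wQ.
have [/existsP[y1 /existsP[y2 /and4P[? ? ? ?]]]|/existsPn none] :=
  boolP [exists y1, [exists y2, [&& y1 \in Q, y2 \in Q, y1 != y2 & ~~ e y1 y2]]].
  by exists y1, y2.
have [S SQ cS] := subset_of_card Q7.
have wS : w \notin S by apply/negP=> /(subsetP SQ)/wQ; rewrite eirr.
have := sp.1 (w |: S); rewrite cardsU1 wS cS => le48; exfalso; move: le48; apply/negP.
rewrite -ltnNge (@leq_trans (\sum_(x in w |: S) 7)) //.
  by rewrite sum_nat_const cardsU1 wS cS.
apply: leq_sum => x xS; apply: leq_trans (nb_full _); first last.
  move=> u uS nux; case/setU1P: uS nux => [->|uS] nux; case/setU1P: xS nux => [->|xS] nux.
  - by rewrite eqxx in nux.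
  - by rewrite esym wQ // (subsetP SQ).
  - by rewrite wQ // (subsetP SQ).
  - have /existsPn/(_ u) := none x; rewrite !(subsetP SQ) //= eq_sym nux /=.
    by rewrite negbK.
by move: (cardsD1 x (w |: S)); rewrite xS cardsU1 wS cS; lia.
Qed.

(* The join of [K_5] with four isolated vertices has 30 > 3 * 9 edges. *)
Lemma few_universal (w : T) (Q U : {set T}) :
  8 <= #|Q| -> (forall q, q \in Q -> e w q) -> U \subset Q ->
  (forall q q', q \in U -> q' \in Q -> q' != q -> e q q') -> #|U| <= 3.
Proof.
move=> Q8 wQ UQ univ; rewrite leqNgt; apply/negP=> U4.
have [S SU cS] := subset_of_card U4.
have SQ := subset_trans SU UQ.
have [|S' S'Q cS'] := @subset_of_card _ (Q :\: S) 4.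
  by rewrite cardsD (setIidPr SQ) cS; lia.
have dSS' : [disjoint S & S'].
  rewrite disjoint_sym disjoints_subset; apply: subset_trans S'Q _.
  by apply/subsetP=> u; rewrite !inE => /andP[].
have S'Q' : S' \subset Q by apply: subset_trans S'Q (subsetDl _ _).
have wS : w \notin S :|: S'.
  by rewrite inE; apply/norP; split; apply/negP;
     [move/(subsetP SQ)|move/(subsetP S'Q')] => /wQ; rewrite eirr.
have cSS : #|S :|: S'| = 8
  by have := (leq_card_setU S S').2; rewrite dSS' cS cS' => /eqP ->.
have := sp.1 (w |: (S :|: S')); rewrite cardsU1 wS cSS; apply/negP.
rewrite -ltnNge big_setU1 //= (eq_bigl [predU S & S']); last by move=> u; rewrite !inE.
rewrite bigU //=.
have sS : \sum_(x in S) 8 <= \sum_(x in S) nb e x (w |: (S :|: S')).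
  apply: leq_sum => x xS; apply: leq_trans (nb_full _); last first.
    move=> u /setU1P[->|]; first by rewrite esym wQ // (subsetP SQ).
    move=> uS nux; apply: univ => //; first exact: (subsetP SU).
    by case/setUP: uS; [apply: (subsetP SQ)|apply: (subsetP S'Q')].
  by move: (cardsD1 x (w |: (S :|: S'))); rewrite !inE xS orbT cardsU1 wS cSS; lia.
have sS' : \sum_(x in S') 5 <= \sum_(x in S') nb e x (w |: (S :|: S')).
  apply: leq_sum => x xS'; have xS : x \notin S by rewrite (disjointFl dSS').
  apply: (@leq_trans #|w |: S|).
    by rewrite cardsU1 cS; case: (boolP (w \in S)) wS => // wS; rewrite inE wS.
  apply: subset_leq_card; apply/subsetP=> u; rewrite !inE.
  case/predU1P=> [->|uS]; first by rewrite eqxx esym wQ // (subsetP S'Q').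
  rewrite uS orbT /= esym; apply: univ; first exact: (subsetP SU).
    exact: (subsetP S'Q').
  by apply: contraNneq xS => ->.
have sw : 8 <= nb e w (w |: (S :|: S')).
  rewrite -cSS; apply: subset_leq_card; apply/subsetP=> u uS.
  rewrite !inE in uS *; rewrite uS orbT wQ //.
  by case/orP: uS; [apply: (subsetP SQ)|apply: (subsetP S'Q')].
by move: sS sS' sw; rewrite !sum_nat_const cS cS'; lia.
Qed.

End Local.

Section Missed.
Variables (T : finType) (e : rel T) (k : nat).

Lemma missed_class (f : T -> option 'I_k) (K : {set 'I_k}) v :
  nb e v (colored_in f K) < #|K| ->
  exists2 z, z \in K & forall u, f u = Some z -> ~~ e v u.
Proof.
move=> small.
have [/existsP[z /andP[zK /forallP vz]]|/existsPn none] :=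
  boolP [exists z, (z \in K) && [forall u, (f u == Some z) ==> ~~ e v u]].
  by exists z => // u fu; move: (vz u); rewrite fu eqxx.
move: small; rewrite ltnNge nb_classes // => j jK; have := none j.
rewrite jK /= negb_forall => /existsP[u]; rewrite negb_imply negbK.
by case/andP=> /eqP fu evu; exists u.
Qed.

Lemma card_recolor (f : T -> option 'I_k) v i j l : f v = Some i ->
  #|cls (upd f v (Some j)) l| + (i == l) = #|cls f l| + (j == l).
Proof.
move=> fv; have := card_upd_none l fv.
have := @card_upd_some _ _ (upd f v None) v j l (upd_same f v None).
have -> : #|cls (upd (upd f v None) v (Some j)) l| = #|cls (upd f v (Some j)) l|.
  by apply: eq_card => u; rewrite !inE /upd; case: (eqVneq u v).
lia.
Qed.

End Missed.

(** * One uncoloured vertex: classes with an arc to the small one *)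

Section OneHole.
Variables (T : finType) (e : rel T) (r s : nat) (x : T).
Hypotheses (sym_e : symmetric e) (irr_e : irreflexive e) (sp : sparse e).
Hypotheses (r9 : 9 <= r) (deg : forall v, nb e v setT <= r).
Hypothesis (dx : nb e x setT <= 6).
Hypothesis noeq : forall f : T -> option 'I_r, proper_col e f ->
  (forall v, f v <> None) -> (forall i, #|cls f i| = s) -> False.

Implicit Types (f g : T -> option 'I_r) (P K R : {set 'I_r}) (h i j : 'I_r).

(* Two classes that dominate all others make every hole fillable. *)
Lemma insert2 f P h v :
  proper_col e f -> #|P| = 2 -> h \notin P -> v \notin colored_in f (~: P) ->
  (forall i j, i \notin P -> j \in P -> dominated e f i j) ->
  (forall i, i \notin P -> #|cls f i| + (h == i) = s) ->
  #|colored_in f P| < 2 * s ->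
  nb e v (colored_in f (~: P)) < r - 2 ->
  exists g, [/\ proper_col e g,
    forall u, u != v -> u \notin colored_in f (~: P) -> g u = f u,
    forall u, (u == v) || (u \in colored_in f (~: P)) -> u \in colored_in g (~: P)
    & forall i, i \notin P -> #|cls g i| = s].
Proof.
move=> pf P2 hP vK dom sz smallP few.
have cK : #|~: P| = r - 2 by rewrite -P2 -[X in X - _](card_ord r) -(cardsC P) addKn.
pose fv := upd f v None.
have fvK i u : i \notin P -> (fv u = Some i) <-> (f u = Some i).
  move=> iP; rewrite /fv /upd; case: eqP => // ->; split=> // fvi.
  by rewrite inE fvi inE iP in vK.
have colK : colored_in fv (~: P) = colored_in f (~: P).
  apply/setP=> u; rewrite /fv !inE /upd; case: eqP => // ->.
  by move: vK; rewrite inE => /negbTE ->.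
have pfv : proper_col e fv by exact: proper_updN.
have clsK i : i \notin P -> #|cls fv i| = #|cls f i|.
  move=> iP; apply: eq_card => u; rewrite !inE; apply/eqP/eqP; by case: (fvK i u iP).
rewrite -{}cK in few.
have [z zK vz] := missed_class few.
have hK : h \in ~: P by rewrite inE.
case: (insert_or sym_e irr_e pfv (upd_same f v None) hK) => [[g [pg gout gin gc]]|].
  exists g; split=> //.
  - by move=> u nuv uK; rewrite gout ?colK // /fv upd_neq.
  - by rewrite -colK.
  - by move=> i iP; rewrite gc clsK ?sz.
(* The obstruction [R] omits [z], where [v] has no neighbour. So some class lies outside [P :|: R],
   and the count of [density2] applies. *)
case=> R [RK hR vR domR]; exfalso.
have zP : z \notin P by rewrite -in_setC.
have zR : z \notin R.
  apply/negP=> /vR[u /(fvK _ _ zP) fu evu].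
  by move: (vz _ fu); rewrite evu.
have RP i : i \in R -> i \notin P by move/(subsetP RK); rewrite inE.
have dPR : [disjoint P & R].
  by rewrite disjoint_sym disjoints_subset.
have [] := density sym_e sp dPR hR _ _ sz.
- move=> i j; rewrite !inE negb_or => /andP[iP iR] /orP[jP|jR]; first exact: dom.
  have domij : dominated e fv i j by apply: domR; rewrite // !inE iR iP.
  move=> u /(fvK _ _ iP)/domij[u' /(fvK _ _ (RP _ jR)) fu' euu'].
  by exists u'.
- by move=> i j /RP; apply: dom.
- by rewrite P2; move: smallP; clear; lia.
have cR : 2 + #|R| < r.
  have: #|z |: (P :|: R)| <= r by rewrite -[X in _ <= X](card_ord r) max_card.
  rewrite cardsU1 !inE negb_or zP zR.
  by have /eqP := (leq_card_setU P R).2; rewrite dPR P2 => ->.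
have R0 : 0 < #|R| by apply/card_gt0P; exists h.
rewrite P2 => h1 h2; apply: (@density2 #|R| (r - (2 + #|R|))) => //.
- by move: cR r9; clear; lia.
- by move: cR; clear; lia.
- by move: h1 cR; clear; lia.
- by move: h2 cR; clear; lia.
Qed.

(** The situation supplied by the induction on edges: [x] alone is uncoloured and the class [h] is
    one vertex short. *)
Definition good f h : Prop :=
  [/\ proper_col e f, forall v, (f v == None) = (v == x)
    & forall i, #|cls f i| + (h == i) = s].

(** [R] is the obstruction met when [x] is inserted. Since [x] has a neighbour in each of its
    classes, [#|R| <= 6], and the edge count against the remaining classes leaves only the sizes 1
    and 2. *)
Lemma small_reach f h : good f h ->
  exists R, [/\ h \in R, #|R| <= 2,
    forall z, z \in R -> exists2 u, f u = Some z & e x u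
    & forall i j, i \notin R -> j \in R -> dominated e f i j].
Proof.
case=> pf fN sz; have fx : f x = None by apply/eqP; rewrite fN.
case: (insert_or sym_e irr_e pf fx (in_setT h)) => [[g [pg _ gin gc]]|].
  exfalso; apply: (noeq pg) => [v gv|i]; last by rewrite gc sz.
  have := gin v; rewrite -fN !inE gv; case: (f v) => [i|] //=; last by move/(_ isT).
  by rewrite in_setT => /(_ isT).
case=> R [_ hR xR dom]; exists R; split=> //; last first.
  by move=> i j iR jR; apply: dom; rewrite // !inE iR.
have R6 : #|R| <= 6 by rewrite (leq_trans _ dx) // (leq_trans (nb_classes xR)) // nbS ?subsetT.
rewrite leqNgt; apply/negP=> R3.
have [] := @density _ _ _ s sym_e sp f set0 R h _ hR.
- by rewrite -setI_eq0 set0I.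
- by move=> i j; rewrite set0U => iR jR; apply: dom; rewrite // !inE iR.
- by move=> i j; rewrite inE.
- by move=> i _.
- by rewrite cards0 card_colored_in big_set0.
rewrite cards0 !add0n => h1 _.
by apply: (@density0 #|R| (r - #|R|)); rewrite ?R3 //; move: h1 r9 R6; clear; lia.
Qed.

Section TwoClasses.
Variables (f : T -> option 'I_r) (h w : 'I_r).
Hypotheses (gf : good f h) (nwh : w != h) (mv : movable e f w h).

Let P := [set h; w].

Let P2 : #|P| = 2. Proof. by rewrite /P cards2 eq_sym nwh. Qed.

Let reachP : (forall z, z \in P -> exists2 u, f u = Some z & e x u) /\
  (forall i j, i \notin P -> j \in P -> dominated e f i j).
Proof.
have [R [hR R2 xR dom]] := small_reach gf.
have wR : w \in R.
  by apply/negP=> /negP wR; move: mv; rewrite (negbTE (dominated_nmovable (dom _ _ wR hR))).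
suff -> : P = R by [].
apply/eqP; rewrite eqEcard P2 R2 andbT.
by apply/subsetP=> i /set2P[->|->].
Qed.

Let sz := let: And3 _ _ sz := gf in sz.
Let fN := let: And3 _ fN _ := gf in fN.
Let pf := let: And3 pf _ _ := gf in pf.

Let cP : #|colored_in f P| < 2 * s.
Proof.
rewrite card_colored_in /P big_setU1 ?inE //= ?big_set1; last by rewrite eq_sym.
by have := sz h; have := sz w; rewrite eqxx eq_sym (negbTE nwh); lia.
Qed.

Let nbx : nb e x (colored_in f (~: P)) <= 4.
Proof.
have := nb_classes reachP.1; rewrite P2 => h2.
have: nb e x (colored_in f P :|: colored_in f (~: P)) <= 6.
  by apply: leq_trans dx; apply: nbS; apply: subsetT.
rewrite nbU; first by lia.
by apply: colored_in_disjoint; rewrite -setI_eq0 setICr.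
Qed.

(** [x] has a neighbour in both classes of [P], hence at most four outside, fewer than [r - 2]. So
    as soon as some [y] outside [P] is uncoloured, [x] can be absorbed there without touching the
    classes of [P]. *)
Let fillx y i : f y = Some i -> i \notin P -> exists g, [/\ proper_col e g,
    (forall u, u != x -> u \notin colored_in f (~: P) -> g u = f u),
    g y = None, (forall u, u != y -> (u == x) || (u \in colored_in f (~: P)) ->
       u \in colored_in g (~: P))
    & forall i, i \notin P -> #|cls g i| = s].
Proof.
move=> fy iP.
have nyx : y != x by rewrite -fN fy.
have colE : colored_in (upd f y None) (~: P) = colored_in f (~: P) :\ y.
  by apply/setP=> u; rewrite !inE /upd; case: (eqVneq u y).
have [||||||g [pg gout gin gc]] := @insert2 (upd f y None) P i x _ P2 iP.
- exact: proper_updN.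
- by rewrite inE upd_neq 1?eq_sym //; have /eqP -> : f x == None by rewrite fN.
- move=> l j lP jP u; rewrite /upd; case: eqP => // _ fu.
  have [u' fu' euu'] := reachP.2 _ _ lP jP _ fu; exists u' => //.
  case: eqP => // u'y; rewrite -u'y in fy.
  by case/negP: iP; have [->] : Some i = Some j by rewrite -fy -fu'.
- move=> l lP; rewrite card_upd_none //; have := sz l.
  case: (eqVneq h l) => [hl|_]; last by rewrite addn0.
  by rewrite -hl !inE eqxx in lP.
- apply: leq_ltn_trans cP; apply: subset_leq_card; apply/subsetP=> u.
  by rewrite !inE /upd; case: eqP.
- apply: leq_ltn_trans (_ : 4 < _); last by lia.
  by apply: leq_trans nbx; apply: nbS; rewrite colE subsetDl.
exists g; split=> //.
- move=> u nux uK; rewrite gout // ?colE ?inE ?(negbTE uK) ?andbF //.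
    rewrite upd_neq //; apply: contraNneq uK => ->.
    by rewrite inE fy inE iP.
  by move: uK; rewrite inE => /negbTE ->; rewrite andbF.
- by rewrite gout ?upd_same // colE !inE eqxx.
- move=> u nuy uK; apply: gin; rewrite colE in_setD1 nuy //.
Qed.

Let inP u i : f u = Some i -> i \in P -> u \notin colored_in f (~: P).
Proof. by move=> fu iP; rewrite inE fu inE iP. Qed.

Let keepP g y : g y = None ->
  (forall u, u != x -> u \notin colored_in f (~: P) -> g u = f u) ->
  (forall u, u != y -> (u == x) || (u \in colored_in f (~: P)) ->
     u \in colored_in g (~: P)) ->
  forall v j, j \in P -> g v = Some j <-> f v = Some j.
Proof.
move=> gy gout gin v j jP.
have [vK|vK] := boolP ((v == x) || (v \in colored_in f (~: P))).
  split=> [gv|fv].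
    case: (eqVneq v y) => [vy|nvy]; first by rewrite vy gy in gv.
    by move: (gin _ nvy vK); rewrite inE gv inE jP.
  by move: vK; rewrite -fN fv /= (negbTE (inP fv jP)).
by move: vK; rewrite negb_or => /andP[vx vK]; rewrite gout.
Qed.

(* A vertex of the class [w] that can be moved to the class [h] has no private
   neighbour outside of the two classes. *)
Let movable_solo u : f u = Some w -> (forall u', f u' = Some h -> ~~ e u u') ->
  solo e (cls f w) (colored_in f (~: P)) u = set0.
Proof.
move=> fu uh; apply/eqP; apply: contraT => /set0Pn[y ys].
have /and3P[yK euy /eqP ny1] : [&& y \in colored_in f (~: P), e u y & nb e y (cls f w) == 1].
  by move: ys; rewrite inE.
move: (yK); rewrite inE; case fy: (f y) => [i|] //; rewrite inE => iP.
have [g [pg gout gy gin gc]] := fillx fy iP.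
have gP := keepP gy gout gin.
have hP : h \in P by rewrite !inE eqxx.
have wP : w \in P by rewrite !inE eqxx orbT.
have gu : g u = Some w by apply/gP.
have nuy : u != y by apply: contraTneq iP => uy; rewrite -uy fu in fy; case: fy => <-; rewrite negbK.
pose g1 := upd g u (Some h).
have pg1 : proper_col e g1.
  by apply: proper_upd => // v nvu /(gP _ _ hP); apply: uh.
(* [x] fills the hole left by [y], [u] moves to [h], and [y], whose only neighbour in the class [w]
   was [u], replaces it there. *)
exfalso; apply: (@noeq (upd g1 y (Some w))).
- apply: proper_upd => // v nvy; rewrite /g1 /upd; case: eqP => [_ [hw]|/eqP nvu].
    by have := nwh; rewrite hw eqxx.
  move/(gP _ _ wP) => fv; apply: contra nvu => eyv; apply/eqP.
  by apply: (soloP sym_e ys) => //; rewrite inE ?fu ?fv.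
- move=> v; rewrite /g1 /upd; case: eqP => // /eqP nvy; case: eqP => // _ gv.
  have : v \notin colored_in g (~: P) by rewrite inE gv.
  move/(contra (gin _ nvy)); rewrite negb_or => /andP[nvx vK].
  by have := gout v nvx vK; rewrite gv => /esym/eqP; rewrite fN (negbTE nvx).
- move=> j; rewrite card_upd_some; last by rewrite /g1 upd_neq // eq_sym.
  rewrite /g1; have := card_recolor h j gu => eqj.
  have [jP|jP] := boolP (j \in P); last first.
    rewrite gc // in eqj; move: jP; rewrite !inE negb_or !(eq_sym j) => /andP[/negbTE hj /negbTE wj].
    by move: eqj; rewrite hj wj; clear; lia.
  have cj : #|cls g j| = #|cls f j|.
    by apply: eq_card => v; rewrite !inE; apply/eqP/eqP => /(gP _ _ jP).
  by have := sz j; rewrite cj in eqj; move: eqj; clear; lia.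
Qed.

(* By counting, some vertex [u] of the class [w] has many private neighbours; as the graph
   has no large clique two of them are non-adjacent and can replace in the class
   [w] both [u] and a vertex moved to [h]; the vacated places take [x] and [u]. *)
Lemma two_classes : False.
Proof.
have /movableP[u0 fu0 u0h] := mv.
set B := colored_in f (~: P).
have domB y : y \in B -> 0 < nb e y (cls f w).
  rewrite inE; case fy: (f y) => [i|] //; rewrite inE => iP.
  have [|u fu eyu] := reachP.2 _ w iP _ _ fy; first by rewrite !inE eqxx orbT.
  by apply: nb_gt0 eyu; rewrite inE fu.
have cB : #|B| = (r - 2) * s.
  have -> : r - 2 = #|~: P| by rewrite -P2 -[X in X - _](card_ord r) -(cardsC P) addKn.
  rewrite -sum_nat_const /B card_colored_in; apply: eq_bigr => i.
  by rewrite !inE negb_or eq_sym => /andP[/negbTE hi _]; have := sz i; rewrite hi addn0.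
have cw : #|cls f w| = s by have := sz w; rewrite eq_sym (negbTE nwh) addn0.
have hP : h \in P by rewrite !inE eqxx.
have wP : w \in P by rewrite !inE eqxx orbT.
have nbB u i : f u = Some i -> i \in P -> nb e u (colored_in f P) + nb e u B <= r.
  move=> fu iP; rewrite -nbU.
    by apply: leq_trans (deg u); apply: nbS; apply: subsetT.
  by apply: colored_in_disjoint; rewrite -setI_eq0 setICr.
(* The [s] vertices of the class share at least [2 * (r - 2) * s]. As [u0] contributes at most
   [r < 2 * (r - 2)], another vertex must exceed the average. *)
have [u uw usum] : exists2 u, f u = Some w & 2 * (r - 2) < nb e u B + #|solo e (cls f w) B u|.
  have [/existsP[u /andP[/eqP fu lt]]|/existsPn none] := boolP
   [exists u, (f u == Some w) && (2 * (r - 2) < nb e u B + #|solo e (cls f w) B u|)].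
    by exists u.
  have := solo_sum sym_e domB; rewrite cB.
  rewrite (bigD1 u0) ?inE ?fu0 //= (movable_solo fu0 u0h) cards0 addn0.
  have -> : 2 * ((r - 2) * s) = 2 * (r - 2) + \sum_(u in cls f w | u != u0) (2 * (r - 2)).
    rewrite -[X in X + _](@big_pred1_eq _ _ addn _ u0 (fun=> 2 * (r - 2))).
    rewrite (eq_bigl (fun u => (u \in cls f w) && (u == u0))); last first.
      by move=> u; case: eqP => [->|_]; rewrite ?inE ?fu0 ?eqxx ?andbF.
    rewrite -(bigID (fun u => u == u0)) /= sum_nat_const cw; lia.
  rewrite leqNgt => /negP[]; rewrite -addSn leq_add //.
    by have := nbB _ _ fu0 wP; lia.
  apply: leq_sum => u /andP[]; rewrite inE => fu _.
  by move: (none u); rewrite fu /= -leqNgt.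
have soloB : #|solo e (cls f w) B u| <= nb e u B.
  by apply: subset_leq_card; apply/subsetP=> y; rewrite !inE => /and3P[-> ->].
have nu0 : u != u0.
  by apply: contraTneq usum => ->; rewrite movable_solo // cards0 addn0 -leqNgt; have := nbB _ _ fu0 wP; lia.
(* Having private neighbours, [u] is not movable to [h]. The neighbour it has there leaves at most
   [r - 1] in [B], so at least [r - 2 >= 7] of them are private. *)
have uh : 0 < nb e u (colored_in f P).
  rewrite lt0n; apply/negP=> /eqP u0P; move: usum; rewrite movable_solo ?cards0 //.
    by have := nbB _ _ uw wP; lia.
  move=> u' fu'; apply/negP=> euu'; move: u0P; apply/eqP; rewrite -lt0n.
  by apply: nb_gt0 euu'; rewrite inE fu' hP.
have nbu : nb e u B <= r - 1 by have := nbB _ _ uw wP; lia.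
have [||y1 [y2 [y1s y2s ny12 ney12]]] :=
  @no_clique _ _ sym_e irr_e sp u (solo e (cls f w) B u).
- by lia.
- by move=> q; rewrite inE => /and3P[].
have [y1B uy1] : y1 \in B /\ e u y1 by move: y1s; rewrite inE => /and3P[? ? _].
have [y2B uy2] : y2 \in B /\ e u y2 by move: y2s; rewrite inE => /and3P[? ? _].
have notP v j : v \in B -> j \in P -> f v <> Some j.
  by move=> vB jP fv; move: (inP fv jP); rewrite vB.
have [i1 fy1 i1P] : exists2 i, f y1 = Some i & i \notin P.
  by move: y1B; rewrite inE; case: (f y1) => [i|] //; rewrite inE; exists i.
have [g [pg gout gy gin gc]] := fillx fy1 i1P.
have gP := keepP gy gout gin.
have [i2 gy2 i2P] : exists2 i, g y2 = Some i & i \notin P.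
  have := gin y2; rewrite eq_sym ny12 [y2 \in _]y2B orbT => /(_ isT isT).
  by rewrite inE; case: (g y2) => [i|] //; rewrite inE; exists i.
pose f2 := upd g y2 None.
have f2P v j : j \in P -> f2 v = Some j <-> f v = Some j.
  move=> jP; rewrite /f2 /upd; case: eqP => [->|_]; last exact: gP.
  by split=> // /(notP _ _ y2B jP).
have y1x : y1 != x by rewrite -fN fy1.
have ny1u : y1 != u by apply: contraTneq i1P => yu; rewrite yu uw in fy1; case: fy1 => <-; rewrite negbK.
have ny2u : y2 != u by apply: contraTneq i2P => yu; move/(gP _ _ wP): uw; rewrite -yu gy2 => -[->]; rewrite negbK.
have f2u : f2 u = Some w by apply/f2P.
have gB v i : g v = Some i -> i \notin P -> v = x \/ v \in B.
  move=> gv iP; case: (eqVneq v x) => [|nvx]; [by left|right].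
  apply: contraT => vB; move: (gout _ nvx vB); rewrite gv => /esym fv.
  by move: vB; rewrite inE fv inE iP.
(* [u] fills the hole left by [y2]. Three of its neighbours, [y1], [y2] and one in [P], lie outside
   the classes used, which leaves fewer than [r - 2]. *)
have [||||||g3 [pg3 g3out g3in g3c]] := @insert2 f2 P i2 u _ P2 i2P.
- exact: proper_updN.
- by rewrite inE f2u inE wP.
- move=> i j iP jP v; rewrite {1}/f2 /upd; case: eqP => // _ gv.
  have [u' fu' evu'] : exists2 u', f u' = Some j & e v u'.
    case: (gB _ _ gv iP) => [->|vB]; first exact: reachP.1.
    move: vB; rewrite inE; case fv: (f v) => [i'|] //; rewrite inE => i'P.
    exact: (reachP.2 _ _ i'P jP _ fv).
  by exists u' => //; apply/f2P.
- by move=> i iP; rewrite card_upd_none // gc.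
- apply: leq_ltn_trans cP; apply: subset_leq_card; apply/subsetP=> v.
  rewrite !inE; case f2v: (f2 v) => [j|] // jP.
  by move/(f2P _ _ jP): f2v => ->.
- have d1 : [disjoint colored_in f2 (~: P) & [set y1; y2] :|: colored_in f P].
    rewrite disjoint_sym disjoints_subset; apply/subsetP=> v.
    rewrite in_setC in_setU in_set2 => /orP[/orP[]/eqP->|].
    + by rewrite inE /f2 upd_neq // gy.
    + by rewrite inE /f2 upd_same.
    + rewrite !inE; case fv: (f v) => [j|] // jP.
      by move/(f2P _ _ jP): fv => ->; rewrite inE jP.
  have d2 : [disjoint [set y1; y2] & colored_in f P].
    rewrite disjoints_subset; apply/subsetP=> v; rewrite in_setC in_set2.
    have hB v' : v' \in B -> v' \notin colored_in f P.
      by rewrite !inE; case: (f v') => [j|] //; rewrite inE.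
    by case/orP=> /eqP->; apply: hB.
  have nb2 : nb e u [set y1; y2] = 2.
    rewrite /nb (_ : [set v in _ | _] = [set y1; y2]) ?cards2 ?ny12 //.
    apply/setP=> v; rewrite !inE; case: eqP => [->|_]; first by rewrite uy1.
    by case: eqP => [->|_]; rewrite ?uy2.
  have: nb e u (colored_in f2 (~: P) :|: ([set y1; y2] :|: colored_in f P)) <= r.
    by apply: leq_trans (deg u); apply: nbS; apply: subsetT.
  rewrite (nbU _ _ d1) (nbU _ _ d2) nb2.
  by move=> le_r; rewrite ltn_subRL (leq_trans _ le_r) // addnCA -addnS leq_add2l -addn1 leq_add2l.
have f2N v : f2 v = None -> v = y1 \/ v = y2.
  rewrite /f2 /upd; case: (eqVneq v y2) => [->|nvy2] gv; first by right.
  case: (eqVneq v y1) => [->|nvy1]; first by left.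
  have: v \notin colored_in g (~: P) by rewrite inE gv.
  move/(contra (gin _ nvy1)); rewrite negb_or => /andP[nvx vK].
  by have := gout v nvx vK; rewrite gv => /esym/eqP; rewrite fN (negbTE nvx).
have g3N v : g3 v = None -> v = y1 \/ v = y2.
  move=> g3v; have: v \notin colored_in g3 (~: P) by rewrite inE g3v.
  move/(contra (g3in _)); rewrite negb_or => /andP[nvu vK].
  by apply: f2N; rewrite -g3out.
have g3P v j : j \in P -> g3 v = Some j <-> v != u /\ f v = Some j.
  move=> jP; split=> [g3v|[nvu fv]]; last first.
    by rewrite g3out //; [apply/f2P|move/(f2P _ _ jP): fv => f2v; rewrite inE f2v inE jP].
  have: v \notin colored_in g3 (~: P) by rewrite inE g3v inE jP.
  move/(contra (g3in _)); rewrite negb_or => /andP[nvu vK]; split=> //.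
  by apply/(f2P _ _ jP); rewrite -g3v g3out.
have y1K : y1 \notin colored_in f2 (~: P) by rewrite inE /f2 upd_neq // gy.
have y2K : y2 \notin colored_in f2 (~: P) by rewrite inE /f2 upd_same.
have g3y1 : g3 y1 = None by rewrite g3out // /f2 upd_neq.
have g3y2 : g3 y2 = None by rewrite g3out // /f2 upd_same.
have g3u0 : g3 u0 = Some w by apply/g3P => //; rewrite eq_sym.
have ny1u0 : y1 != u0 by apply: contraTneq isT => yu; rewrite -yu g3y1 in g3u0.
have ny2u0 : y2 != u0 by apply: contraTneq isT => yu; rewrite -yu g3y2 in g3u0.
have fwW v : f v = Some w -> v \in cls f w by move=> fv; rewrite inE fv.
(* The class [w] has lost [u] and [u0] and receives [y1] and [y2]; [h] receives [u0]. *)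
apply: (@noeq (upd (upd (upd g3 u0 (Some h)) y1 (Some w)) y2 (Some w))).
- apply: proper_upd => //; first apply: proper_upd => //; first apply: proper_upd => //.
  + by move=> v _ /(g3P _ _ hP)[_]; apply: u0h.
  + move=> v nvy1; rewrite /upd; case: eqP => [_ [hw]|_].
      by have := nwh; rewrite hw eqxx.
    move/(g3P _ _ wP) => [nvu fv]; apply: contra nvu => eyv; apply/eqP.
    by apply: (soloP sym_e y1s) => //; apply: fwW.
  + move=> v nvy2; rewrite /upd; case: eqP => [-> _|_]; first by rewrite sym_e.
    case: eqP => [_ [hw]|_]; first by have := nwh; rewrite hw eqxx.
    move/(g3P _ _ wP) => [nvu fv]; apply: contra nvu => eyv; apply/eqP.
    by apply: (soloP sym_e y2s) => //; apply: fwW.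
- move=> v; rewrite /upd; case: eqP => // nvy2; case: eqP => // nvy1.
  by case: eqP => // _ /g3N[].
- move=> j; rewrite card_upd_some; last by rewrite 2?upd_neq // eq_sym.
  rewrite card_upd_some; last by rewrite upd_neq.
  have := card_recolor h j g3u0.
  have [jP|jP] := boolP (j \in P); last first.
    rewrite g3c //; move: jP; rewrite !inE negb_or !(eq_sym j) => /andP[/negbTE hj /negbTE wj].
    by rewrite hj wj; clear; lia.
  have -> : #|cls g3 j| = #|cls (upd f u None) j|.
    apply: eq_card => v; rewrite !inE /upd; apply/eqP/eqP.
      by case/(g3P _ _ jP) => /negbTE ->.
    by case: (eqVneq v u) => // nvu fv; apply/g3P.
  by have := card_upd_none j uw; have := sz j; clear; lia.
Qed.

End TwoClasses.
(** Stated for every [good] colouring: the contradictions below come from building another such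
    colouring that has an arc to its small class. *)
Lemma no_arc f h w : good f h -> w != h -> ~~ movable e f w h.
Proof. by move=> gf nwh; apply/negP => mv; apply: (two_classes gf nwh mv). Qed.

End OneHole.

Section NbClasses.
Variables (T : finType) (e : rel T) (k : nat) (f : T -> option 'I_k).

Lemma nb_colored_in v (I : {set 'I_k}) :
  nb e v (colored_in f I) = \sum_(i in I) nb e v (cls f i).
Proof.
pose f' u := if e v u then f u else None.
transitivity #|colored_in f' I|.
  by apply: eq_card => u; rewrite !inE /f' andbC; case: (e v u).
rewrite card_colored_in; apply: eq_bigr => i _.
by apply: eq_card => u; rewrite !inE /f' andbC; case: (e v u).
Qed.

Lemma colored_inP v (I : {set 'I_k}) :
  reflect (exists2 i, f v = Some i & i \in I) (v \in colored_in f I).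
Proof.
rewrite inE; case: (f v) => [i|]; last by right=> -[].
by apply: (iffP idP) => [iI|[_ [<-]]//]; exists i.
Qed.

End NbClasses.

Section Keep.
Variables (T : finType) (k : nat) (f g : T -> option 'I_k) (P : {set 'I_k}) (v0 : T).
Hypothesis gout : forall u, u != v0 -> u \notin colored_in f (~: P) -> g u = f u.
Hypothesis gin : forall u, (u == v0) || (u \in colored_in f (~: P)) ->
  u \in colored_in g (~: P).

(** The inserted vertex [v0] may come from a class of [P]; that class then loses [v0] and nothing
    else changes in [P]. *)
Lemma insert_keep v j : j \in P -> g v = Some j <-> v != v0 /\ f v = Some j.
Proof.
move=> jP; split=> [gv|[nv fv]].
  have : v \notin colored_in g (~: P) by rewrite inE gv inE jP.
  by move/(contra (@gin _)); rewrite negb_or => /andP[nv vK]; rewrite -gout.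
by rewrite gout // inE fv inE jP.
Qed.

Lemma insert_None v : g v = None -> v != v0 /\ f v = None.
Proof.
move=> gv; have : v \notin colored_in g (~: P) by rewrite inE gv.
by move/(contra (@gin _)); rewrite negb_or => /andP[nv vK]; rewrite -gout.
Qed.

Lemma insert_Some v i : i \notin P -> g v = Some i ->
  v = v0 \/ exists2 i', f v = Some i' & i' \notin P.
Proof.
move=> iP gv; case: (eqVneq v v0) => [->|nv]; [by left|right].
have [/colored_inP[i' fv]|vK] := boolP (v \in colored_in f (~: P)).
  by rewrite inE; exists i'.
by exists i => //; rewrite -gout.
Qed.

End Keep.

(** * No class has an arc to the small one *)

Section Stuck.
Variables (T : finType) (e : rel T) (r s : nat) (x : T).
Hypotheses (sym_e : symmetric e) (irr_e : irreflexive e) (sp : sparse e).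
Hypotheses (r9 : 9 <= r) (deg : forall v, nb e v setT <= r).
Hypothesis (dx : nb e x setT <= 6).
Hypothesis noeq : forall f : T -> option 'I_r, proper_col e f ->
  (forall v, f v <> None) -> (forall i, #|cls f i| = s) -> False.
Variables (f : T -> option 'I_r) (h : 'I_r).
Hypothesis gf : good e s x f h.

Let sz := let: And3 _ _ sz := gf in sz.
Let fN := let: And3 _ fN _ := gf in fN.
Let pf := let: And3 pf _ _ := gf in pf.
Let K := ~: [set h].
Let B := colored_in f K.
Let V := cls f h.

Let cK : #|K| = r - 1.
Proof. by rewrite -(cards1 h) -[X in X - _](card_ord r) -(cardsC [set h]) addKn. Qed.

Let domh i : i != h -> dominated e f i h.
Proof.
by move=> nih; apply: nmovable; apply: (no_arc sym_e irr_e sp r9 deg dx noeq gf).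
Qed.

Let inB u i : f u = Some i -> (u \in B) = (i != h).
Proof. by move=> fu; rewrite inE fu !inE. Qed.

Let BP u : u \in B -> exists2 i, f u = Some i & i != h.
Proof. by rewrite inE; case: (f u) => [i|] //; rewrite !inE; exists i. Qed.

Let nB i : i != h -> #|cls f i| = s.
Proof. by move=> nih; have := sz i; rewrite eq_sym (negbTE nih) addn0. Qed.

Let cV : #|V| + 1 = s.
Proof. by have := sz h; rewrite eqxx. Qed.

Let cB : #|B| = (r - 1) * s.
Proof.
rewrite -cK -sum_nat_const /B card_colored_in; apply: eq_bigr => i.
by rewrite !inE => /nB.
Qed.

(** The [s - 1] vertices of [V] dominate the [(r - 1) * s] vertices of [B]. So for some [w]
    neighbours and private neighbours together exceed [2 * (r - 1)]; as the private ones are among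
    at most [r] neighbours, both numbers are nearly forced. *)
Let exists_saturated : exists w, [/\ f w = Some h, nb e w B = r & r - 1 <= #|solo e V B w|].
Proof.
have domB y : y \in B -> 0 < nb e y V.
  case/BP=> i fy nih; have [u fu eyu] := domh nih fy.
  by apply: nb_gt0 eyu; rewrite inE fu.
have soloB u : #|solo e V B u| <= nb e u B.
  by apply: subset_leq_card; apply/subsetP=> y; rewrite !inE => /and3P[-> ->].
have nbB u : nb e u B <= r by apply: leq_trans (deg u); apply: nbS; apply: subsetT.
have [/existsP[w /andP[/eqP fw lt]]|/existsPn none] := boolP
   [exists u, (f u == Some h) && (2 * (r - 1) < nb e u B + #|solo e V B u|)].
  exists w; split=> //; first by move: (soloB w) (nbB w) lt r9; clear; lia.
  by move: (soloB w) (nbB w) lt r9; clear; lia.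
have := solo_sum sym_e domB; rewrite cB => le1.
have le2 : \sum_(u in V) (nb e u B + #|solo e V B u|) <= \sum_(u in V) (2 * (r - 1)).
  by apply: leq_sum => u; rewrite inE => fu; have := none u; rewrite fu -leqNgt.
have := leq_trans le1 le2; rewrite sum_nat_const -cV; move: r9; clear; nia.
Qed.

Section Saturated.
Variable w : T.
Hypotheses (fw : f w = Some h) (nbw : nb e w B = r).
Let Q := solo e V B w.
Hypothesis Qr : r - 1 <= #|Q|.

Let QP q : q \in Q -> [/\ q \in B, e w q & forall u, f u = Some h -> e q u -> u = w].
Proof.
move=> qQ; have /and3P[qB ewq _] : [&& q \in B, e w q & nb e q V == 1].
  by move: qQ; rewrite inE.
by split=> // u fu; apply: (soloP sym_e qQ); rewrite inE ?fw ?fu.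
Qed.

(* If [q] and [w] could trade places, then [q'] would be movable to the small class. *)
Let hole_reach q q' i : q \in Q -> q' \in Q -> q' != q -> ~~ e q q' -> f q = Some i ->
  exists R : {set 'I_r}, [/\ h \notin R, i \in R,
    forall z, z \in R -> exists u, [/\ u != q, f u = Some z & e w u],
    forall l j, l != h -> l \notin R -> j \in R ->
      forall u, f u = Some l -> exists u', [/\ u' != q, f u' = Some j & e u u']
    & #|R| = 1 \/ r - 2 <= #|R|].
Proof.
move=> qQ q'Q nq'q neqq' fq.
have [qB ewq qsolo] := QP qQ; have [q'B ewq' q'solo] := QP q'Q.
have nih : i != h by rewrite -(inB fq).
have nqw : q != w by apply: contraTneq ewq => ->; rewrite irr_e.
pose f1 := upd f w None; pose f0 := upd f1 q (Some h).
have pf0 : proper_col e f0.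
  apply: proper_upd => //; first exact: proper_updN.
  move=> u nuq; rewrite /f1 /upd; case: eqP => // nuw fu.
  by apply/negP=> /(qsolo _ fu).
have f0w : f0 w = None by rewrite /f0 upd_neq 1?eq_sym // /f1 upd_same.
have f1q : f1 q = Some i by rewrite /f1 upd_neq.
have f0K u l : l != h -> f0 u = Some l <-> u != q /\ f u = Some l.
  move=> nlh; rewrite /f0 /f1 /upd; case: (eqVneq u q) => [->|nuq].
    by split=> [[hl]|[//]]; rewrite hl eqxx in nlh.
  case: (eqVneq u w) => [->|nuw]; last by split=> [//|[]].
  by rewrite fw; split=> // -[_ [hl]]; rewrite hl eqxx in nlh.
have colE u : (u \in colored_in f0 K) = (u \in B) && (u != q).
  apply/idP/andP=> [|[/BP[l fu nlh] nuq]].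
    case/colored_inP=> l f0u; rewrite in_setC1 => nlh.
    by have [nuq fu] := (f0K _ _ nlh).1 f0u; rewrite (inB fu).
  by rewrite inE; have -> : f0 u = Some l; [apply/f0K|rewrite !inE].
have iK : i \in K by rewrite !inE.
(* Now [q] sits in [h], [w] is uncoloured and the hole is in [i]. If [w] can be absorbed, the result
   is [good] and [q'] is movable to [h]: its only neighbour there was [w], and it is not adjacent to
   [q]. *)
case: (insert_or sym_e irr_e pf0 f0w iK) => [[g [pg gout gin gc]]|].
  exfalso; have gg : good e s x g h.
    split=> // [v|l]; last first.
      rewrite gc; have := card_recolor h l f1q; have := card_upd_none l fw; have := sz l.
      by rewrite -/f1 -/f0; clear; lia.
    have [vK|] := boolP ((v == w) || (v \in colored_in f0 K)).
      have := gin _ vK; rewrite inE; case: (g v) => [l|] // _.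
      case/orP: vK => [/eqP->|]; first by rewrite -fN fw.
      by rewrite colE => /andP[/BP[j fv _] _]; rewrite -fN fv.
    rewrite negb_or => /andP[nvw vK]; rewrite gout // /f0 /f1 /upd (negbTE nvw).
    by case: (eqVneq v q) => [->|_]; rewrite ?fN // -fN fq.
  have : q' \in colored_in g K by apply: gin; rewrite colE q'B nq'q orbT.
  rewrite inE; case gq': (g q') => [l|] //; rewrite !inE => nlh.
  have /negP[] := no_arc sym_e irr_e sp r9 deg dx noeq gg nlh.
  apply/movableP; exists q' => // u gu.
  have : u \notin colored_in g K by rewrite inE gu !inE eqxx.
  move/(contra (gin _)); rewrite negb_or => /andP[nuw uK].
  move: gu; rewrite gout // /f0 /f1 /upd; case: eqP => [-> _|_]; first by rewrite sym_e.
  case: eqP => // _ fu; apply/negP=> /(q'solo _ fu) uw.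
  by rewrite uw eqxx in nuw.
case=> R [/subsetP RK iR wR domR].
have RK' l : l \in R -> l != h by move/RK; rewrite !inE.
have domR' l j : l != h -> l \notin R -> j \in R ->
    forall u, f u = Some l -> exists u', [/\ u' != q, f u' = Some j & e u u'].
  move=> nlh lR jR u fu.
  have nuq : u != q by apply: contraNneq lR => uq; move: fu; rewrite uq fq => -[<-].
  have [||u' /(f0K _ _ (RK' _ jR))[? ?] ?] := domR l j _ jR u; last by exists u'.
    by rewrite !inE lR nlh.
  by apply/f0K.
have hR : h \notin R by apply/negP=> /RK'; rewrite eqxx.
exists R; split=> // [z zR|].
  by have [u /(f0K _ _ (RK' _ zR))[? ?] ?] := wR _ zR; exists u.
pose f2 := upd f q None.
have f2K u l : f2 u = Some l -> u != q /\ f u = Some l.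
  by rewrite /f2 /upd; case: eqP.
have f2K' u l : u != q -> f u = Some l -> f2 u = Some l.
  by move=> nuq fu; rewrite /f2 upd_neq.
have domf2 l : l != h -> dominated e f2 l h.
  move=> nlh u /f2K[nuq fu]; have [u' fu' euu'] := domh nlh fu.
  exists u' => //; apply: f2K' => //; apply/eqP=> u'q; move: fu'; rewrite u'q fq => -[ih].
  by rewrite ih eqxx in nih.
(* The count takes [f] without [q], so that the hole is in [i]. The class [h] keeps all its
   vertices, [w] included, and dominates every other class. *)
have [|||||d1 d2] := @density _ _ _ s sym_e sp f2 [set h] R i _ iR.
- by rewrite disjoints1.
- move=> l j; rewrite !inE negb_or => /andP[nlh lR] /orP[/eqP->|jR]; first exact: domf2.
  move=> u /f2K[nuq fu]; have [u' [nu'q fu' euu']] := domR' _ _ nlh lR jR _ fu.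
  by exists u' => //; apply: f2K'.
- by move=> l j lR; rewrite inE => /eqP ->; apply: domf2; apply: RK'.
- by move=> l; rewrite inE => nlh; rewrite card_upd_none // nB.
- rewrite cards1 -cls_colored_in.
  by have := card_upd_none h fq; rewrite (negbTE nih) -/V -/f2; move: cV; clear; lia.
rewrite !cards1 in d1 d2.
have R0 : 0 < #|R| by apply/card_gt0P; exists i.
have [le|lt] := leqP (r - 2) #|R|; [by right|left].
case: (@density1 #|R| (r - (1 + #|R|))) => //.
- by move: lt r9; clear; lia.
- by move: lt r9; clear; lia.
- by move: d1 lt r9; clear; lia.
- by move: d2 lt r9; clear; lia.
- by move: lt r9; clear; lia.
Qed.

(** The private neighbours of [w] to which the swap of [hole_reach] applies. *)
Let N := [set q in Q | [exists q', [&& q' \in Q, q' != q & ~~ e q q']]].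

Let NP q : q \in N -> q \in Q /\ exists q', [/\ q' \in Q, q' != q & ~~ e q q'].
Proof. by rewrite inE => /andP[qQ /existsP[q' /and3P[? ? ?]]]; split=> //; exists q'. Qed.

Let NuP q q' : q \in Q -> q \notin N -> q' \in Q -> q' != q -> e q q'.
Proof.
move=> qQ qN q'Q nq'q; apply: contraR qN => neqq'.
by rewrite /N in_set qQ; apply/existsP; exists q'; apply/and3P.
Qed.

Let N5 : 5 <= #|N|.
Proof.
have : #|Q :\: N| <= 3.
  apply: (few_universal sym_e irr_e sp (w := w) (Q := Q)).
  - by move: Qr r9; clear; lia.
  - by move=> q /QP[].
  - exact: subsetDl.
  - by move=> q q' /setDP[qQ qN]; apply: NuP.
have := cardsID N Q; rewrite (setIidPr _); last by apply/subsetP=> q /NP[].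
by move: Qr r9; clear; lia.
Qed.

Let c i := nb e w (cls f i).

Let sum_c : \sum_(i in K) c i = r.
Proof. by have := nbw; rewrite /B nb_colored_in. Qed.

(** Each [q] in [N] shares its class with a second neighbour of [w]. So at least five of the [r]
    neighbours lie in classes that are hit more than once, and other classes must be missed. *)
Let missed2 : 2 <= #|[set i in K | c i == 0]|.
Proof.
set m := #|_|; have leN : #|N| <= \sum_(i in K | 2 <= c i) c i.
  rewrite (eq_bigl [in [set i in K | 2 <= c i]]); last by move=> i; rewrite inE.
  rewrite -nb_colored_in; apply: subset_leq_card; apply/subsetP=> q qN.
  have [qQ [q' [q'Q nq'q neqq']]] := NP qN.
  have [qB ewq _] := QP qQ; have [i fq nih] := BP qB.
  have [R [_ iR hitR _ _]] := hole_reach qQ q'Q nq'q neqq' fq.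
  have [u [nuq fu ewu]] := hitR _ iR.
  rewrite inE ewq andbT inE fq !inE nih /=.
  have <- : #|[set q; u]| = 2 by rewrite cards2 eq_sym nuq.
  by apply: subset_leq_card; apply/subsetP=> v; rewrite !inE => /orP[]/eqP->; rewrite ?fq ?fu eqxx.
(* Summed over the [r - 1] classes, this gives [#|N| + 2 * (r - 1) <= 2 * r + 2 * m], hence
   [2 * m >= 3]. *)
have : \sum_(i in K) ((2 <= c i) * c i + 2) <= \sum_(i in K) (2 * c i + 2 * (c i == 0)).
  by apply: leq_sum => i _; case: (c i) => [|[|n]] //; clear; lia.
have d2 (F : 'I_r -> nat) : \sum_(i in K) 2 * F i = 2 * \sum_(i in K) F i.
  by rewrite big_distrr.
rewrite [X in X <= _]big_split [X in _ <= X]big_split /= !d2 sum_c sum_nat_const cK.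
have -> : \sum_(i in K) (2 <= c i) * c i = \sum_(i in K | 2 <= c i) c i.
  by rewrite [RHS]big_mkcondr; apply: eq_bigr => i _; case: (2 <= c i); rewrite ?mul1n.
have -> : \sum_(i in K) (c i == 0) = m.
  rewrite /m -sum1_card [RHS]big_mkcond [LHS]big_mkcond; apply: eq_bigr => i _.
  by rewrite inE; case: (i \in K); case: (c i == 0).
by move: leN N5 r9; rewrite /c; clear; lia.
Qed.

(** [w] hits every class of [R] but misses two classes other than [h]; thus [#|R| <= r - 3], and of
    the alternatives in [hole_reach] only [#|R| = 1] remains. The class of [q] then dominates the
    others even without [q]. *)
Let bad q i : q \in N -> f q = Some i ->
  forall l u, l != h -> l != i -> f u = Some l ->
    exists u', [/\ u' != q, f u' = Some i & e u u'].
Proof.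
move=> qN fq l u nlh nli fu.
have [qQ [q' [q'Q nq'q neqq']]] := NP qN.
have [R [hR iR hitR domR cR]] := hole_reach qQ q'Q nq'q neqq' fq.
have R1 : #|R| = 1.
  case: cR => // cR; pose M := [set i in K | c i == 0].
  have M2 : 2 <= #|M| := missed2.
  have : #|h |: (R :|: M)| <= r by rewrite -[X in _ <= X](card_ord r) max_card.
  rewrite cardsU1 !inE negb_or hR eqxx /=.
  have := (leq_card_setU R M).2.
  have -> : [disjoint R & M].
    rewrite disjoints_subset; apply/subsetP=> z /hitR[v [_ fv ewv]].
    by rewrite !inE negb_and -lt0n (nb_gt0 _ ewv) ?orbT // inE fv.
  move=> /eqP -> le1; have := leq_trans (leq_add (leqnn 1) (leq_add cR M2)) le1.
  by move: r9; clear; lia.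
apply: domR fu => //; apply: contra nli => lR.
by move/eqP/cards1P: R1 => [z Rz]; move: lR iR; rewrite Rz !inE => /eqP-> /eqP->.
Qed.

(** Two such classes would both dominate the others; with [h] set apart this is [density1] for 2 and
    [r - 3]. *)
Let one_class q1 q2 i j : q1 \in N -> q2 \in N -> f q1 = Some i -> f q2 = Some j -> i = j.
Proof.
move=> q1N q2N fq1 fq2; apply/eqP; apply/negPn/negP=> nij.
have nih : i != h by rewrite -(inB fq1); have [/QP[]] := NP q1N.
have njh : j != h by rewrite -(inB fq2); have [/QP[]] := NP q2N.
pose f1 := upd f q1 None.
have f1K u l : f1 u = Some l -> f u = Some l by rewrite /f1 /upd; case: eqP.
have f1K' u l : u != q1 -> f u = Some l -> f1 u = Some l.
  by move=> nu fu; rewrite /f1 upd_neq.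
have f1i u l : l != i -> f u = Some l -> f1 u = Some l.
  by move=> nli fu; apply: f1K' => //; apply: contraNneq nli => uq; move: fu; rewrite uq fq1 => -[<-].
have domf1 l : l != h -> dominated e f1 l h.
  move=> nlh u /f1K fu; have [u' fu' euu'] := domh nlh fu.
  by exists u' => //; apply: f1i; rewrite // eq_sym.
have iR : i \in [set i; j] by rewrite !inE eqxx.
have [|||||d1 d2] := @density _ _ _ s sym_e sp f1 [set h] [set i; j] i _ iR.
- by rewrite disjoints1 !inE negb_or !(eq_sym h) nih.
- move=> l j'; rewrite !inE !negb_or => /and3P[nlh nli nlj].
  case/or3P=> /eqP->; first exact: domf1.
    move=> u /f1K fu; have [u' [nu' fu' euu']] := bad q1N fq1 nlh nli fu.
    by exists u' => //; apply: f1K'.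
  move=> u /f1K fu; have [u' [nu' fu' euu']] := bad q2N fq2 nlh nlj fu.
  by exists u' => //; apply: f1i; rewrite // eq_sym.
- by move=> l j'; rewrite !inE => /orP[]/eqP-> /eqP->; apply: domf1.
- by move=> l; rewrite inE => nlh; rewrite card_upd_none // nB.
- rewrite cards1 -cls_colored_in.
  by have := card_upd_none h fq1; rewrite (negbTE nih) -/V -/f1; move: cV; clear; lia.
rewrite !cards1 cards2 nij in d1 d2.
case: (@density1 2 (r - 3)) => //; move: d1 d2 r9; clear; lia.
Qed.

Let nonsolo v : v \in B -> v \notin Q -> exists u, [/\ u != w, f u = Some h & e v u].
Proof.
move=> vB vQ; have [i fv nih] := BP vB.
have [u fu evu] := domh nih fv.
case: (eqVneq u w) => [uw|nuw]; last by exists u.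
have : nb e v V != 1.
  by apply: contra vQ => nv1; rewrite /Q /solo in_set vB nv1 sym_e -uw evu.
have uV : u \in V by rewrite inE fu.
rewrite /nb (cardD1 u) !inE fu eqxx evu /= -[1]addn0 eqn_add2l -lt0n => /card_gt0P[u'].
rewrite !inE uw => /and3P[nu'w /eqP fu' evu'].
by exists u'.
Qed.

(** * Recolouring when [N] lies in a single class *)

Section Final.
Variables (t : 'I_r) (t1 t2 : T).
Hypotheses (Nt : forall q, q \in N -> f q = Some t).
Hypotheses (t1N : t1 \in N) (t2N : t2 \in N) (nt12 : t2 != t1).
Let P := [set h; t].
Let C := colored_in f (~: P).
Let W := cls f t :\ t1.

Let nth : t != h.
Proof. by rewrite -(inB (Nt t1N)); have [/QP[]] := NP t1N. Qed.

Let P2 : #|P| = 2. Proof. by rewrite /P cards2 eq_sym nth. Qed.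

Let nP i : (i \notin P) = (i != h) && (i != t).
Proof. by rewrite !inE negb_or. Qed.

Let CP v : reflect (exists i, [/\ f v = Some i, i != h & i != t]) (v \in C).
Proof.
apply: (iffP (colored_inP _ _ _)) => [[i fv]|[i [fv nih nit]]].
  by rewrite in_setC nP => /andP[? ?]; exists i.
by exists i; rewrite // in_setC nP nih.
Qed.

Let CB v : v \in C -> v \in B.
Proof. by case/CP=> i [fv nih _]; rewrite (inB fv). Qed.

Let domt q v : q \in N -> v \in C -> exists u, [/\ u != q, f u = Some t & e v u].
Proof. by move=> qN /CP[i [fv nih nit]]; apply: (bad qN (Nt qN) nih nit fv). Qed.

(** After the planned swap [t1] replaces [w] in the small class, which must still dominate [C]. A
    vertex outside [Q] has a second neighbour in [V]; one in [Q] is not in [N], hence adjacent to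
    all of [Q] and so to [t1]. *)
Let domA v : v \in C -> exists2 u, u = t1 \/ u != w /\ f u = Some h & e v u.
Proof.
move=> vC; have [vQ|vQ] := boolP (v \in Q); last first.
  by have [u [nuw fu evu]] := nonsolo (CB vC) vQ; exists u => //; right.
exists t1; first by left.
have vN : v \notin N.
  by apply/negP=> /Nt fv; case/CP: vC => i [fv' _]; move: fv'; rewrite fv => -[->]; rewrite eqxx.
apply: NuP => //; first by have [] := NP t1N.
by apply: contraNneq vN => <-.
Qed.

Let cC : #|C| = (r - 2) * s.
Proof.
have -> : r - 2 = #|~: P| by rewrite -P2 -[X in X - _](card_ord r) -(cardsC P) addKn.
rewrite -sum_nat_const /C card_colored_in; apply: eq_bigr => i.
by rewrite in_setC nP => /andP[/nB].
Qed.

Let nbC u : f u = Some t -> nb e u C <= r - 1.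
Proof.
move=> fu; have [u' fu' euu'] := domh nth fu.
have := nb_gt0 (_ : u' \in V) euu'; rewrite inE fu' eqxx => /(_ isT) V0.
have dVC : [disjoint V & C].
  rewrite disjoints_subset; apply/subsetP=> v; rewrite !inE => /eqP->.
  by rewrite !inE eqxx.
have : nb e u (V :|: C) <= r by apply: leq_trans (deg u); apply: nbS; apply: subsetT.
by rewrite nbU //; move: V0; clear; lia.
Qed.

(** Average over the [s - 1] vertices of [W]. If [y] is private to some [u] in [N], then [bad] gives
    it another neighbour in the class [t], which can only be [t1]. So the private sets of the
    vertices of [N] together embed in the neighbourhood of [t1], and a vertex outside [N] must
    exceed the average. *)
Let exists_private : exists w', [/\ f w' = Some t, w' \notin N & r - 2 <= #|solo e W C w'|].
Proof.
have [/existsP[u /and3P[/eqP fu uN lt]]|/existsPn none] := boolP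
   [exists u, [&& f u == Some t, u \notin N & 2 * (r - 2) < nb e u C + #|solo e W C u|]].
  by exists u; split=> //; move: (nbC fu) lt r9; clear; lia.
have t1t := Nt t1N.
have domW y : y \in C -> 0 < nb e y W.
  move=> yC; have [u [nu fu eyu]] := domt t1N yC.
  by apply: nb_gt0 eyu; rewrite !inE nu fu eqxx.
have := solo_sum sym_e domW; rewrite (bigID [in N]) /= cC.
have le2 : \sum_(u in W | u \notin N) (nb e u C + #|solo e W C u|) <= #|W :\: N| * (2 * (r - 2)).
  rewrite -sum_nat_const (eq_bigl [in W :\: N]); last by move=> u; rewrite in_setD andbC.
  apply: leq_sum => u /setDP[/setD1P[_ uW] uN].
  have fu : f u == Some t by rewrite inE in uW.
  by have := none u; rewrite fu uN /= -leqNgt.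
have le1 : \sum_(u in W | u \in N) (nb e u C + #|solo e W C u|) <= #|W :&: N| * (r - 1) + (r - 1).
  rewrite (eq_bigl [in W :&: N]); last by move=> u; rewrite in_setI.
  rewrite big_split leq_add //=.
    rewrite -sum_nat_const; apply: leq_sum => u; rewrite in_setI => /andP[_ /Nt]; exact: nbC.
  apply: leq_trans (nbC t1t); rewrite (nbE e t1 C).
  apply: (@leq_trans (\sum_(u in W :&: N) \sum_(y in C) (e u y && (nb e y W == 1)))).
    apply: leq_sum => u _; rewrite -sum1_card [X in X <= _]big_mkcond [X in _ <= X]big_mkcond.
    by apply: leq_sum => y _; rewrite inE; case: (y \in C).
  rewrite exchange_big; apply: leq_sum => y yC /=.
  case: eqP => [ny1|_]; last by rewrite big1 // => u _; rewrite andbF.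
  have [et1y|net1y] := boolP (e t1 y).
    rewrite -[X in _ <= X]ny1 nbE big_mkcond [X in _ <= X]big_mkcond; apply: leq_sum => u _.
    by rewrite in_setI andbT sym_e; case: (u \in W); case: (u \in N).
  rewrite big1 // => u; rewrite in_setI andbT => /andP[uW uN].
  case euy : (e u y) => //; have [u' [nu'u fu' eyu']] := domt uN yC.
  have u'W : u' \in W.
    by rewrite !inE fu' eqxx andbT; apply: contraNneq net1y => <-; rewrite sym_e.
  have euy' : e y u by rewrite sym_e.
  by move: nu'u; rewrite (nb1_uniq ny1 u'W uW eyu' euy') eqxx.
have cW : #|W| + 1 = s.
  by rewrite -(nB nth) (cardsD1 t1 (cls f t)) inE t1t eqxx addnC.
have := cardsID N W; move: le1 le2 cW r9; clear.
move: #|W :&: N| #|W :\: N| #|W| (\sum_(u in W | u \in N) _) (\sum_(u in W | u \notin N) _).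
by move=> a b cw s1 s2; nia.
Qed.

(** [t1] replaces [w] in [h], [w] is absorbed by the hole at [y1] and [w'] by that at [y2], and [y1]
    and [y2] take the places of [t1] and [w'] in [t]. The result is [good], and [t2] can move to
    [h]: its only neighbour there was [w]. This contradicts [no_arc]. *)
Lemma saturated_false : False.
Proof.
have [w' [fw' w'N cS]] := exists_private.
have t1t := Nt t1N; have t2t := Nt t2N.
have [t1Q _] := NP t1N; have [t2Q _] := NP t2N.
have [t1B ewt1 t1solo] := QP t1Q; have [t2B ewt2 t2solo] := QP t2Q.
have [||y1 [y2 [y1s y2s ny12 ney12]]] :=
  @no_clique _ _ sym_e irr_e sp w' (solo e W C w').
- by move: cS r9; clear; lia.
- by move=> q; rewrite inE => /and3P[].
have [y1C w'y1] : y1 \in C /\ e w' y1 by move: y1s; rewrite inE => /and3P[? ? _].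
have [y2C w'y2] : y2 \in C /\ e w' y2 by move: y2s; rewrite inE => /and3P[? ? _].
have /CP[i1 [fy1 ni1h ni1t]] := y1C.
have hP : h \in P by rewrite !inE eqxx.
have tP : t \in P by rewrite !inE eqxx orbT.
have fPC v j : f v = Some j -> j \in P -> v \notin C.
  move=> fv jP; apply/negP=> /CP[i]; rewrite fv => -[[<-] nh nt].
  by move: jP; rewrite -[_ \in _]negbK nP nh nt.
have w't1 : w' != t1 by apply: contraNneq w'N => ->.
have w't2 : w' != t2 by apply: contraNneq w'N => ->.
pose f1 := upd f w None; pose fa := upd f1 t1 (Some h); pose g0 := upd fa y1 None.
have ne_col u v i j : f u = Some i -> f v = Some j -> i != j -> u != v.
  by move=> fu fv; apply: contraNneq => uv; move: fv; rewrite -uv fu => -[->].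
have y1t1 : y1 != t1 by apply: (ne_col _ _ _ _ fy1 t1t).
have y1w : y1 != w by apply: (ne_col _ _ _ _ fy1 fw).
have t1w : t1 != w by apply: (ne_col _ _ _ _ t1t fw).
have pfa : proper_col e fa.
  apply: proper_upd => //; first exact: proper_updN.
  move=> v nv; rewrite /f1 /upd; case: eqP => // nvw fv.
  by apply/negP=> /(t1solo _ fv).
have g0w : g0 w = None by rewrite /g0 /fa /f1 /upd eq_sym (negbTE y1w) eq_sym (negbTE t1w) eqxx.
have g0K v i : i \notin P -> g0 v = Some i <-> v != y1 /\ f v = Some i.
  move=> iP; rewrite /g0 /fa /f1 /upd; case: (eqVneq v y1) => [_|nv]; first by split=> // -[].
  case: (eqVneq v t1) => [->|_].
    by rewrite t1t; split=> [[hi]|[_ [ti]]]; move: iP; rewrite -?hi -?ti ?hP ?tP.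
  case: (eqVneq v w) => [->|_]; last by split=> [//|[]].
  by rewrite fw; split=> // -[_ [hi]]; move: iP; rewrite -hi hP.
have g0h v : g0 v = Some h <-> v = t1 \/ v != w /\ f v = Some h.
  rewrite /g0 /fa /f1 /upd; case: (eqVneq v y1) => [->|nv].
    by split=> // -[yt|[_]]; [rewrite yt eqxx in y1t1|rewrite fy1 => -[ih]; rewrite ih eqxx in ni1h].
  case: (eqVneq v t1) => [->|nvt]; first by split=> // _; left.
  case: (eqVneq v w) => [->|_]; first by split=> // -[wt|[]//]; rewrite wt eqxx in t1w.
  by split=> [?|[vt|[]//]]; [right|rewrite vt eqxx in nvt].
have g0t v : g0 v = Some t <-> v != t1 /\ f v = Some t.
  rewrite /g0 /fa /f1 /upd; case: (eqVneq v y1) => [->|nv].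
    by split=> // -[_]; rewrite fy1 => -[it]; rewrite it eqxx in ni1t.
  case: (eqVneq v t1) => [->|nvt]; first by split=> [[ht]|[]//]; have := nth; rewrite ht eqxx.
  case: (eqVneq v w) => [->|_]; last by split=> [//|[]].
  by rewrite fw; split=> // -[_ [ht]]; have := nth; rewrite ht eqxx.
have small g : (forall v j, j \in P -> g v = Some j -> g0 v = Some j) -> #|colored_in g P| < 2 * s.
  move=> gP; have : #|colored_in g P| <= #|V :\ w :|: cls f t|.
    apply: subset_leq_card; apply/subsetP=> v /colored_inP[j gv jP]; have := gP _ _ jP gv.
    move: jP; rewrite !inE => /orP[]/eqP->; first by case/g0h=> [->|[-> ->]]; rewrite ?t1t eqxx ?orbT.
    by case/g0t=> _ ->; rewrite eqxx orbT.
  have := (leq_card_setU (V :\ w) (cls f t)).1; rewrite (nB nth).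
  by have := cV; rewrite (cardsD1 w V) inE fw eqxx; clear; lia.
have dom0 g : (forall v j, j \in P -> v != y1 -> v != y2 -> g0 v = Some j -> g v = Some j) ->
   forall v j, v \in C -> j \in P -> exists2 u, g u = Some j & e v u.
  move=> gP v j vC jP.
  have gP' u : g0 u = Some j -> g u = Some j.
    move=> g0u; apply: (gP _ _ jP) => //.
      by apply/eqP=> uy; move: g0u; rewrite uy /g0 upd_same.
    apply/eqP=> uy; case/set2P: jP g0u => ->; rewrite uy.
      case/g0h=> [yt|[_ fy2]]; last by have := fPC _ _ fy2 hP; rewrite y2C.
      by have := fPC _ _ t1t tP; rewrite -yt y2C.
    by case/g0t=> _ fy2; have := fPC _ _ fy2 tP; rewrite y2C.
  case/set2P: jP gP' => -> gP'.
    by have [u hu evu] := domA vC; exists u => //; apply/gP'/g0h.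
  by have [u [nu fu evu]] := domt t1N vC; exists u => //; apply/gP'/g0t.
have i1P : i1 \notin P by rewrite nP ni1h.
have colC g : (forall v i, i \notin P -> g v = Some i -> f v = Some i) ->
    colored_in g (~: P) \subset C.
  move=> gK; apply/subsetP=> v /colored_inP[i gv]; rewrite in_setC => iP.
  by apply/colored_inP; exists i; rewrite ?in_setC //; apply: gK gv.
have faK i : i \notin P -> #|cls fa i| = s.
  move=> iP; rewrite -(@nB i); last by move: iP; rewrite nP => /andP[].
  apply: eq_card => v; rewrite !inE /fa /f1 /upd.
  case: (eqVneq v t1) => [->|_]; first by rewrite t1t !(inj_eq Some_inj); move: iP; rewrite !inE !(eq_sym i) negb_or => /andP[/negbTE-> /negbTE->].
  case: (eqVneq v w) => [->|//]; rewrite fw (inj_eq Some_inj).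
  by move: iP; rewrite !inE (eq_sym i) negb_or => /andP[/negbTE->].
have [|||||| g1 [pg1 g1out g1in g1c]] := @insert2 _ _ r s sym_e irr_e sp r9 g0 P i1 w _ P2 i1P.
- exact: proper_updN.
- by rewrite inE g0w.
- move=> i j iP jP v /(g0K _ _ iP)[_ fv]; apply: dom0 jP => //.
  by apply/CP; exists i; move: iP; rewrite nP => /andP[].
- move=> i iP; rewrite card_upd_none ?faK //.
  by rewrite /fa /f1 !upd_neq.
- exact: small.
(* At least five neighbours of [w] lie in [N], hence in the class [t], so at most [r - 5] lie in
   [C]. *)
- have : colored_in g0 (~: P) \subset C by apply: colC => v i iP /(g0K _ _ iP)[].
  move/(nbS e w) => le; apply: leq_ltn_trans le _.
  have dCN : [disjoint C & N].
    rewrite disjoint_sym disjoints_subset; apply/subsetP=> v /Nt fv.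
    by rewrite in_setC; apply: fPC fv tP.
  have : nb e w (C :|: N) <= r.
    by apply: leq_trans (deg w); apply: nbS; apply: subsetT.
  rewrite nbU //.
  have -> : nb e w N = #|N|.
    apply: eq_card => v; rewrite [LHS]in_set andb_idr // => /NP[/QP[]] //.
  by move: N5 r9; clear; lia.
have g1P := insert_keep g1out g1in; have g1N := insert_None g1out g1in.
have g1S := insert_Some g1out.
have [i2 g1y2 i2P] : exists2 i, g1 y2 = Some i & i \notin P.
  have /CP[i [fy2 nih nit]] := y2C.
  have : y2 \in colored_in g1 (~: P).
    apply: g1in; apply/orP; right; apply/colored_inP; exists i; last by rewrite in_setC nP nih.
    by apply/g0K; rewrite ?nP ?nih // eq_sym.
  by case/colored_inP=> i' ? ; rewrite in_setC; exists i'.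
pose g2 := upd g1 y2 None.
have g2P v j : j \in P -> g2 v = Some j <-> g0 v = Some j.
  move=> jP; rewrite /g2 /upd; case: (eqVneq v y2) => [->|_].
    split=> // g0y2; have : g1 y2 = Some j; last by rewrite g1y2 => -[ij]; rewrite ij jP in i2P.
    by apply/g1P => //; split=> //; apply/eqP=> yw; rewrite yw g0w in g0y2.
  by split=> [/(g1P _ _ jP)[]//|g0v]; apply/g1P => //; split=> //; apply/eqP=> vw; rewrite vw g0w in g0v.
have g0w' : g0 w' = Some t by apply/g0t.
have g2w' : g2 w' = Some t by apply/g2P.
have g2C v i : i \notin P -> g2 v = Some i -> v = w \/ [/\ v \in C, v != y1 & v != y2].
  move=> iP; rewrite /g2 /upd; case: (eqVneq v y2) => // nv g1v.
  case: (g1S _ _ iP g1v) => [|[i' g0v i'P]]; [by left|right].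
  have [nvy1 fv] := (g0K _ _ i'P).1 g0v; split=> //.
  by apply/CP; exists i'; move: i'P; rewrite nP => /andP[].
have [|||||| g3 [pg3 g3out g3in g3c]] := @insert2 _ _ r s sym_e irr_e sp r9 g2 P i2 w' _ P2 i2P.
- exact: proper_updN.
- by rewrite inE g2w' inE tP.
- move=> i j iP jP v /(g2C _ _ iP)[->|[vC _ _]]; last first.
    by apply: dom0 jP => // v' j' j'P _ _ g0v'; apply/g2P.
  case/set2P: (jP) => ->; first by exists t1 => //; apply/g2P => //; apply/g0h; left.
  by exists t2 => //; apply/g2P => //; apply/g0t.
- by move=> i iP; rewrite card_upd_none // g1c.
- by apply: small => v j jP /(g2P _ _ jP).
(* [w'] is outside [Q]: not being adjacent to [t1], it would otherwise belong to [N]. So it has a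
   neighbour [u0] in [V] other than [w]; with [y1] and [y2] three neighbours lie outside the classes
   used. *)
- have w'B : w' \in B by rewrite (inB fw').
  have w'Q : w' \notin Q.
    apply/negP=> w'Q; case/negP: w'N; rewrite /N in_set w'Q; apply/existsP; exists t1.
    by rewrite t1Q eq_sym w't1 (pf fw' t1t).
  have [u0 [nu0w fu0 ewu0]] := nonsolo w'B w'Q.
  have u0C := fPC _ _ fu0 hP.
  pose X := [set y1; y2; u0].
  have cX : #|X| = 3.
    by rewrite /X setUC cardsU1 cards2 ny12 !inE negb_or; case: eqP => [uy|_]; [rewrite uy y1C in u0C|case: eqP => [uy|_ //]; rewrite uy y2C in u0C].
  have dX : [disjoint colored_in g2 (~: P) & X].
    rewrite disjoints_subset; apply/subsetP=> v /colored_inP[i g2v]; rewrite (in_setC i) => iP.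
    rewrite !inE !negb_or; case: (g2C _ _ iP g2v) => [->|[vC -> ->]]; last by apply: contraNneq u0C => <-.
    rewrite eq_sym y1w (eq_sym w u0) nu0w andbT /=; apply: contraTneq y2C => <-.
    exact: fPC fw hP.
  have : nb e w' (colored_in g2 (~: P) :|: X) <= r.
    by apply: leq_trans (deg w'); apply: nbS; apply: subsetT.
  rewrite nbU //; have -> : nb e w' X = 3.
    rewrite -cX; apply: eq_card => v; rewrite [LHS]in_set andb_idr // !inE.
    by case/orP=> [/orP[]|] /eqP->.
  by move=> le; rewrite ltn_subRL (leq_trans _ le) // addnC addn3 addn2.
have g3P := insert_keep g3out g3in; have g3N := insert_None g3out g3in.
have g3h v : g3 v = Some h <-> v = t1 \/ v != w /\ f v = Some h.
  split=> [/(g3P _ _ hP)[_ /(g2P _ _ hP)/g0h]//|hv].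
  apply/g3P => //; split; last by apply/g2P/g0h.
  case: hv => [->|[_ fv]]; first by rewrite eq_sym.
  by apply: contraTneq isT => vw; move: fv; rewrite vw fw' => -[th]; have := nth; rewrite th eqxx.
have g3t v : g3 v = Some t <-> [/\ v != w', v != t1 & f v = Some t].
  split=> [/(g3P _ _ tP)[nv /(g2P _ _ tP)/g0t[? ?]]//|[? ? ?]].
  by apply/g3P => //; split=> //; apply/g2P => //; apply/g0t.
have notw' y : y \in C -> y != w'.
  by move=> yC; apply: contraTneq yC => ->; apply: fPC fw' tP.
have g2y1 : g2 y1 = None.
  rewrite /g2 upd_neq // g1out //; first by rewrite /g0 upd_same.
  by rewrite inE /g0 upd_same.
have g3y1 : g3 y1 = None.
  by rewrite g3out // ?notw' // inE g2y1.
have g3y2 : g3 y2 = None.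
  by rewrite g3out // ?notw' // ?inE /g2 upd_same.
have g3x v : g3 v = None -> [\/ v = x, v = y1 | v = y2].
  case/g3N=> _; rewrite /g2 /upd; case: (eqVneq v y2) => [->|nv2]; first by constructor 3.
  case/g1N=> nvw; rewrite /g0 /fa /f1 /upd; case: (eqVneq v y1) => [->|nv1]; first by constructor 2.
  case: (eqVneq v t1) => // _; rewrite (negbTE nvw) => /eqP; rewrite fN => /eqP->; by constructor 1.
pose g4 := upd (upd g3 y1 (Some t)) y2 (Some t).
have g4E v : v != y1 -> v != y2 -> g4 v = g3 v by move=> n1 n2; rewrite /g4 !upd_neq.
have g3xN : g3 x = None.
  have fx : f x = None by apply/eqP; rewrite fN.
  have xw' : x != w' by apply: contraTneq isT => xw; rewrite xw fw' in fx.
  have xw : x != w by apply: contraTneq isT => xw; rewrite xw fw in fx.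
  have g0x : g0 x = None.
    rewrite /g0 /fa /f1 /upd; case: eqP => // _.
    by case: eqP => [xt|_]; [rewrite xt t1t in fx|case: eqP].
  have g2x : g2 x = None by rewrite /g2 /upd; case: eqP => // _; rewrite g1out // inE g0x.
  by rewrite g3out // inE g2x.
have xy y : y \in C -> x != y.
  by move=> /CP[i [fy _ _]]; rewrite eq_sym -fN fy.
have g4g : good e s x g4 h.
  split.
  - apply: proper_upd => //; first apply: proper_upd => //.
      move=> v _ /g3t[nvw' nvt1 fv]; apply: contra nvw' => eyv; apply/eqP.
      by apply: (soloP sym_e y1s) => //; rewrite !inE ?w't1 ?nvt1 ?fw' ?fv eqxx.
    move=> v nv; rewrite /upd; case: eqP => [-> _|_]; first by rewrite sym_e.
    move=> /g3t[nvw' nvt1 fv]; apply: contra nvw' => eyv; apply/eqP.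
    by apply: (soloP sym_e y2s) => //; rewrite !inE ?w't1 ?nvt1 ?fw' ?fv eqxx.
  - move=> v; rewrite /g4 /upd; case: (eqVneq v y2) => [->|nv2].
      by rewrite (eq_sym y2) (negbTE (xy _ y2C)).
    case: (eqVneq v y1) => [->|nv1]; first by rewrite (eq_sym y1) (negbTE (xy _ y1C)).
    apply/eqP/eqP=> [/g3x[]// vy|->//]; first by rewrite vy eqxx in nv1.
    by rewrite vy eqxx in nv2.
  - move=> i; rewrite card_upd_some; last by rewrite upd_neq // eq_sym.
    rewrite card_upd_some //.
    have [iP|iP] := boolP (i \in P); last first.
      rewrite g3c //; move: iP; rewrite nP !(eq_sym i) => /andP[/negbTE-> /negbTE->].
      by rewrite !addn0.
    case/set2P: iP => ->; rewrite eqxx ?(negbTE nth) 1?eq_sym ?(negbTE nth) /=.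
      have -> : cls g3 h = t1 |: (V :\ w).
        apply/setP=> v; rewrite !inE; apply/eqP/orP=> [/g3h[->|[-> ->]]|].
        + by left.
        + by right; rewrite eqxx.
        + by case=> [/eqP->|/andP[nv /eqP fv]]; apply/g3h; [left|right].
      rewrite cardsU1 !inE t1t; have -> : (Some t == Some h) = false by apply/eqP=> -[th]; have := nth; rewrite th eqxx.
      by have := cV; rewrite (cardsD1 w V) inE fw eqxx andbF /=; clear; lia.
    have -> : cls g3 t = (cls f t :\ t1) :\ w'.
      apply/setP=> v; rewrite !inE; apply/eqP/and3P=> [/g3t[-> -> ->]//|[? ? /eqP ?]].
      by apply/g3t.
    have := nB nth; rewrite (cardsD1 t1) (cardsD1 w' (_ :\ _)) !inE t1t fw' w't1 eqxx /=.
    by clear; lia.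
have : movable e g4 t h.
  apply/movableP; exists t2.
    have nt2y y : y \in C -> t2 != y by move=> yC; apply: contraTneq yC => <-; apply: fPC t2t tP.
    by rewrite g4E ?nt2y //; apply/g3t; split=> //; rewrite eq_sym.
  move=> v; rewrite /g4 /upd; case: eqP => [_ [th]|_]; first by have := nth; rewrite th eqxx.
  case: eqP => [_ [th]|_]; first by have := nth; rewrite th eqxx.
  case/g3h=> [->|[nvw fv]]; first exact: (pf t2t t1t).
  by apply: contra nvw => et2v; apply/eqP; apply: t2solo.
by apply/negP; apply: (no_arc sym_e irr_e sp r9 deg dx noeq g4g).
Qed.

End Final.

Lemma saturated_contra : False.
Proof.
have [t1 t1N] : exists t1, t1 \in N by apply/card_gt0P; move: N5; clear; lia.
have [t2 t2N] : exists t2, t2 \in N :\ t1.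
  by apply/card_gt0P; have := N5; rewrite (cardsD1 t1 N) t1N; clear; lia.
have [[/QP[/BP[t ft1 _] _ _] _]] := NP t1N.
case/setD1P: t2N => nt12 t2N; apply: (@saturated_false t t1 t2) => // q qN.
have [[/QP[/BP[i fq _] _ _] _]] := NP qN.
by rewrite fq (one_class qN t1N fq ft1).
Qed.

End Saturated.

(* A vertex [w] of the small class with [r] neighbours outside has many private
   neighbours, of which at most three are adjacent to all others.  Swapping one
   of the remaining ones with [w] must not create an arc into the small class. *)
Lemma no_good : False.
Proof. by have [w [fw nbw cQ]] := exists_saturated; apply: (saturated_contra fw nbw cQ). Qed.

End Stuck.

(** * Induction on the edges, and reduction of arbitrary orders *)

Lemma nb_imset (T U : finType) (e : rel T) (i : U -> T) (X : {set U}) (v : T) :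
  injective i -> nb e v (i @: X) = #|[set u in X | e v (i u)]|.
Proof.
move=> inj_i; rewrite -(card_imset _ inj_i); apply: eq_card => u.
rewrite inE; apply/andP/imsetP => [[/imsetP[u' u'X ->] evu']|[u']].
  by exists u'; rewrite // inE u'X.
by rewrite inE => /andP[u'X evu'] ->; rewrite imset_f.
Qed.

Lemma sparse_inj (T U : finType) (e : rel T) (i : U -> T) :
  injective i -> sparse e -> sparse (fun u v => e (i u) (i v)).
Proof.
move=> inj_i [sp1 sp2].
have E (X Y : {set U}) : \sum_(x in X) nb (fun u v => e (i u) (i v)) x Y = \sum_(x in i @: X) nb e x (i @: Y).
  rewrite big_imset /=; last exact: in2W.
  by apply: eq_bigr => x _; rewrite nb_imset.
split=> [X|X Y dXY]; rewrite E -!(card_imset _ inj_i); first exact: sp1.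
by apply: sp2; rewrite imset_disjoint //; apply: in2W.
Qed.

Lemma exists_low (T : finType) (e : rel T) (X : {set T}) :
  sparse e -> X != set0 -> exists2 x, x \in X & nb e x X <= 6.
Proof.
move=> sp X0; have [/existsP[x /andP[xX lex]]|/existsPn none] :=
  boolP [exists x, (x \in X) && (nb e x X <= 6)]; first by exists x.
have : \sum_(x in X) 7 <= \sum_(x in X) nb e x X.
  by apply: leq_sum => x xX; have := none x; rewrite xX /= -ltnNge.
move/leq_trans/(_ (sp.1 X)); rewrite sum_nat_const mulnC leq_mul2r cards_eq0.
by rewrite (negbTE X0).
Qed.

Section Divisible.
Variables (T : finType) (r s : nat).
Hypotheses (r9 : 9 <= r) (cT : #|T| = r * s).

(** Boolean on finite functions, so that the existence of an equitable colouring can be decided. *)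
Definition eqcol (e : rel T) (c : {ffun T -> 'I_r}) : bool :=
  [forall u, [forall v, e u v ==> (c u != c v)]] && [forall i, #|[set v | c v == i]| == s].

Lemma eqcol_exists (e : rel T) : symmetric e -> irreflexive e -> sparse e ->
  (forall v, nb e v setT <= r) -> exists c, eqcol e c.
Proof.
have [m] := ubnP #|[set p : T * T | e p.1 p.2]|.
elim: m e => // m IH e /ltnSE le_m sym_e irr_e sp deg.
have [/existsP //|/existsPn nocol] := boolP [exists c, eqcol e c].
have noeq (f : T -> option 'I_r) : proper_col e f ->
    (forall v, f v <> None) -> (forall i, #|cls f i| = s) -> False.
  move=> pf fN sz; have r0 : 0 < r by move: r9; clear; lia.
  pose c := [ffun v => odflt (Ordinal r0) (f v)].
  have fc v : f v = Some (c v) by rewrite ffunE; case fv: (f v) => //; case: (fN v).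
  case/negP: (nocol c); apply/andP; split.
    apply/forallP=> u; apply/forallP=> v; apply/implyP=> euv.
    by apply/eqP=> cuv; have := pf u v (c u); rewrite !fc cuv euv => /(_ erefl erefl).
  apply/forallP=> i; rewrite -(sz i); apply/eqP/eq_card => v.
  by rewrite !inE fc (inj_eq Some_inj).
(* The vertex [x] is sought among the non-isolated ones, so that deleting its edges lowers their
   number. All its neighbours are in [X], so its degree in [X] is its full degree. *)
pose X := [set v | 0 < nb e v setT].
have [X0|X0] := eqVneq X set0.
  exfalso; have ne u v : e u v = false.
    apply/negP=> euv; have : u \in X by rewrite inE; apply: nb_gt0 euv; rewrite inE.
    by rewrite X0 inE.
  have cE : #|T| = #|{: 'I_r * 'I_s}| by rewrite cT card_prod !card_ord.
  pose b v := enum_val (cast_ord cE (enum_rank v)).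
  have bK : cancel b (fun p => enum_val (cast_ord (esym cE) (enum_rank p))).
    by move=> v; rewrite /b enum_valK cast_ordK enum_rankK.
  have bij_b : bijective b.
    exists (fun p => enum_val (cast_ord (esym cE) (enum_rank p))) => // p.
    by rewrite /b enum_valK cast_ordKV enum_rankK.
  apply: (noeq (fun v => Some (b v).1)) => // [u v i _ _|i]; first by rewrite ne.
  rewrite (_ : cls _ _ = b @^-1: [set p | p.1 == i]); last first.
    by apply/setP=> v; rewrite !inE (inj_eq Some_inj).
  rewrite on_card_preimset; last by apply: onW_bij.
  rewrite (_ : [set p | _] = setX [set i] setT); first by rewrite cardsX cards1 cardsT card_ord mul1n.
  by apply/setP=> -[a a']; rewrite !inE andbT.
have [x xX dxX] := exists_low sp X0.
have dx : nb e x setT <= 6.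
  apply: leq_trans dxX; apply: subset_leq_card; apply/subsetP=> u.
  rewrite !inE /= => exu; rewrite exu andbT; apply: (nb_gt0 (u := x)); rewrite ?inE //.
  by rewrite sym_e.
pose e' u v := [&& e u v, u != x & v != x].
have nbe' u Y : nb e' u Y <= nb e u Y.
  by apply: subset_leq_card; apply/subsetP=> v; rewrite !inE => /andP[-> /andP[->]].
have [|||||c] := IH e'.
- apply: leq_trans le_m; apply: proper_card; apply/properP; split.
    by apply/subsetP=> -[u v]; rewrite !inE => /andP[].
  move: xX; rewrite inE => /nb_gt0P[u _ exu].
  by exists (x, u); rewrite inE //= /e' exu eqxx.
- by move=> u v; rewrite /e' sym_e; case: (u != x); case: (v != x).
- by move=> u; rewrite /e' irr_e.
- split=> [Y|Y Z dYZ].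
    by apply: leq_trans (sp.1 Y); apply: leq_sum => y _; apply: nbe'.
  by apply: leq_trans (sp.2 _ _ dYZ); apply: leq_sum => y _; apply: nbe'.
- by move=> v; apply: leq_trans (deg v); apply: nbe'.
move=> /andP[/forallP pc /forallP szc].
pose f v := if v == x then None else Some (c v).
exfalso; apply: (@no_good T e r s x sym_e irr_e sp r9 deg dx noeq f (c x)).
split.
- move=> u v i; rewrite /f; case: eqP => // /eqP nux [<-]; case: eqP => // /eqP nvx [cuv].
  apply/negP=> euv; have /forallP/(_ v) := pc u.
  by rewrite /e' euv nux nvx cuv eqxx.
- by move=> v; rewrite /f; case: (v == x).
- move=> i; rewrite -[in RHS](eqP (szc i)) [in RHS](cardsD1 x) inE addnC; congr (_ + _).
  by apply: eq_card => v; rewrite !inE /f; case: (v == x); rewrite ?(inj_eq Some_inj).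
Qed.

End Divisible.

Lemma nb_inj (T U : finType) (e : rel T) (i : U -> T) (v : U) (n : nat) :
  injective i -> nb e (i v) setT <= n -> nb (fun u v => e (i u) (i v)) v setT <= n.
Proof.
move=> inj_i; apply: leq_trans; apply: leq_trans (nbS _ _ (subsetT (i @: setT))).
by rewrite nb_imset.
Qed.

(* Remove [l] vertices of small degree successively, colour the rest, and put the
   removed vertices back into distinct classes. *)
Lemma few_extra (r q l : nat) (T : finType) (e : rel T) :
  9 <= r -> l + 6 <= r -> #|T| = r * q + l ->
  symmetric e -> irreflexive e -> sparse e -> (forall v, nb e v setT <= r) ->
  exists (c : T -> 'I_r) (D : {set 'I_r}),
    [/\ forall u v, e u v -> c u != c v, #|D| = l
      & forall i, #|[set v | c v == i]| = q + (i \in D)].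
Proof.
move=> r9; elim: l T e => [|l IH] T e lr cT sym_e irr_e sp deg.
  rewrite addn0 in cT.
  have [c /andP[/forallP pc /forallP szc]] := eqcol_exists r9 cT sym_e irr_e sp deg.
  exists c, set0; split=> [u v euv||i]; last by rewrite inE addn0 (eqP (szc i)).
    by have /forallP/(_ v) := pc u; rewrite euv.
  by rewrite cards0.
have T0 : [set: T] != set0 by rewrite -card_gt0 cardsT cT addnS.
have [w _ dw] := exists_low sp T0.
pose U := {v : T | v != w}.
pose e' (u v : U) := e (val u) (val v).
have [||||||c [D [pc cD szc]]] := IH U e'.
- by move: lr; clear; lia.
- by have := cardC1 w; rewrite card_sig cT addnS.
- by move=> u v; apply: sym_e.
- by move=> u; apply: irr_e.
- by apply: sparse_inj sp; apply: val_inj.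
- by move=> v; apply: nb_inj; [apply: val_inj|apply: deg].
(* The classes to avoid: the [l] that already received a removed vertex, and those of the at most
   six neighbours of [w]. *)
pose F := D :|: [set c u | u in [set u | e w (val u)]].
have [i iF] : exists i, i \notin F.
  have cF : #|F| < r.
    apply: (@leq_ltn_trans (l + 6)); last by move: lr; clear; lia.
    apply: leq_trans (leq_card_setU _ _) _; rewrite cD leq_add2l.
    apply: leq_trans (leq_imset_card _ _) _; apply: leq_trans dw.
    apply: leq_trans (nbS _ _ (subsetT (val @: [set: U]))).
    rewrite nb_imset; last exact: val_inj.
    by apply: subset_leq_card; apply/subsetP=> u; rewrite !inE.
  have : [exists i, i \notin F]; last by move/existsP.
  rewrite -negb_forall; apply: contraL cF => /forallP h; rewrite -leqNgt.
  by rewrite -[X in X <= _](card_ord r); apply: subset_leq_card; apply/subsetP=> i _.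
pose c' (v : T) := if insub v is Some u then c u else i.
have c'w : c' w = i by rewrite /c' insubF ?eqxx.
have c'U u : c' (val u) = c u by rewrite /c' valK.
have valU v : v != w -> exists u : U, v = val u by move=> nv; exists (exist _ v nv).
move: iF; rewrite inE negb_or => /andP[iD iN].
have iNw u : e w (val u) -> i != c u.
  by move=> ewu; apply: contraNneq iN => ->; apply: imset_f; rewrite inE.
exists c', (i |: D); split.
- move=> u v; case: (eqVneq u w) => [->|/valU[u' ->]].
    case: (eqVneq v w) => [->|/valU[v' ->]]; first by rewrite irr_e.
    by rewrite c'w c'U; apply: iNw.
  case: (eqVneq v w) => [->|/valU[v' ->]].
    by rewrite c'w c'U sym_e eq_sym; apply: iNw.
  by rewrite !c'U; apply: pc.
- by rewrite cardsU1 iD cD.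
- move=> j; rewrite (cardsD1 w) inE c'w.
  have -> : [set v | c' v == j] :\ w = val @: [set u | c u == j].
    apply/setP=> v; apply/idP/imsetP=> [|[u uj ->]].
      by rewrite !inE => /andP[/valU[u ->]]; rewrite c'U => cu; exists u; rewrite ?inE.
    by rewrite !inE (valP u) c'U; move: uj; rewrite inE.
  rewrite card_imset; last exact: val_inj.
  rewrite szc !inE addnCA; congr (_ + _); rewrite (eq_sym j).
  by case: eqP => [<-|_] //=; rewrite (negbTE iD).
Qed.

Section JoinClique.
Variables (T : finType) (e : rel T) (p : nat).

Definition add_clique : rel (T + 'I_p) := fun u v =>
  match u, v with
  | inl u', inl v' => e u' v'
  | inr i, inr j => i != j
  | _, _ => false
  end.

Let L (X : {set T + 'I_p}) := [set v | inl v \in X].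
Let R (X : {set T + 'I_p}) := [set i | inr i \in X].

Let sumLR (X : {set T + 'I_p}) (F : T + 'I_p -> nat) :
  \sum_(u in X) F u = \sum_(u in L X) F (inl u) + \sum_(i in R X) F (inr i).
Proof.
rewrite big_mkcond big_sumType /= -!big_mkcond /=; congr (_ + _).
  by apply: eq_bigl => u; rewrite inE.
by apply: eq_bigl => u; rewrite inE.
Qed.

Let cLR (X : {set T + 'I_p}) : #|X| = #|L X| + #|R X|.
Proof. by rewrite -!sum1_card sumLR. Qed.

Let nbL u (X : {set T + 'I_p}) : nb add_clique (inl u) X = nb e u (L X).
Proof. by rewrite !nbE sumLR /= [X in _ + X]big1 // addn0. Qed.

Let nbR i (X : {set T + 'I_p}) : nb add_clique (inr i) X = #|R X :\ i|.
Proof.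
rewrite nbE sumLR /= big1 ?add0n // -sum1_card big_mkcond [RHS]big_mkcond.
by apply: eq_bigr => j _; rewrite in_setD1 andbC eq_sym; case: (j \in R X); case: (j != i).
Qed.

(** Degrees in the clique are at most 6, and [a * b <= 2 * (a + b)] whenever [a + b <= 7]. The union
    is disjoint, so the bounds add up. *)
Lemma add_clique_sparse : p <= 7 -> sparse e -> sparse add_clique.
Proof.
move=> p7 sp; split=> [X|X Y dXY].
  rewrite sumLR cLR mulnDr; apply: leq_add.
    by under eq_bigr => u _ do rewrite nbL; apply: sp.1.
  rewrite mulnC -sum_nat_const; apply: leq_sum => i iR; rewrite nbR.
  have : #|R X| <= p by rewrite -[X in _ <= X](card_ord p); apply: max_card.
  by rewrite (cardsD1 i) iR; move: p7; clear; lia.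
rewrite sumLR !cLR.
have dL : [disjoint L X & L Y].
  rewrite disjoints_subset; apply/subsetP=> u; rewrite !inE => uX.
  by rewrite (disjointFr dXY).
have dR : [disjoint R X & R Y].
  rewrite disjoints_subset; apply/subsetP=> u; rewrite !inE => uX.
  by rewrite (disjointFr dXY).
under eq_bigr => u _ do rewrite nbL.
have := sp.2 _ _ dL.
have : \sum_(i in R X) nb add_clique (inr i) Y <= #|R X| * #|R Y|.
  rewrite -sum_nat_const; apply: leq_sum => i _; rewrite nbR.
  by apply: subset_leq_card; apply: subsetDl.
have : #|R X| + #|R Y| <= 7.
  apply: leq_trans p7; rewrite -[X in _ <= X](card_ord p).
  have := (leq_card_setU (R X) (R Y)).2; rewrite dR => /eqP <-.
  exact: max_card.
move: #|R X| #|R Y| (\sum_(i in R X) _) (\sum_(u in L X) _) #|L X| #|L Y|.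
move=> a b s1 s2 c d; case: a => [|[|[|[|[|[|[|[|a]]]]]]]] //; lia.
Qed.

Lemma add_clique_sym : symmetric e -> symmetric add_clique.
Proof. by move=> sym_e [u|i] [v|j] //=; rewrite eq_sym. Qed.

Lemma add_clique_irr : irreflexive e -> irreflexive add_clique.
Proof. by move=> irr_e [u|i] //=; rewrite eqxx. Qed.

Lemma add_clique_deg r : p <= r -> (forall v, nb e v setT <= r) ->
  forall v, nb add_clique v setT <= r.
Proof.
move=> pr deg [u|i]; first by rewrite nbL (leq_trans _ (deg u)) // nbS ?subsetT.
rewrite nbR (leq_trans _ pr) // -[X in _ <= X](card_ord p).
exact: max_card.
Qed.

End JoinClique.

Theorem sparse_equitable (T : finType) (e : rel T) (r : nat) :
  9 <= r -> symmetric e -> irreflexive e -> sparse e ->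
  (forall v, nb e v setT <= r) ->
  exists c : T -> 'I_r, (forall u v, e u v -> c u != c v) /\
    (forall i j, #|[set v | c v == i]| <= #|[set v | c v == j]| + 1).
Proof.
move=> r9 sym_e irr_e sp deg.
have r0 : 0 < r by move: r9; clear; lia.
have cT := divn_eq #|T| r; rewrite mulnC in cT.
set q := _ %/ _ in cT; set l := _ %% _ in cT.
have lr : l < r by rewrite ltn_mod.
have [small|large] := leqP (l + 6) r.
  have [c [D [pc _ szc]]] := few_extra r9 small cT sym_e irr_e sp deg.
  exists c; split=> // i j; rewrite !szc; move: (i \in D) (j \in D) => [] []; clear; lia.
(* Here [r - l <= 5]. The vertices of the added clique lie in distinct classes, so its removal
   leaves classes of sizes [q] and [q.+1]. *)
have cT' : #|{: T + 'I_(r - l)}| = r * q.+1.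
  by rewrite card_sum card_ord mulnS cT; move: lr; clear; lia.
have [||||c /andP[/forallP pc /forallP szc]] := eqcol_exists r9 cT' (e := add_clique e (p := r - l)).
- exact: add_clique_sym.
- exact: add_clique_irr.
- by apply: add_clique_sparse => //; move: large; clear; lia.
- by apply: add_clique_deg => //; apply: leq_subr.
have pc' u v : add_clique e u v -> c u != c v.
  by move=> euv; have /forallP/(_ v) := pc u; rewrite euv.
exists (fun v => c (inl v)); split=> [u v euv|]; first exact: pc'.
suff sz i : q <= #|[set v | c (inl v) == i]| <= q.+1.
  by move=> i j; have := sz i; have := sz j; clear; lia.
have /eqP := szc i; rewrite -sum1_card big_mkcond big_sumType /=.
have -> : \sum_(v : T) (if inl v \in [set v | c v == i] then 1 else 0) = #|[set v | c (inl v) == i]|.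
  by rewrite -sum1_card [RHS]big_mkcond; apply: eq_bigr => v _; rewrite !inE.
have -> : \sum_(v : 'I_(r - l)) (if inr v \in [set v | c v == i] then 1 else 0) = #|[set v | c (inr v) == i]|.
  by rewrite -sum1_card [RHS]big_mkcond; apply: eq_bigr => v _; rewrite !inE.
have : #|[set v | c (inr v) == i]| <= 1.
  apply/card_le1_eqP => a b; rewrite !inE => /eqP ca /eqP cb; apply/eqP.
  apply: contraT => nba; have := pc' (inr b) (inr a); rewrite /= ca cb eqxx.
  by rewrite ?nba 1?eq_sym ?nba => /(_ isT).
move=> b1 ab; rewrite -ltnS -ab leq_addr andbT -addn1 leq_add2l.
exact: b1.
Qed.

(** * Minors of cell complexes *)

Lemma odd_sum (I : finType) (A : {set I}) (F : I -> nat) :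
  odd (\sum_(i in A) F i) = odd #|[set i in A | odd (F i)]|.
Proof.
rewrite -sum1_card [X in _ = odd X]big_mkcond [in LHS]big_mkcond.
rewrite !(big_morph odd oddD (erefl _)); apply: eq_bigr => i _.
by rewrite inE; case: (i \in A) => //=; case: (odd (F i)).
Qed.

Lemma sum_cardI (I J : finType) (A : {set I}) (B : {set J}) (X : J -> {set I}) :
  \sum_(j in B) #|X j :&: A| = \sum_(i in A) #|[set j in B | i \in X j]|.
Proof.
transitivity (\sum_(j in B) \sum_(i in A) (i \in X j)).
  apply: eq_bigr => j _; rewrite -sum1_card big_mkcond [RHS]big_mkcond.
  by apply: eq_bigr => i _; rewrite inE; case: (i \in X j); case: (i \in A).
rewrite exchange_big; apply: eq_bigr => i _; rewrite -sum1_card big_mkcond [RHS]big_mkcond.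
by apply: eq_bigr => j _; rewrite inE; case: (i \in X j); case: (j \in B).
Qed.

Lemma card2_set2 (I : finType) (A : {set I}) a b :
  #|A| = 2 -> a \in A -> b \in A -> a != b -> A = [set a; b].
Proof.
move=> A2 aA bA nab; apply/esym/eqP; rewrite eqEcard A2 cards2 nab andbT.
by apply/subsetP=> i /set2P[]->.
Qed.

(** * Spanning forests of a graph or of its dual *)

Section Forest.
Variables (V E : finType) (en : E -> {set V}) (A : pred E) (e0 : E).
Hypothesis en2 : forall e, #|en e| = 2.

(** [en] will be either the ends of an edge or the two faces beside it. An end of an edge of [A] is
    adjacent to itself, which does not affect connectivity. *)
Definition adj : rel V := fun u v => [exists e, [&& A e, u \in en e & v \in en e]].

Lemma adj_sym : symmetric adj.
Proof. by move=> u v; apply: eq_existsb => e; rewrite (andbC (u \in _)). Qed.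

Lemma adj_connect_sym : connect_sym adj.
Proof. exact/sym_connect_sym/adj_sym. Qed.

Definition rep (v : V) : V := root adj v.

Lemma rep_connect u v : (rep u == rep v) = connect adj u v.
Proof. by rewrite /rep root_connect //; apply: adj_connect_sym. Qed.

Lemma rep_adj u v : adj u v -> rep u = rep v.
Proof. by move=> auv; apply/eqP; rewrite rep_connect connect1. Qed.

Lemma rep_rep v : rep (rep v) = rep v.
Proof. by apply: root_root; apply: adj_connect_sym. Qed.

Let layer n := iter n (fun X : {set V} => X :|: [set v | [exists u in X, adj u v]])
                 [set v | rep v == v].

Let layer_connect v : exists n, v \in layer n.
Proof.
have: connect adj (rep v) v by rewrite adj_connect_sym connect_root.
case/connectP=> p + ->; have: rep v \in layer 0 by rewrite inE rep_rep.
elim: p (rep v) 0 => [|w p IH] u n un /=; first by exists n.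
case/andP=> auw pth; apply: (IH _ n.+1) => //.
by rewrite /layer iterS !inE; apply/orP; right; apply/existsP; exists u; rewrite un.
Qed.

(* A breadth-first spanning forest: every vertex [v] that is not a root is
   joined to its parent [(g v).2] by the edge [(g v).1]. *)
Lemma forest : exists (d : V -> nat) (g : V -> E * V), forall v, rep v != v ->
  [/\ A (g v).1, en (g v).1 = [set v; (g v).2], d (g v).2 < d v & rep (g v).2 = rep v].
Proof.
pose d v := ex_minn (layer_connect v).
have dP v : v \in layer (d v) by rewrite /d; case: ex_minnP.
have dmin v m : v \in layer m -> d v <= m by rewrite /d; case: ex_minnP => k _; apply.
have H v : exists p : E * V, rep v != v ->
    [/\ A p.1, en p.1 = [set v; p.2], d p.2 < d v & rep p.2 = rep v].
  have [rv|nrv] := eqVneq (rep v) v; first by exists (e0, v).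
  have := dP v; case dv: (d v) => [|n] vn; first by rewrite inE (negbTE nrv) in vn.
  have vNn : v \notin layer n by apply/negP=> /dmin; rewrite dv ltnn.
  move: vn; rewrite /layer iterS in_setU (negbTE vNn) /= inE => /existsP[u /andP[un auv]].
  case/existsP: (auv) => e /and3P[Ae ue ve].
  have nvu : v != u by apply: contraNneq vNn => ->.
  exists (e, u) => _; split=> //=; last exact: rep_adj.
    exact: card2_set2.
  by rewrite ltnS; apply: dmin.
have [g gP] := fin_all_exists H.
by exists d, g.
Qed.

(** Two vertices with the same parent edge would be parents of each other, against the decrease of
    [d]. *)
Lemma forest_inj (d : V -> nat) (g : V -> E * V) : (forall v, rep v != v ->
   [/\ A (g v).1, en (g v).1 = [set v; (g v).2], d (g v).2 < d v & rep (g v).2 = rep v]) ->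
  {in [set v | rep v != v] &, injective (fun v => (g v).1)}.
Proof.
move=> gP u v; rewrite !inE => /gP[_ eu du _] /gP[_ ev dv _] guv.
have: [set u; (g u).2] = [set v; (g v).2] by rewrite -eu -ev guv.
move=> E1; have: u \in [set v; (g v).2] by rewrite -E1 !inE eqxx.
case/set2P=> // uv; have: v \in [set u; (g u).2] by rewrite E1 !inE eqxx.
case/set2P=> // vu; move: du dv; rewrite -uv -vu => h1 h2.
by move: (ltn_trans h1 h2); rewrite ltnn.
Qed.

End Forest.

(** * Edge bounds for minors by merging faces *)

Section Euler.
Variables (V E F T : finType) (en : E -> {set V}) (sd : E -> {set F}).
Hypotheses (en2 : forall e, #|en e| = 2) (sd2 : forall e, #|sd e| = 2).
Hypothesis boundary : forall f v, ~~ odd #|[set e | (f \in sd e) && (v \in en e)]|.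
Hypothesis connF : forall f g, connect (adj sd predT) f g.
Hypothesis euler : #|E| <= #|V| + #|F|.
Variable phi : V -> T.

Definition inner : pred E := [pred e | [forall u in en e, forall v in en e, phi u == phi v]].

Hypothesis branch : forall u v, phi u = phi v -> connect (adj en inner) u v.
Variable M : {set E}.
Hypothesis M2 : forall e, e \in M -> #|phi @: en e| = 2.
Hypothesis M_inj : {in M &, injective (fun e => phi @: en e)}.

Section Nonempty.
Variable e0 : E.

Let inner_set1 e : inner e -> exists t, forall v, v \in en e -> phi v = t.
Proof.
move/forall_inP => h; have /card_gt0P[u ue] : 0 < #|en e| by rewrite en2.
by exists (phi u) => v ve; have /forall_inP/(_ _ ue)/eqP := h _ ve.
Qed.

Let M_inner e : e \in M -> ~~ inner e.
Proof.
move=> eM; apply/negP=> /inner_set1[t ht].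
have := M2 eM; have : #|phi @: en e| <= #|[set t]|.
  by apply: subset_leq_card; apply/subsetP=> _ /imsetP[v ve ->]; rewrite inE ht.
by rewrite cards1 => le1 E2; rewrite E2 in le1.
Qed.

Section WithForest.
Variables (d : V -> nat) (g : V -> E * V).
Let NR := [set v | rep en inner v != v].
Hypothesis gP : forall v, rep en inner v != v ->
  [/\ inner (g v).1, en (g v).1 = [set v; (g v).2], d (g v).2 < d v
    & rep en inner (g v).2 = rep en inner v].
Let S := (fun v => (g v).1) @: NR.
Let H := S :|: M.

Let SP e : e \in S -> exists2 v, v \in NR & e = (g v).1.
Proof. by case/imsetP=> v vN ->; exists v. Qed.

Let S_inner e : e \in S -> inner e.
Proof. by case/SP=> v; rewrite inE => /gP[ge _ _ _] ->. Qed.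

(* [H] is a spanning forest of the branch sets together with the minor edges. *)
Let cH : #|V| + #|M| <= #|H| + #|T|.
Proof.
have dSM : [disjoint S & M].
  rewrite disjoints_subset; apply/subsetP=> e /S_inner ie; rewrite inE.
  by apply/negP=> /M_inner; rewrite ie.
have -> : #|H| = #|S| + #|M| by have := (leq_card_setU S M).2; rewrite dSM => /eqP.
rewrite addnAC leq_add2r /S card_in_imset; last exact: forest_inj gP.
rewrite -(cardsC NR) leq_add2l -(card_in_imset (f := phi) (D := ~: NR)) ?max_card //.
move=> u v; rewrite !inE !negbK => /eqP ru /eqP rv /branch.
by rewrite -rep_connect ru rv => /eqP.
Qed.

(** Faces merged across all edges outside [H]; the classes stand for the faces of the drawing of
    [H]. *)
Let repF := rep sd (fun e => e \notin H).

(** A spanning forest of the merged faces consists of dual edges outside [H], so at least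
    [#|F| - #|~: H|] classes remain; [cH] and the Euler inequality finish the count. *)
Let cF : #|M| <= #|[set f | repF f == f]| + #|T|.
Proof.
have [d' [g' g'P]] := @forest _ _ sd (fun e => e \notin H) e0 sd2.
have : #|[set f | repF f != f]| <= #|~: H|.
  rewrite -(card_in_imset (forest_inj g'P)); apply: subset_leq_card.
  by apply/subsetP=> _ /imsetP[f + ->]; rewrite inE in_setC => /g'P[].
have -> : [set f | repF f != f] = ~: [set f | repF f == f] by apply/setP=> f; rewrite !inE.
have := cardsC H; have := cardsC [set f | repF f == f]; move: cH euler; clear; lia.
Qed.

Section Face.
Variable c : F.
Let C := [set f | repF f == c].
(** The boundary mod 2 of the merged face [C]: the edges with exactly one side in it. *)
Let z e := odd #|sd e :&: C|.
Let sides := \sum_(e in M) #|sd e :&: C|.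

Let zH e : z e -> e \in H.
Proof.
move=> ze; apply: contraT => eH; move: ze; rewrite /z.
have [/existsP[f /andP[fe fC]]|/existsPn none] := boolP [exists f, (f \in sd e) && (f \in C)].
  suff -> : sd e :&: C = sd e by rewrite sd2.
  apply/setIidPl/subsetP=> f' f'e; rewrite inE; move: fC; rewrite inE => /eqP <-.
  apply/eqP/rep_adj/existsP; exists e; by rewrite eH f'e.
by rewrite (_ : sd e :&: C = set0) ?cards0 //; apply/setP=> f; rewrite inE (negbTE (none f)) inE.
Qed.

(** A boundary is a cycle: the parity hypothesis [boundary] is summed over the faces of [C]. *)
Let even_at v : ~~ odd #|[set e | z e && (v \in en e)]|.
Proof.
have := sum_cardI C [set e | v \in en e] sd.
move/(congr1 odd); rewrite odd_sum.
have -> : [set e in [set e | v \in en e] | odd #|sd e :&: C|] = [set e | z e && (v \in en e)].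
  by apply/setP=> e; rewrite !inE andbC.
move=> ->; rewrite odd_sum (_ : [set f in C | _] = set0) ?cards0 //.
apply/setP=> f; rewrite !inE; apply/negP=> /andP[_]; apply/negP.
rewrite (_ : [set e in _ | _] = [set e | (f \in sd e) && (v \in en e)]) //.
by apply/setP=> e; rewrite !inE andbC.
Qed.

Let even_cut U : ~~ odd #|[set e | z e && odd #|en e :&: U|]|.
Proof.
have := sum_cardI U [set e | z e] en.
move/(congr1 odd); rewrite odd_sum.
have -> : [set e in [set e | z e] | odd #|en e :&: U|] = [set e | z e && odd #|en e :&: U|].
  by apply/setP=> e; rewrite !inE.
move=> ->; rewrite odd_sum (_ : [set v in U | _] = set0) ?cards0 //.
apply/setP=> v; rewrite !inE; apply/negP=> /andP[_]; apply/negP.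
rewrite (_ : [set e in _ | _] = [set e | z e && (v \in en e)]); first exact: even_at.
by apply/setP=> e; rewrite !inE.
Qed.

Let par u := if u \in NR then (g u).2 else u.

Let d_par n u : d (iter n par u) <= d u.
Proof.
elim: n u => // n IH u; rewrite iterSr; apply: leq_trans (IH _) _.
by rewrite /par; case: ifP => //; rewrite inE => /gP[_ _ /ltnW].
Qed.

(** A cycle mod 2 inside a forest vanishes. [U] consists of the descendants of [v], and the edge
    from [v] to its parent is the only forest edge leaving [U], against [even_cut]. *)
Let tree_zero : (forall e, e \in M -> ~~ z e) -> forall e, ~~ z e.
Proof.
move=> Mz e; apply/negP=> ze; have := zH ze; case/setUP=> [/SP[v vN ev]|/Mz]; last by rewrite ze.
pose U := [set u | fconnect par u v].
have vN' : rep en inner v != v by move: vN; rewrite inE.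
have [_ Ev dv _] := gP vN'.
have nvp : v != (g v).2 by apply: contraTneq dv => <-; rewrite ltnn.
have pU : (g v).2 \notin U.
  rewrite inE; apply/negP=> /iter_findex it; have := d_par (findex par (g v).2 v) (g v).2.
  by rewrite it leqNgt dv.
have vU : v \in U by rewrite inE connect0.
have := even_cut U; rewrite (_ : [set e | _] = [set e]) ?cards1 //.
apply/setP=> e'; rewrite !inE; apply/andP/eqP=> [[ze' oe']|->]; last first.
  rewrite ev; split; first by rewrite -ev.
  rewrite Ev (_ : [set v; _] :&: U = [set v]) ?cards1 //.
  apply/setP=> u; rewrite in_setI in_set2 in_set1; case: eqP => [->|_] //=.
  by case: eqP => [->|_] //=; rewrite (negbTE pU).
have := zH ze'; case/setUP=> [/SP[u uN eu]|/Mz]; last by rewrite ze'.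
have uN' : rep en inner u != u by move: uN; rewrite inE.
have [_ Eu du _] := gP uN'; case: (eqVneq u v) => [uv|nuv]; first by rewrite eu ev uv.
have pu : par u = (g u).2 by rewrite /par uN.
have nup : u != (g u).2 by apply: contraTneq du => <-; rewrite ltnn.
have Uu : (u \in U) = ((g u).2 \in U).
  rewrite !inE; apply/idP/idP=> [fuv|]; last first.
    by apply: connect_trans; rewrite -pu fconnect1.
  have := iter_findex fuv; case: (findex par u v) => [|n] /=; first by move=> uv; rewrite uv eqxx in nuv.
  by rewrite -iterS iterSr pu => <-; apply: fconnect_iter.
move: oe'; rewrite eu Eu; case uU: (u \in U).
  rewrite (setIidPl _) ?cards2 ?nup //.
  by apply/subsetP=> w /set2P[]->; rewrite -?Uu uU.
rewrite (_ : _ :&: _ = set0) ?cards0 //; apply/setP=> w; rewrite in_setI in_set2 in_set0.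
by case: eqP => [->|_] /=; [rewrite uU|case: eqP => [->|_] //=; rewrite -Uu uU].
Qed.

(** The boundary remains a cycle after contracting the branch sets, since forest edges never cross
    the preimage of [B]. *)
Let even_branch (B : {set T}) :
  ~~ odd #|[set e in M | z e && odd #|phi @: en e :&: B|]|.
Proof.
have := even_cut (phi @^-1: B).
rewrite (_ : [set e | _] = [set e in M | z e && odd #|phi @: en e :&: B|]) //.
apply/setP=> e; rewrite !inE.
have [eM|eM] := boolP (e \in M).
  congr (_ && _); congr odd.
  have inj : {in en e &, injective phi}.
    by apply/imset_injP; rewrite M2 // en2.
  rewrite -(card_in_imset (f := phi) (D := en e :&: phi @^-1: B)); last first.
    by move=> u v /setIP[ue _] /setIP[ve _]; apply: inj.
  apply: eq_card => t; apply/imsetP/setIP=> [[v /setIP[ve vB] ->]|[/imsetP[v ve ->] vB]].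
    by rewrite imset_f //; move: vB; rewrite inE.
  by exists v; rewrite // !inE ve.
rewrite /=; apply/negP=> /andP[ze]; apply/negP.
have := zH ze; case/setUP=> [/S_inner/inner_set1[t ht]|]; last by rewrite (negbTE eM).
case tB: (t \in B).
  rewrite (setIidPl _) ?en2 //; apply/subsetP=> v ve; by rewrite inE ht.
rewrite (_ : _ :&: _ = set0) ?cards0 //; apply/setP=> v; rewrite !inE.
by case ve: (v \in en e) => //=; rewrite ht.
Qed.

Let Z := [set e in M | z e].

(** Without boundary edges [C] is closed under adjacency of faces, hence contains every face, and
    both sides of each edge of [M] count. *)
Let all_sides : c = repF c -> Z = set0 -> sides = 2 * #|M|.
Proof.
move=> cc Z0; have zF : forall e, ~~ z e.
  apply: tree_zero => e eM; apply/negP=> ze.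
  by have : e \in Z; [rewrite inE eM|rewrite Z0 inE].
suff CT : C = setT.
  rewrite /sides CT mulnC -sum_nat_const; apply: eq_bigr => e _.
  by rewrite setIT sd2.
have closedC f f' : adj sd predT f f' -> f \in C -> f' \in C.
  case/existsP=> e /and3P[_ fe f'e] fC; case: (eqVneq f f') => [<-//|nff'].
  move: (zF e); rewrite /z (card2_set2 (sd2 e) fe f'e nff').
  case f'C: (f' \in C) => //; rewrite (_ : _ :&: C = [set f]) ?cards1 //.
  apply/setP=> w; rewrite in_setI in_set2 in_set1; case: eqP => [->|_] //=.
  by case: eqP => [->|_] //=; rewrite f'C.
apply/setP=> f; rewrite in_setT; have /connectP[p pth ->] := connF c f.
have : c \in C by rewrite inE -cc.
elim: p (c) pth => //= f1 p IH f2 /andP[a12 pth] f2C.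
by apply: IH => //; apply: closedC a12 f2C.
Qed.

Let Z_sides : #|Z| <= sides.
Proof.
rewrite /sides /Z -sum1_card big_mkcond [X in _ <= X]big_mkcond; apply: leq_sum => e _.
by rewrite inE; case: (e \in M) => //=; rewrite /z; case: #|sd e :&: C| => //= n; case: ifP.
Qed.

Let Z_other e t : e \in Z -> t \in phi @: en e -> exists e', [/\ e' \in Z, e' != e & t \in phi @: en e'].
Proof.
move=> eZ te; have := even_branch [set t].
rewrite (_ : [set e in M | _] = [set e in Z | t \in phi @: en e]); last first.
  apply/setP=> e'; rewrite !inE andbA; congr (_ && _).
  case te': (t \in phi @: en e').
    by rewrite (setIidPr _) ?cards1 // sub1set.
  by rewrite (_ : _ :&: _ = set0) ?cards0 //; apply/eqP; rewrite setI_eq0 disjoint_sym disjoints1 te'.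
rewrite (cardsD1 e) in_set eZ te /=.
case: (posnP #|[set e in Z | t \in phi @: en e] :\ e|) => [->//|/card_gt0P[e']].
rewrite in_setD1 [e' \in [set _ in _ | _]]in_set => /and3P[ne e'Z te'] _.
by exists e'.
Qed.

(** The cycle continues from [e1] at both of its ends, and by [M_inj] not with one and the same
    edge. *)
Let Z3 : Z != set0 -> 3 <= #|Z|.
Proof.
case/set0Pn=> e1 e1Z; have e1M : e1 \in M by move: e1Z; rewrite inE => /andP[].
have /cards2P[a [b [nab Eab]]] : #|phi @: en e1| == 2 by rewrite M2.
have [|e2 [e2Z n21 ae2]] := @Z_other e1 a e1Z; first by rewrite Eab !inE eqxx.
have [|e3 [e3Z n31 be3]] := @Z_other e1 b e1Z; first by rewrite Eab !inE eqxx orbT.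
have n23 : e2 != e3.
  apply: contraNneq n21 => e23; have e2M : e2 \in M by move: e2Z; rewrite inE => /andP[].
  by apply/eqP/M_inj => //; rewrite Eab; apply: card2_set2 => //; rewrite ?M2 // e23.
have -> : 3 = #|[set e1; e2; e3]| by rewrite setUC cardsU1 cards2 !inE negb_or (eq_sym e3 e2) n31 n23 eq_sym n21.
by apply: subset_leq_card; apply/subsetP=> e; rewrite !in_setU !in_set1 => /orP[/orP[]|] /eqP->.
Qed.

Lemma face_sides : c = repF c -> 2 <= #|M| -> 3 <= sides.
Proof.
move=> cc m2; have [/(all_sides cc) ->|/Z3 z3] := eqVneq Z set0; first by move: m2; clear; lia.
exact: leq_trans z3 Z_sides.
Qed.

Lemma face_sides_bip (B : {set T}) : (forall e, e \in M -> #|phi @: en e :&: B| = 1) ->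
  c = repF c -> 2 <= #|M| -> 4 <= sides.
Proof.
move=> MB cc m2; have [/(all_sides cc) ->|/Z3 z3] := eqVneq Z set0; first by move: m2; clear; lia.
(* All of [M] crosses [B], so the boundary has an even number of edges of [M], and 3 improves to
   4. *)
have := even_branch B; rewrite (_ : [set e in M | _] = Z); last first.
  by apply/setP=> e; rewrite !inE; case eM: (e \in M) => //=; rewrite MB // andbT.
move: z3 => + ev; rewrite leq_eqVlt => /predU1P[c3|z4]; last exact: leq_trans z4 Z_sides.
by rewrite -c3 in ev.
Qed.

End Face.

(** Every edge of [M] has two sides, so [k] times the number of merged faces is at most [2 * #|M|];
    this is inserted in [cF]. *)
Lemma faces_bound k : 2 <= #|M| ->
  (forall c, c = repF c -> k <= \sum_(e in M) #|sd e :&: [set f | repF f == c]|) ->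
  k * #|M| <= 2 * #|M| + k * #|T|.
Proof.
move=> m2 hk; have le : k * #|[set f | repF f == f]| <= 2 * #|M|.
  rewrite mulnC -sum_nat_const.
  apply: (@leq_trans (\sum_(c in [set f | repF f == f]) \sum_(e in M) #|sd e :&: [set f | repF f == c]|)).
    by apply: leq_sum => c; rewrite inE => /eqP rc; apply: hk.
  rewrite exchange_big mulnC -sum_nat_const; apply: leq_sum => e _ /=.
  rewrite -[X in _ <= X](sd2 e) -[X in _ <= X]sum1_card.
  rewrite [X in _ <= X](partition_big repF [in [set f | repF f == f]]) /=.
    apply: leq_sum => c _; rewrite -sum1_card; apply: eq_leq; apply: eq_bigl => f.
    by rewrite !inE.
  by move=> f _; rewrite inE /repF rep_rep.
apply: leq_trans (_ : k * (#|[set f | repF f == f]| + #|T|) <= _).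
  by rewrite leq_mul2l cF orbT.
by rewrite mulnDr leq_add2r.
Qed.

End WithForest.

Let small_M k : 1 <= k -> #|M| < 2 -> #|M| <= k * #|T|.
Proof.
move=> k1; case: (posnP #|M|) => [->//|/card_gt0P[e /M2 c2]].
have : 2 <= #|T| by rewrite -c2 max_card.
by move=> T2 m2; apply: leq_trans (_ : 1 * 1 <= _); [|apply: leq_mul => //; apply: leq_trans T2].
Qed.

Lemma nonempty_bound : #|M| <= 3 * #|T|.
Proof.
have [m2|m2] := leqP 2 #|M|; last exact: small_M.
have [d [g gP]] := forest inner e0 en2.
have := faces_bound gP m2 (fun c cc => face_sides gP cc m2).
by clear; lia.
Qed.

Lemma nonempty_bound_bip (B : {set T}) :
  (forall e, e \in M -> #|phi @: en e :&: B| = 1) -> #|M| <= 2 * #|T|.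
Proof.
move=> MB; have [m2|m2] := leqP 2 #|M|; last exact: small_M.
have [d [g gP]] := forest inner e0 en2.
have := faces_bound gP m2 (fun c cc => face_sides_bip gP MB cc m2).
by clear; lia.
Qed.

End Nonempty.

Theorem minor_bound : #|M| <= 3 * #|T|.
Proof.
case: (posnP #|M|) => [->//|/card_gt0P[e0 _]]; exact: nonempty_bound.
Qed.

Theorem minor_bound_bip (B : {set T}) :
  (forall e, e \in M -> #|phi @: en e :&: B| = 1) -> #|M| <= 2 * #|T|.
Proof.
case: (posnP #|M|) => [->//|/card_gt0P[e0 _]]; exact: nonempty_bound_bip.
Qed.

End Euler.

(** * Subdivided triangulations *)

Section Lattice.
Variables (n N : nat).

Definition lat := {ffun 'I_n -> 'I_N.+1}.
Implicit Types (b c : lat) (i j k : 'I_n) (A : {set 'I_n}).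

Definition mass b : nat := \sum_i b i.
Definition supp b : {set 'I_n} := [set i | 0 < b i].
(** [inord] gives the true value only while coordinates stay at most [N]; hence the hypotheses
    [mass b < N] below. *)
Definition inc b i : lat := [ffun j => inord (b j + (j == i))].
Definition dec b i : lat := [ffun j => inord (b j - (j == i))].

Lemma le_mass b i : b i <= mass b.
Proof. by rewrite /mass (bigD1 i) //= leq_addr. Qed.

Lemma latP b c : (forall i, b i = c i :> nat) -> b = c.
Proof. by move=> h; apply/ffunP=> i; apply/val_inj/h. Qed.

Lemma incE b i j : mass b < N -> inc b i j = b j + (j == i) :> nat.
Proof.
move=> ltN; rewrite ffunE inordK // ltnS.
have := le_mass b j; case: (j == i); move: ltN; clear; lia.
Qed.

Lemma decE b i j : dec b i j = b j - (j == i) :> nat.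
Proof. by rewrite ffunE inordK // (leq_ltn_trans (leq_subr _ _)). Qed.

Lemma mass_inc b i : mass b < N -> mass (inc b i) = (mass b).+1.
Proof.
move=> ltN; rewrite /mass (eq_bigr (fun j => b j + (j == i))); last by move=> j _; rewrite incE.
rewrite big_split /= [X in _ + X](bigD1 i) //= eqxx [X in _ + (_ + X)]big1 ?addn1 //.
by move=> j /negbTE->.
Qed.

Lemma supp_inc b i : mass b < N -> supp (inc b i) = i |: supp b.
Proof.
move=> ltN; apply/setP=> j; rewrite !inE incE // addn_gt0 orbC.
by case: (j == i).
Qed.

Lemma decK b i : i \in supp b -> mass (dec b i) < N -> inc (dec b i) i = b.
Proof.
move=> ib ltN; apply: latP => j; rewrite incE // decE subnK //.
by case: eqP => [->|_] //; rewrite inE in ib.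
Qed.

Lemma mass_dec b i : i \in supp b -> (mass (dec b i)).+1 = mass b.
Proof.
rewrite inE => ib; rewrite /mass (bigD1 i) // [RHS](bigD1 i) //= decE eqxx subn1.
rewrite -addSn prednK //; congr (_ + _); apply: eq_bigr => j /negbTE ji.
by rewrite decE ji subn0.
Qed.

Lemma supp_dec b i : supp (dec b i) \subset supp b.
Proof. by apply/subsetP=> j; rewrite !inE decE; case: (j == i) => /=; lia. Qed.

Lemma inc_inj b c i : mass b < N -> mass c < N -> inc b i = inc c i -> b = c.
Proof.
move=> bN cN E; apply: latP => j; apply: (@addIn (j == i)).
by rewrite -!incE // E.
Qed.

Lemma inc_inj2 b i j : mass b < N -> inc b i = inc b j -> i = j.
Proof.
move=> bN E; have := incE i i bN; rewrite E incE // eqxx.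
by case: (eqVneq i j) => // _ /addnI.
Qed.

Lemma incC b i j : (mass b).+1 < N -> inc (inc b i) j = inc (inc b j) i.
Proof.
move=> bN; have bN' := ltnW bN; apply: latP => k.
by rewrite !incE ?mass_inc // -!addnA (addnC (k == i : nat)).
Qed.

Definition slice m A : {set lat} := [set b | (mass b == m) && (supp b \subset A)].

Lemma in_slice m A b : (b \in slice m A) = (mass b == m) && (supp b \subset A).
Proof. by rewrite in_set. Qed.

(** Pascal's rule: the coordinate [k] is zero, or one unit can be taken from it. *)
Lemma sliceS m A k : k \in A -> m < N ->
  #|slice m.+1 A| = #|slice m.+1 (A :\ k)| + #|slice m A|.
Proof.
move=> kA mN; rewrite -(cardsID [set b | k \in supp b] (slice m.+1 A)) addnC.
congr (_ + _).
  apply: eq_card => b; rewrite in_setD /slice !in_set subsetD1 in_set.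
  by case: (0 < b k); rewrite ?andbF ?andbT.
rewrite -[RHS](card_in_imset (f := inc ^~ k)); last first.
  move=> b c; rewrite !in_slice => /andP[/eqP bm _] /andP[/eqP cm _]; apply: inc_inj; by rewrite ?bm ?cm.
apply: eq_card => b; rewrite inE; apply/andP/imsetP=> [[]|[c]].
  rewrite in_slice in_set => /andP[/eqP bm bA] kb.
  have dm := mass_dec kb; rewrite bm in dm; case: dm => dm.
  exists (dec b k); last by rewrite decK // dm.
  by rewrite in_slice dm eqxx /=; apply: subset_trans (supp_dec b k) bA.
rewrite in_slice => /andP[/eqP cm cA] ->; rewrite in_slice in_set mass_inc ?cm // eqxx /=.
by rewrite supp_inc ?cm // subUset sub1set kA cA setU11.
Qed.

Lemma slice_set0 m : #|slice m.+1 set0| = 0.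
Proof.
apply: eq_card0 => b; rewrite in_slice subset0; apply/negP=> /andP[/eqP bm /eqP b0].
move: bm; rewrite /mass big1 // => i _; apply/eqP; rewrite -leqn0 leqNgt.
apply/negP=> bi; have : i \in (set0 : {set 'I_n}) by rewrite -b0 inE.
by rewrite inE.
Qed.

Lemma slice0 A : #|slice 0 A| = 1.
Proof.
rewrite -(cards1 ([ffun=> ord0] : lat)); apply: eq_card => b; rewrite in_slice inE.
apply/andP/eqP=> [[/eqP bm _]|->].
  apply: latP => i; rewrite ffunE /=; apply/eqP.
  by rewrite -leqn0 -bm le_mass.
split; first by apply/eqP; rewrite /mass big1 // => i _; rewrite ffunE.
by apply/subsetP=> i; rewrite inE ffunE.
Qed.

Lemma slice1 m k : m <= N -> #|slice m [set k]| = 1.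
Proof.
elim: m => [|m IH] mN; first exact: slice0.
rewrite (sliceS (k := k)) ?inE // setDv slice_set0 add0n IH //; exact: ltnW.
Qed.

Lemma slice2 m A : #|A| = 2 -> m < N -> #|slice m.+1 A| = #|slice m A| + 1.
Proof.
move=> /eqP/cards2P[i [j [nij ->]]] mN.
rewrite (sliceS (k := i)) ?inE ?eqxx // addnC; congr (_ + _).
rewrite (_ : _ :\ i = [set j]) ?slice1 //.
by apply/setP=> l; rewrite !inE; case: (eqVneq l i) => //= ->; rewrite (negbTE nij).
Qed.

(** The slices of a triangle are counted by triangular numbers, whose second difference is 1. *)
Lemma slice3 m A : #|A| = 3 -> m.+1 < N ->
  #|slice m.+2 A| + #|slice m A| = 2 * #|slice m.+1 A| + 1.
Proof.
move=> A3 mN; have /card_gt0P[k kA] : 0 < #|A| by rewrite A3.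
have A2 : #|A :\ k| = 2 by move: A3; rewrite (cardsD1 k) kA => -[].
rewrite (sliceS kA mN) (slice2 A2 mN) (sliceS kA (ltnW mN)).
set a := #|slice m.+1 _|; set c := #|slice m A|.
by move: a c; clear; lia.
Qed.

End Lattice.

Lemma card_valP (X : finType) (P Q : pred X) :
  #|[set v : {x | P x} | Q (val v)]| = #|[set x | P x && Q x]|.
Proof.
rewrite -(card_imset _ val_inj); apply: eq_card => x; rewrite inE.
apply/imsetP/andP=> [[v + ->]|[Px Qx]]; first by rewrite inE (valP v).
by exists (exist _ x Px); rewrite ?inE.
Qed.

Lemma card2_setD1 (I : finType) (A : {set I}) (k : I) :
  #|A| = 3 -> k \in A -> #|A :\ k| = 2.
Proof. by move=> A3 kA; move: A3; rewrite (cardsD1 k) kA => -[]. Qed.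

Lemma subset2_3 (I : finType) (A B : {set I}) :
  #|A| = 2 -> #|B| = 3 -> A \subset B -> exists2 k, k \in B & A = B :\ k.
Proof.
move=> A2 B3 AB; have /card_gt0P[k] : 0 < #|B :\: A|.
  by rewrite cardsD (setIidPr AB) A2 B3.
rewrite inE => /andP[kA kB]; exists k => //; apply/eqP.
by rewrite eqEcard (card2_setD1 B3 kB) A2 leqnn andbT subsetD1 AB.
Qed.

(** * The subdivided surface as a cell complex *)

Section Complex.
Variables (n : nat) (F0 : {set {set 'I_n}}) (m : nat).
Hypothesis vertF : forall v : 'I_n, exists2 t, t \in F0 & v \in t.
Hypothesis card3 : forall t, t \in F0 -> #|t| = 3.
Hypothesis two_sides : forall s, s \in tri_edges F0 -> #|[set t in F0 | s \subset t]| = 2.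

Let N := m.+2.
Let lt := lat n N.

Definition is_vertex (b : lt) : bool :=
  (mass b == m.+2) && [exists t in F0, supp b \subset t].
(** An edge is coded by its direction [p.1] and the common part [p.2] of its two ends, so that each
    edge has a single code. *)
Definition is_edge (p : {set 'I_n} * lt) : bool :=
  [&& p.1 \in tri_edges F0, mass p.2 == m.+1
    & [exists t in F0, (p.1 \subset t) && (supp p.2 \subset t)]].
(* [(true, (t, b))] is the upward triangle [b + e_i], [i] in [t], and
   [(false, (t, b))] the downward triangle [b + e_i + e_j], [i != j] in [t]. *)
Definition is_face (f : bool * ({set 'I_n} * lt)) : bool :=
  [&& f.2.1 \in F0, supp f.2.2 \subset f.2.1 & mass f.2.2 == if f.1 then m.+1 else m].
Definition raw_ends (p : {set 'I_n} * lt) : {set lt} := [set inc p.2 i | i in p.1].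
(** The side of a downward triangle opposite to [k] has the ends [b + e_k + e_i] with [i != k],
    hence the common part [inc b k]. *)
Definition raw_inc (f : bool * ({set 'I_n} * lt)) (p : {set 'I_n} * lt) : bool :=
  (p.1 \subset f.2.1) &&
  (if f.1 then p.2 == f.2.2 else [exists k in f.2.1 :\: p.1, p.2 == inc f.2.2 k]).

Definition lvertex := {b | is_vertex b}.
Definition ledge := {p | is_edge p}.
Definition lface := {f | is_face f}.

Definition ends (e : ledge) : {set lvertex} := [set v | val v \in raw_ends (val e)].
Definition sides (e : ledge) : {set lface} := [set f | raw_inc (val f) (val e)].

Lemma tri_edgeP (s t : {set 'I_n}) :
  t \in F0 -> s \subset t -> #|s| = 2 -> s \in tri_edges F0.
Proof. by move=> tF st s2; rewrite inE s2 eqxx; apply/exists_inP; exists t. Qed.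

Lemma tri_edge2 s : s \in tri_edges F0 -> #|s| = 2.
Proof. by rewrite inE => /andP[/eqP]. Qed.

Lemma tri_edgeF s : s \in tri_edges F0 -> exists2 t, t \in F0 & s \subset t.
Proof. by rewrite inE => /andP[_ /exists_inP]. Qed.

Lemma tri_eq (X t : {set 'I_n}) : t \in F0 -> X \subset t -> #|X| = 3 -> X = t.
Proof. by move=> tF Xt X3; apply/eqP; rewrite eqEcard Xt X3 card3. Qed.

Lemma is_edge_ends p b : is_edge p -> b \in raw_ends p -> is_vertex b.
Proof.
case/and3P=> _ /eqP mp /exists_inP[t tF /andP[st bt]] /imsetP[i ip ->].
rewrite /is_vertex mass_inc mp // eqxx; apply/exists_inP; exists t => //.
by rewrite supp_inc ?mp // subUset sub1set (subsetP st).
Qed.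

Lemma ends2 e : #|ends e| = 2.
Proof.
case: e => p pe; rewrite /ends card_valP /=.
transitivity #|raw_ends p|.
  by apply: eq_card => b; rewrite inE; apply: andb_idl; apply: is_edge_ends.
have /and3P[p1 /eqP mp _] := pe.
by rewrite card_imset ?tri_edge2 // => i j; apply: inc_inj2; rewrite mp.
Qed.

(** A small edge on an edge [s] of the triangulation borders one upward triangle in each of the two
    triangles at [s]. Any other lies inside a single triangle, between an upward and a downward
    face. *)
Lemma sides2 e : #|sides e| = 2.
Proof.
case: e => [[s b] pe]; rewrite /sides (card_valP is_face (raw_inc^~ (s, b))).
have /and3P[/= sE /eqP mb /exists_inP[t0 t0F /andP[/= st0 bt0]]] := pe.
have s2 := tri_edge2 sE.
have [bs|bs] := boolP (supp b \subset s).
  rewrite -(two_sides sE) -(card_imset (f := fun t => (true, (t, b)))); last by move=> t t' [].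
  apply: eq_card => -[u [t b']]; rewrite inE.
  apply/andP/imsetP=> [[/and3P[/= tF b't mb'] /andP[/= st]]|[t']].
    case: u mb' => [mb' /eqP<-|/eqP mb' /exists_inP[k]]; first by exists t; rewrite // inE tF.
    rewrite inE => /andP[ks _] /eqP bE.
    by move: (subsetP bs k); rewrite bE supp_inc ?mb' // setU11 (negbTE ks) => /(_ isT).
  rewrite inE => /andP[t'F st'] [-> -> ->]; rewrite /is_face /raw_inc /= t'F mb !eqxx st'.
  by rewrite (subset_trans bs st').
have /subsetPn[k kb ks] := bs.
have kt0 := subsetP bt0 k kb.
have t0E : k |: s = t0.
  by apply: tri_eq => //; rewrite ?subUset ?sub1set ?kt0 // cardsU1 ks s2.
have md : mass (dec b k) = m by have := mass_dec kb; rewrite mb => -[].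
transitivity #|[set (true, (t0, b)); (false, (t0, dec b k))]|; last by rewrite cards2.
apply: eq_card => -[u [t b']]; rewrite inE.
apply/andP/set2P=> [[/and3P[/= tF b't mb'] /andP[/= st]]|].
  have tE : k \in t -> t = t0.
    by move=> kt; rewrite -t0E; apply/esym/tri_eq; rewrite // ?subUset ?sub1set ?kt // cardsU1 ks s2.
  case: u mb' => [mb' /eqP bE|/eqP mb' /exists_inP[k']].
    by rewrite -bE in b't *; left; rewrite tE //; apply: (subsetP b't).
  rewrite inE => /andP[k's k't] /eqP bE; right.
  have bt : supp b \subset t by rewrite bE supp_inc ?mb' // subUset sub1set k't.
  have tt := tE (subsetP bt k kb); rewrite tt; move: k't; rewrite tt -t0E !inE (negbTE k's) orbF.
  move=> /eqP k'k; congr (_, (_, _)); apply: (@inc_inj _ _ _ _ k); rewrite ?mb' ?md //.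
  by rewrite -[in LHS]k'k -bE decK // md.
case=> [[-> -> ->]|[-> -> ->]]; rewrite /is_face /raw_inc /= t0F st0 ?bt0 ?mb ?md !eqxx //.
rewrite (subset_trans (supp_dec b k) bt0); split=> //; apply/exists_inP; exists k.
  by rewrite inE ks.
by rewrite decK // md.
Qed.

(** A face has one side [ed k] for each [k] in [t], and a vertex is on none or on exactly two of
    these sides. *)
Lemma even_boundary f v : ~~ odd #|[set e | (f \in sides e) && (v \in ends e)]|.
Proof.
case: f => [[u [t b]] Pf]; case: v => v Pv.
have /and3P[/= tF bt /eqP mb] := Pf; have t3 := card3 tF.
pose ed k : {set 'I_n} * lt := (t :\ k, if u then b else inc b k).
have inj_ed : {in t &, injective ed}.
  move=> k k' kt k't [E _]; apply/eqP; apply: contraT => nkk'.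
  have: k' \in t :\ k by rewrite !inE eq_sym nkk'.
  by rewrite E !inE eqxx.
have -> : #|[set e | (exist _ (u, (t, b)) Pf \in sides e) && (exist _ v Pv \in ends e)]|
   = #|[set k in t | v \in raw_ends (ed k)]|.
  transitivity #|[set e : ledge | raw_inc (u, (t, b)) (val e) && (v \in raw_ends (val e))]|.
    by apply: eq_card => e; rewrite !inE.
  rewrite (card_valP is_edge (fun p => raw_inc (u, (t, b)) p && (v \in raw_ends p))).
  rewrite -(card_in_imset (f := ed)); last first.
    by move=> k k'; rewrite !inE => /andP[kt _] /andP[k't _]; apply: inj_ed.
  apply: eq_card => -[s b'']; rewrite inE; apply/and3P/imsetP=> [[]|[k]].
    move=> /and3P[/= sE _ _] /andP[/= st bE] vp.
    have [k kt sk] := subset2_3 (tri_edge2 sE) t3 st.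
    suff E : (s, b'') = ed k by exists k; rewrite // inE kt -E.
    rewrite /ed sk; congr (_, _).
    case: (u) bE => [/eqP//|/exists_inP[k']].
    by rewrite sk !inE negb_and negbK => /andP[/orP[/eqP->|/negbTE->] // _ /eqP].
  rewrite inE => /andP[kt vk] ->; split=> //.
    rewrite /is_edge /= (tri_edgeP tF (subsetDl _ _)) ?card2_setD1 //=; apply/andP; split.
      by case: (u) mb => mb; rewrite ?mass_inc mb.
    apply/exists_inP; exists t => //; rewrite subsetDl /=.
    by case: (u) mb => mb //; rewrite supp_inc ?mb // subUset sub1set kt.
  rewrite /raw_inc /= subsetDl /=; case: (u) => //.
  by apply/exists_inP; exists k; rewrite // !inE eqxx kt.
case: u mb Pf @ed {inj_ed} => mb Pf ed.
  have [/existsP[i /andP[it /eqP vi]]|/existsPn none] := boolP [exists i, (i \in t) && (v == inc b i)].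
    rewrite (_ : [set k in t | _] = t :\ i) ?card2_setD1 //.
    apply/setP=> k; rewrite !inE andbC /raw_ends /= vi; congr (_ && _).
    apply/imsetP/idP=> [[j]|nki]; last by exists i; rewrite // !inE it eq_sym nki.
    rewrite !inE => /andP[njk jt] /inc_inj2 ->; by rewrite ?mb // eq_sym.
  rewrite (_ : [set k in t | _] = set0) ?cards0 //.
  apply/setP=> k; rewrite !inE; apply/negP=> /andP[kt /imsetP[i]].
  by rewrite !inE => /andP[_ it] vi; have := none i; rewrite it vi eqxx.
have [->|/set0Pn[k0]] := eqVneq [set k in t | v \in raw_ends (ed k)] set0; first by rewrite cards0.
rewrite inE => /andP[k0t /imsetP[i0]]; rewrite !inE => /andP[n0 i0t] /= v0.
rewrite (_ : [set k in t | _] = [set k0; i0]) ?cards2 1?eq_sym ?n0 //.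
apply/setP=> k; rewrite in_set in_set2; apply/andP/idP=> [[kt /imsetP[i]]|].
  rewrite !inE => /andP[nik it] /= vE.
  have := congr1 (fun c : lt => c k : nat) (etrans (esym vE) v0).
  rewrite !incE ?mass_inc ?mb // eqxx eq_sym (negbTE nik).
  by move: (b k : nat) => x; case: (k == k0) => //; case: (k == i0) => //; clear; lia.
case/orP=> /eqP ->; split=> //; apply/imsetP; first by exists i0; rewrite // !inE n0.
exists k0; first by rewrite !inE eq_sym n0.
by rewrite v0 /=; apply: incC; rewrite mb.
Qed.

Definition peak M (i : 'I_n) : lt := [ffun j => inord (M * (j == i))].

Lemma peakE M i j : M <= N -> peak M i j = M * (j == i) :> nat.
Proof. by move=> MN; rewrite ffunE inordK // ltnS; case: (j == i); rewrite ?muln1 ?muln0. Qed.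

Lemma mass_peak M i : M <= N -> mass (peak M i) = M.
Proof.
move=> MN; rewrite /mass (bigD1 i) //= peakE // eqxx muln1 big1 ?addn0 //.
by move=> j /negbTE ji; rewrite peakE // ji muln0.
Qed.

Lemma supp_peak M i : M <= N -> supp (peak M i) \subset [set i].
Proof.
by move=> MN; apply/subsetP=> j; rewrite !inE peakE //; case: (j == i); rewrite ?muln0.
Qed.

Lemma peak_unique b i : supp b \subset [set i] -> b = peak (mass b) i.
Proof.
move=> bi; have b0 j : j != i -> b j = 0 :> nat.
  move=> ji; apply/eqP; rewrite -leqn0 leqNgt; apply: contra ji => bj.
  by rewrite -in_set1 (subsetP bi) // inE.
have mb : mass b = b i by rewrite /mass (bigD1 i) //= big1 ?addn0 // => j /b0.
have mN : mass b <= N by rewrite mb -ltnS.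
apply: latP => j; rewrite peakE // mb; case: (eqVneq j i) => [->|/b0->]; first by rewrite muln1.
by rewrite muln0.
Qed.

(** Units are moved to the coordinate [i] one at a time until the corner [peak M.+1 i] is reached.
    The invariant [K] will be the component of a face or of a vertex. *)
Lemma slide (R : Type) (K : lt -> R) (t : {set 'I_n}) M i :
  M.+1 <= N -> i \in t ->
  (forall c k, mass c = M -> supp c \subset t -> k \in t -> K (inc c k) = K (inc c i)) ->
  forall b, mass b = M.+1 -> supp b \subset t -> K b = K (peak M.+1 i).
Proof.
move=> MN it step b; have [d] := ubnP (M.+1 - b i); elim: d b => // d IH b /ltnSE le_d mb bt.
have [bi|/subsetPn[k kb]] := boolP (supp b \subset [set i]).
  by rewrite (peak_unique bi) mb.
rewrite inE => nki; have mdb : mass (dec b k) = M by have := mass_dec kb; rewrite mb => -[].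
have mdN : mass (dec b k) < N by rewrite mdb.
have kt := subsetP bt k kb; have dbt := subset_trans (supp_dec b k) bt.
rewrite -{1}(decK kb mdN) step //; apply: IH.
- rewrite incE // eqxx decE eq_sym (negbTE nki) subn0.
  have : b i < M.+1.
    rewrite -mb /mass (bigD1 i) //= -addn1 leq_add2l (bigD1 k) //= addn_gt0.
    by move: kb; rewrite inE => ->.
  by move: (b i : nat) le_d => x; clear; lia.
- by rewrite mass_inc // mdb.
- by rewrite supp_inc // subUset sub1set it.
Qed.

Section Connected.
Hypothesis linkF : forall v x y : 'I_n, [set v; x] \in tri_edges F0 ->
  [set v; y] \in tri_edges F0 -> connect (link F0 v) x y.
Hypothesis skelF : forall x y : 'I_n,
  connect (fun a b : 'I_n => [set a; b] \in tri_edges F0) x y.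

Lemma edge_in (a b : 'I_n) t : t \in F0 -> a \in t -> b \in t -> a != b ->
  [set a; b] \in tri_edges F0.
Proof.
by move=> tF at_ bt nab; apply: (tri_edgeP tF); rewrite ?cards2 ?nab // subUset !sub1set at_ bt.
Qed.

Lemma other_vertex t i : t \in F0 -> i \in t -> exists2 x, x \in t & i != x.
Proof.
move=> tF it; have /card_gt0P[x] : 0 < #|t :\ i| by rewrite card2_setD1 ?card3.
by rewrite !inE => /andP[nxi xt]; exists x; rewrite // eq_sym.
Qed.

(** The component of a face, set to [None] on codes of no face, so that no proofs of [is_face] have
    to be carried along. *)
Let kF f : option lface := omap (rep sides predT) (insub f).

Let kF_step p f g : is_edge p -> is_face f -> is_face g -> raw_inc f p -> raw_inc g p ->
  kF f = kF g.
Proof.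
move=> pe fF gF fp gp; rewrite /kF (insubT is_face fF) (insubT is_face gF) /=.
congr Some; apply: rep_adj; apply/existsP; exists (exist _ p pe).
by rewrite !inE fp gp.
Qed.

Let kF_down t c k : t \in F0 -> mass c = m -> supp c \subset t -> k \in t ->
  kF (true, (t, inc c k)) = kF (false, (t, c)).
Proof.
move=> tF mc ct kt; have mN : mass c < N by rewrite mc ltnW.
have ckt : supp (inc c k) \subset t by rewrite supp_inc // subUset sub1set kt.
apply: (@kF_step (t :\ k, inc c k)).
- rewrite /is_edge /= (tri_edgeP tF (subsetDl _ _)) ?card2_setD1 ?card3 //=.
  by rewrite mass_inc // mc eqxx; apply/exists_inP; exists t; rewrite // subsetDl.
- by rewrite /is_face /= tF ckt mass_inc // mc eqxx.
- by rewrite /is_face /= tF ct mc eqxx.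
- by rewrite /raw_inc /= subsetDl eqxx.
- rewrite /raw_inc /= subsetDl; apply/exists_inP; exists k => //.
  by rewrite !inE eqxx kt.
Qed.

Let corner t i := kF (true, (t, peak m.+1 i)).

Let kF_corner f i : is_face f -> i \in f.2.1 -> kF f = corner f.2.1 i.
Proof.
case: f => u [t b] /and3P[/= tF bt /eqP mb] it.
have up c : mass c = m.+1 -> supp c \subset t -> kF (true, (t, c)) = corner t i.
  apply: (slide (K := fun c => kF (true, (t, c)))) => // c' k mc' c't kt.
  by rewrite !kF_down.
case: u mb => mb; first exact: up.
have mN : mass b < N by rewrite mb ltnW.
rewrite -(kF_down tF mb bt it) up ?mass_inc ?mb //.
by rewrite supp_inc // subUset sub1set it.
Qed.

Let corner_face t i : t \in F0 -> i \in t -> is_face (true, (t, peak m.+1 i)).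
Proof.
move=> tF it; rewrite /is_face /= tF mass_peak // eqxx andbT.
by apply: subset_trans (supp_peak _ _) _; rewrite ?sub1set.
Qed.

Let corner_cross t t' i x : t \in F0 -> t' \in F0 -> [set i; x] \in tri_edges F0 ->
  [set i; x] \subset t -> [set i; x] \subset t' -> corner t i = corner t' i.
Proof.
move=> tF t'F ixE ixt ixt'.
have [it it'] : i \in t /\ i \in t'.
  by split; [apply: (subsetP ixt)|apply: (subsetP ixt')]; rewrite !inE eqxx.
apply: (@kF_step ([set i; x], peak m.+1 i)).
- rewrite /is_edge /= ixE mass_peak // eqxx; apply/exists_inP; exists t => //.
  by rewrite ixt; apply: subset_trans (supp_peak _ _) _; rewrite ?sub1set.
- exact: corner_face.
- exact: corner_face.
- by rewrite /raw_inc /= ixt eqxx.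
- by rewrite /raw_inc /= ixt' eqxx.
Qed.

(** Consecutive triangles around [i] share an edge at [i], and their corner faces at [i] are the two
    sides of the first small edge on it. *)
Let corner_link t t' i : t \in F0 -> t' \in F0 -> i \in t -> i \in t' ->
  corner t i = corner t' i.
Proof.
move=> tF t'F it it'; have [x xt nix] := other_vertex tF it.
have [y yt' niy] := other_vertex t'F it'.
have /connectP[p] := linkF (edge_in tF it xt nix) (edge_in t'F it' yt' niy).
elim: p t x tF it xt nix => /= [|z p IH] t x tF it xt nix.
  move=> _ yx; rewrite {}yx in yt' niy; apply: (@corner_cross _ _ i x) => //.
  - exact: edge_in tF it xt nix.
  - by rewrite subUset !sub1set it.
  - by rewrite subUset !sub1set it'.
case/andP=> ixz pth last_p; rewrite /link in ixz.
have [i2 x2 z2] : [/\ i \in [set i; x; z], x \in [set i; x; z] & z \in [set i; x; z]].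
  by rewrite !inE !eqxx ?orbT.
have niz : i != z.
  apply/eqP=> iz; have := card3 ixz; rewrite -iz setUAC setUid cards2.
  by case: (i != x).
rewrite (@corner_cross _ _ i x tF ixz) //; first exact: IH pth last_p.
- exact: edge_in tF it xt nix.
- by rewrite subUset !sub1set it.
- by rewrite subUset !sub1set i2.
Qed.

Let corner_all t t' i j : t \in F0 -> t' \in F0 -> i \in t -> j \in t' ->
  corner t i = corner t' j.
Proof.
move=> tF t'F it jt'; have /connectP[p] := skelF i j.
elim: p t i tF it => /= [|k p IH] t i tF it.
  by move=> _ ji; rewrite {}ji in jt' *; apply: corner_link.
case/andP=> ikE pth last_p; have [t2 t2F] := tri_edgeF ikE.
rewrite subUset !sub1set => /andP[it2 kt2].
rewrite (corner_link tF t2F it it2) -(IH t2 k t2F kt2 pth last_p).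
exact: (kF_corner (corner_face t2F it2) kt2).
Qed.

Lemma conn_faces f g : connect (adj sides predT) f g.
Proof.
rewrite -rep_connect; case: f g => [f fF] [g gF].
have /and3P[tf _ _] := fF; have /and3P[tg _ _] := gF.
have /card_gt0P[i it] : 0 < #|f.2.1| by rewrite card3.
have /card_gt0P[j jt] : 0 < #|g.2.1| by rewrite card3.
have := kF_corner fF it; rewrite (corner_all tf tg it jt) -(kF_corner gF jt) /kF.
by rewrite (insubT is_face fF) (insubT is_face gF) /= => -[->].
Qed.

Let kV b : option lvertex := omap (rep ends predT) (insub b).

Let kV_step t c k i : t \in F0 -> mass c = m.+1 -> supp c \subset t -> k \in t -> i \in t ->
  kV (inc c k) = kV (inc c i).
Proof.
move=> tF mc ct kt it; case: (eqVneq k i) => [->//|nki].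
have ce : is_edge ([set k; i], c).
  rewrite /is_edge /= (edge_in tF kt it nki) mc eqxx; apply/exists_inP; exists t => //.
  by rewrite ct subUset !sub1set kt it.
have end_in j : j \in [set k; i] -> inc c j \in raw_ends ([set k; i], c).
  by move=> jki; apply: imset_f.
have [kP iP] : inc c k \in raw_ends ([set k; i], c) /\ inc c i \in raw_ends ([set k; i], c).
  by split; apply: end_in; rewrite !inE eqxx ?orbT.
have vk := is_edge_ends ce kP; have vi := is_edge_ends ce iP.
rewrite /kV (insubT is_vertex vk) (insubT is_vertex vi) /=.
congr Some; apply: rep_adj; apply/existsP; exists (exist is_edge _ ce).
by rewrite !inE /= kP iP.
Qed.

Lemma conn_vertices u v : connect (adj ends predT) u v.
Proof.
rewrite -rep_connect; case: u v => [u uV] [v vV].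
have kVp b t i : is_vertex b -> t \in F0 -> supp b \subset t -> i \in t -> kV b = kV (peak N i).
  move=> /andP[/eqP mb _] tF bt it; apply: (@slide _ kV t m.+1 i) => //.
  by move=> c k mc ct kt; apply: (@kV_step t).
have peakV i t : t \in F0 -> i \in t -> is_vertex (peak N i).
  move=> tF it; rewrite /is_vertex mass_peak // eqxx; apply/exists_inP; exists t => //.
  by apply: subset_trans (supp_peak _ _) _; rewrite ?sub1set.
have peaks i j : kV (peak N i) = kV (peak N j).
  have /connectP[p] := skelF i j; elim: p i => /= [|k p IH] i; first by move=> _ ->.
  case/andP=> ikE pth last_p; rewrite -(IH k pth last_p).
  have [t tF] := tri_edgeF ikE; rewrite subUset !sub1set => /andP[it kt].
  apply: (kVp _ t) => //; first exact: peakV tF it.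
  by apply: subset_trans (supp_peak _ _) _; rewrite ?sub1set.
have kVi b : is_vertex b -> exists i, kV b = kV (peak N i).
  move=> bV; have /andP[_ /exists_inP[t tF bt]] := bV.
  have /card_gt0P[i it] : 0 < #|t| by rewrite card3.
  by exists i; apply: (kVp _ t).
have [i ui] := kVi u uV; have [j vj] := kVi v vV.
have : kV u = kV v by rewrite ui vj.
by rewrite /kV (insubT is_vertex uV) (insubT is_vertex vV) /= => -[->].
Qed.

End Connected.

(** * The Euler inequality of the subdivision *)

Section Count.
Hypothesis eulerF : #|tri_edges F0| <= n + #|F0|.

Let tau (G : {set {set 'I_n}}) (X : {set 'I_n}) := #|[set t in G | X \subset t]|.
Let te := tri_edges F0.
Let G1 : {set {set 'I_n}} := [set [set i] | i : 'I_n].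

(** Pairs of an edge and a triangle containing it, both at [i], are counted twice: a triangle has
    two edges at [i], and an edge is in two triangles. *)
Let tau1 i : tau F0 [set i] = tau te [set i].
Proof.
have two_in t : t \in F0 -> i \in t -> #|[set s in te | [set i] \subset s & s \subset t]| = 2.
  move=> tF it; rewrite -(card2_setD1 (card3 tF) it).
  rewrite -(card_in_imset (f := fun k => t :\ k)); last first.
    move=> k k' kt k't E; apply/eqP; apply: contraT => nkk'.
    have: k' \in t :\ k by case/setD1P: k't => _ k't; rewrite !inE k't andbT eq_sym.
    by rewrite E !inE eqxx.
  apply: eq_card => s; rewrite inE; apply/and3P/imsetP=> [[sE]|[k]].
    rewrite sub1set => is_ st; have [k kt sk] := subset2_3 (tri_edge2 sE) (card3 tF) st.
    exists k; rewrite // !inE kt andbT; apply: contraTneq is_ => ki.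
    by rewrite sk ki !inE eqxx.
  case/setD1P=> nki kt ->; split.
  - by apply: (tri_edgeP tF); rewrite ?subsetDl ?card2_setD1 ?card3.
  - by rewrite sub1set !inE eq_sym nki.
  - exact: subsetDl.
apply/eqP; rewrite -(eqn_pmul2r (isT : 0 < 2)) -!sum_nat_const; apply/eqP.
transitivity (\sum_(t in [set t in F0 | [set i] \subset t])
    #|[set s in te | [set i] \subset s & s \subset t]|).
  by apply: eq_bigr => t; rewrite inE sub1set => /andP[tF it]; rewrite two_in.
transitivity (\sum_(s in [set s in te | [set i] \subset s]) #|[set t in F0 | s \subset t]|); last first.
  by apply: eq_bigr => s; rewrite inE => /andP[sE _]; rewrite two_sides.
transitivity (\sum_(t in F0) \sum_(s in te | ([set i] \subset s) && (s \subset t)) 1).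
  rewrite big_mkcond [RHS]big_mkcond; apply: eq_bigr => t _; rewrite inE.
  case tF: (t \in F0) => //=; case: ifP => it.
    by rewrite -sum1_card; apply: eq_bigl => s; rewrite inE.
  by rewrite big1 // => s /andP[_ /andP[is_ st]]; rewrite (subset_trans is_ st) in it.
rewrite (exchange_big_dep [in [set s in te | [set i] \subset s]]) /=; last first.
  by move=> t s _ /and3P[h1 h2 _]; rewrite in_set h1.
apply: eq_bigr => s; rewrite in_set => /andP[sE is_]; rewrite -sum1_card.
by apply: eq_bigl => t; rewrite in_set sE is_.
Qed.

(* The Euler relation of a link: summed over the supports of the lattice points it
   gives the Euler inequality of the subdivision from that of the triangulation. *)
Let local_euler (X : {set 'I_n}) : X != set0 ->
  tau F0 X + tau G1 X = (0 < tau F0 X) + tau te X.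
Proof.
move=> X0; have tauG : tau G1 X = (#|X| == 1).
  have [/cards1P[i ->]|X1] := boolP (#|X| == 1).
    rewrite -[RHS](cards1 [set i]); apply: eq_card => Y; rewrite !inE.
    apply/andP/eqP=> [[/imsetP[j _ ->]]|->]; last by rewrite imset_f // inE.
    by rewrite sub1set inE => /eqP->.
  apply: eq_card0 => Y; rewrite !inE; apply/negP=> /andP[/imsetP[j _ ->]].
  by rewrite subset1 (negbTE X0) orbF => /eqP XE; rewrite XE cards1 in X1.
have [t0|] := posnP (tau F0 X).
  have none t : t \in F0 -> ~~ (X \subset t).
    by move=> tF; apply/negP=> Xt; have := card0_eq t0 t; rewrite !inE tF Xt.
  have -> : tau te X = 0.
    apply: eq_card0 => s; rewrite inE; apply/negP=> /andP[/tri_edgeF[t tF st] Xs].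
    by have := none t tF; rewrite (subset_trans Xs st).
  rewrite t0 tauG; case: eqP => // /eqP/cards1P[i Xi].
  have [t tF it] := vertF i; have := none t tF; by rewrite Xi sub1set it.
move=> tpos; have /card_gt0P[t] := tpos; rewrite inE => /andP[tF Xt].
rewrite tauG addnC.
have : #|X| <= 3 by rewrite -(card3 tF) subset_leq_card.
have : 0 < #|X| by rewrite card_gt0.
case cX: #|X| => [|[|[|[|?]]]] // _ _ /=.
- by have /eqP/cards1P[i ->] := cX; rewrite tau1.
- have XE : X \in te by apply: tri_edgeP tF Xt cX.
  have -> : tau F0 X = 2 by apply: two_sides.
  suff -> : tau te X = 1 by [].
  rewrite -(cards1 X); apply: eq_card => s; rewrite in_set in_set1.
  apply/andP/eqP=> [[sE Xs]|->]; last by rewrite XE.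
  by apply/esym/eqP; rewrite eqEcard Xs cX (tri_edge2 sE).
- have -> : tau te X = 0.
    apply: eq_card0 => s; rewrite inE; apply/negP=> /andP[sE /subset_leq_card].
    by rewrite cX (tri_edge2 sE).
  have Xt' := tri_eq tF Xt cX.
  suff -> : tau F0 X = 1 by [].
  rewrite -(cards1 t); apply: eq_card => t'; rewrite in_set in_set1.
  apply/andP/eqP=> [[t'F Xt'']|->]; last by rewrite tF.
  by rewrite -Xt'; apply/esym/tri_eq.
Qed.

Let sum_tau (G : {set {set 'I_n}}) (M : nat) :
  \sum_(b : lt | mass b == M) tau G (supp b) = \sum_(X in G) #|slice N M X|.
Proof.
transitivity (\sum_(b : lt | mass b == M) \sum_(X in G) (supp b \subset X)).
  apply: eq_bigr => b _; rewrite /tau -sum1_card big_mkcond [RHS]big_mkcond.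
  by apply: eq_bigr => X _; rewrite inE; case: (X \in G); case: (_ \subset _).
rewrite exchange_big; apply: eq_bigr => X _; rewrite -sum1_card big_mkcond [RHS]big_mkcond.
by apply: eq_bigr => b _; rewrite inE; case: (mass b == M); case: (_ \subset _).
Qed.

Let supp_neq0 (b : lt) (M : nat) : mass b = M.+1 -> supp b != set0.
Proof.
move=> mb; apply/eqP=> b0.
have : b \in slice N M.+1 set0 by rewrite in_slice mb eqxx b0 subxx.
by rewrite (card0_eq (slice_set0 _ _ _)).
Qed.

Let count_points : \sum_(X in G1) #|slice N N X| = n.
Proof.
rewrite (eq_bigr (fun=> 1)); last by move=> X /imsetP[i _ ->]; rewrite slice1.
by rewrite sum1_card card_imset ?card_ord //; apply: set1_inj.
Qed.

Let count_vertices : #|{: lvertex}| + \sum_(s in te) #|slice N N s| =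
  \sum_(t in F0) #|slice N N t| + \sum_(X in G1) #|slice N N X|.
Proof.
rewrite -!sum_tau -big_split /= [RHS](eq_bigr (fun b => (0 < tau F0 (supp b)) + tau te (supp b))).
  rewrite big_split /=; congr (_ + _); rewrite card_sig -sum1_card big_mkcond [RHS]big_mkcond.
  apply: eq_bigr => b _; rewrite -topredE /= /is_vertex; case: (mass b == N) => //=.
  case: existsP => [[t /andP[tF bt]]|none].
    by rewrite (_ : 0 < _) //; apply/card_gt0P; exists t; rewrite inE tF.
  rewrite /tau; case: posnP => // /card_gt0P[t]; rewrite inE => tb; by case: none; exists t.
by move=> b /eqP mb; apply: local_euler; apply: supp_neq0 mb.
Qed.

(** Both sides count pairs of a small edge and a triangle containing it: edges with
    [supp b \subset s] lie in two triangles, the others in one, and a triangle offers three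
    directions. *)
Let count_edges : #|{: ledge}| + \sum_(s in te) #|slice N m.+1 s| =
  3 * \sum_(t in F0) #|slice N m.+1 t|.
Proof.
transitivity (\sum_(s in te) \sum_(b : lt | mass b == m.+1) tau F0 (s :|: supp b)).
  rewrite [RHS](eq_bigr (fun s => \sum_(b : lt | mass b == m.+1)
     ((0 < tau F0 (s :|: supp b)) + (supp b \subset s)))); last first.
    move=> s sE; apply: eq_bigr => b _; have s2 := tri_edge2 sE.
    have [bs|bs] := boolP (supp b \subset s).
      by rewrite (setUidPl bs); have -> : tau F0 s = 2 by apply: two_sides.
    case: posnP => [->//|tpos]; have /card_gt0P[t] := tpos.
    rewrite inE => /andP[tF sbt].
    have sb3 : #|s :|: supp b| = 3.
      apply/eqP; rewrite eqn_leq -{1}(card3 tF) subset_leq_card //= -s2.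
      apply: proper_card; rewrite properE subsetUl; apply: contra bs.
      exact/subset_trans/subsetUr.
    have -> : true + 0 = 1 by [].
    rewrite -(cards1 t); apply: eq_card => t'; rewrite in_set in_set1.
    apply/andP/eqP=> [[t'F Xt'']|->]; last by rewrite tF.
    by rewrite -(tri_eq tF sbt sb3); apply/esym/tri_eq.
  rewrite [RHS](eq_bigr _ (fun s sE => big_split _ _ _ _ _)) [RHS]big_split /=; congr (_ + _); last first.
    apply: eq_bigr => s _; rewrite -sum1_card big_mkcond [RHS]big_mkcond.
    by apply: eq_bigr => b _; rewrite inE; case: (mass b == _); case: (_ \subset _).
  rewrite pair_big_dep /= card_sig -sum1_card big_mkcond [RHS]big_mkcond.
  apply: eq_bigr => -[s b] _; rewrite -topredE /= /is_edge /=.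
  case: (s \in te) => //=; case: (mass b == m.+1) => //=.
  case: existsP => [[t /andP[tF /andP[st bt]]]|none].
    by rewrite (_ : 0 < _) //; apply/card_gt0P; exists t; rewrite inE tF subUset st.
  rewrite /tau; case: posnP => // /card_gt0P[t]; rewrite inE subUset => tb; by case: none; exists t.
transitivity (\sum_(s in te) \sum_(t in F0 | s \subset t) #|slice N m.+1 t|).
  apply: eq_bigr => s _.
  transitivity (\sum_(b : lt | mass b == m.+1) \sum_(t in F0 | s \subset t) (supp b \subset t)).
    apply: eq_bigr => b _; rewrite /tau -sum1_card big_mkcond [RHS]big_mkcond.
    by apply: eq_bigr => t _; rewrite inE subUset; case: (t \in F0); case: (s \subset t); case: (supp b \subset t).
  rewrite exchange_big; apply: eq_bigr => t _; rewrite -sum1_card big_mkcond [RHS]big_mkcond.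
  by apply: eq_bigr => b _; rewrite inE; case: (mass b == _); case: (_ \subset _).
rewrite (exchange_big_dep [in F0]) /=; last by move=> s t _ /andP[].
rewrite big_distrr; apply: eq_bigr => t tF; rewrite sum_nat_const; congr (_ * _).
transitivity #|[set s : {set 'I_n} | s \subset t & #|s| == 2]|; last by rewrite cards_draws card3.
apply: eq_card => s; rewrite [RHS]in_set unfold_in /=.
case st: (s \subset t) => //=; last by rewrite ?andbF.
rewrite tF /= andbT; apply/idP/eqP; [apply: tri_edge2|apply: (tri_edgeP tF st)].
Qed.

Let count_faces : #|{: lface}| = \sum_(t in F0) (#|slice N m.+1 t| + #|slice N m t|).
Proof.
rewrite card_sig -sum1_card big_mkcond.
rewrite -(pair_bigA _ (fun u tb => if (u, tb) \in is_face then 1 else 0)) /= big_bool /= big_split /=.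
have inF f : (f \in is_face) = is_face f by [].
have E u M : (M = if u then m.+1 else m) ->
    \sum_tb (if (u, tb) \in is_face then 1 else 0) = \sum_(t in F0) #|slice N M t|.
  move=> ME; rewrite -(pair_bigA _ (fun t b => if (u, (t, b)) \in is_face then 1 else 0)) /=.
  rewrite [RHS]big_mkcond; apply: eq_bigr => t _.
  case tF: (t \in F0).
    rewrite -sum1_card [RHS]big_mkcond; apply: eq_bigr => b _.
    by rewrite inF /is_face /= tF in_slice ME /= andbC.
  by rewrite big1 // => b _; rewrite inF /is_face /= tF.
by rewrite (E true m.+1) // (E false m).
Qed.

Lemma euler_lattice : #|{: ledge}| <= #|{: lvertex}| + #|{: lface}|.
Proof.
have h1 := count_vertices; rewrite count_points in h1; have h2 := count_edges; have h3 := count_faces.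
(* First differences along edges and second differences in triangles leave just [#|te|] and
   [#|F0|]. *)
have h4 : \sum_(s in te) #|slice N N s| = \sum_(s in te) #|slice N m.+1 s| + #|te|.
  rewrite -sum1_card -big_split /=; apply: eq_bigr => s /tri_edge2 s2.
  exact: slice2.
have h5 : \sum_(t in F0) #|slice N N t| + \sum_(t in F0) #|slice N m t| =
    2 * \sum_(t in F0) #|slice N m.+1 t| + #|F0|.
  rewrite -[#|F0|]sum1_card big_distrr -!big_split /=; apply: eq_bigr => t tF.
  by apply: slice3; rewrite ?card3.
rewrite big_split /= in h3.
have arith v e f a a' b c d k0 f0 : v + a = b + n -> e + a' = 3 * c -> f = c + d ->
    a = a' + k0 -> b + d = 2 * c + f0 -> k0 <= n + f0 -> e <= v + f by clear; lia.
exact: arith h1 h2 h3 h4 h5 eulerF.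
Qed.

End Count.
End Complex.

Lemma ltn_exists_sum (I : finType) (a b : I -> nat) :
  (exists i, a i != b i) -> \sum_i a i = \sum_i b i -> exists i, b i < a i.
Proof.
move=> [i0 ni] eqs; apply/existsP; apply: contraT => /existsPn h.
have le i : a i <= b i by rewrite leqNgt h.
have := leqif_sum (fun i (_ : true) => leqif_eq (le i)).
case=> _; rewrite eqs eqxx => /esym/forallP/(_ i0) /=.
by rewrite (negbTE ni).
Qed.

(** With equal masses some coordinate goes up and some goes down, each by 1; on a support of three
    elements the third coordinate is then unchanged. *)
Lemma lat_neighbours (n m : nat) (a b : lat n m.+2) (t : {set 'I_n}) :
  #|t| = 3 -> mass a = m.+2 -> mass b = m.+2 -> supp a \subset t -> supp b \subset t ->
  (forall i, a i <= b i + 1) -> (forall i, b i <= a i + 1) -> a != b ->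
  exists c i j, [/\ i \in t, j \in t, i != j & [/\ mass c = m.+1, supp c \subset t, a = inc c i & b = inc c j]].
Proof.
move=> t3 ma mb sa sb ab ba nab.
have [x nx] : exists x, a x != b x :> nat.
  apply/existsP; apply: contraT => /existsPn h; case/eqP: nab.
  by apply: latP => x; apply/eqP; rewrite -[_ == _]negbK h.
have [i ai] : exists i, b i < a i.
  by apply: ltn_exists_sum; [exists x|rewrite -/(mass a) -/(mass b) ma mb].
have [j bj] : exists j, a j < b j.
  by apply: ltn_exists_sum; [exists x; rewrite eq_sym|rewrite -/(mass a) -/(mass b) ma mb].
have nij : i != j by apply: contraTneq ai => ->; rewrite -leqNgt ltnW.
have it : i \in t by apply: (subsetP sa); rewrite inE (leq_ltn_trans _ ai).
have jt : j \in t by apply: (subsetP sb); rewrite inE (leq_ltn_trans _ bj).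
have /eqP/cards1P[k kE] : #|t :\ i :\ j| = 1.
  have jti : j \in t :\ i by rewrite !inE eq_sym nij.
  by move: t3; rewrite (cardsD1 i t) it (cardsD1 j (t :\ i)) jti => -[]; rewrite add0n => ->.
have tE y : y \notin t -> a y = 0 :> nat /\ b y = 0 :> nat.
  move=> yt; split; apply/eqP; rewrite -leqn0 leqNgt.
    by apply: contra yt => h; apply: (subsetP sa); rewrite inE.
  by apply: contra yt => h; apply: (subsetP sb); rewrite inE.
have massE (d : lat n m.+2) : supp d \subset t -> mass d = d i + (d j + d k).
  move=> sd; rewrite /mass (bigID (mem t)) /= [X in _ + X]big1 ?addn0; last first.
    move=> y yt; apply/eqP; rewrite -leqn0 leqNgt.
    by apply: contra yt => h; apply: (subsetP sd); rewrite inE.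
  rewrite (big_setD1 i) //= (big_setD1 j) /=; last by rewrite !inE eq_sym nij.
  by rewrite kE big_set1.
have isa : i \in supp a by rewrite inE (leq_ltn_trans _ ai).
have mc : mass (dec a i) = m.+1 by have := mass_dec isa; rewrite ma => -[].
have sc : supp (dec a i) \subset t := subset_trans (supp_dec a i) sa.
exists (dec a i), i, j; split=> //; split=> //; first by rewrite decK ?mc.
apply: latP => y; rewrite incE ?mc // decE.
have kk : y \in t -> y != i -> y != j -> y = k.
  by move=> yt yi yj; apply/set1P; rewrite -kE !inE yi yj.
have := massE _ sa; have := massE _ sb; rewrite ma mb => eb ea.
case: (eqVneq y i) => [->|yi]; first by rewrite (negbTE nij); move: (ab i) (ba i) ai; clear; lia.
case: (eqVneq y j) => [->|yj]; first by move: (ab j) (ba j) bj; clear; lia.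
have [yt|/tE[-> ->]] := boolP (y \in t); last by [].
rewrite (kk yt yi yj); move: (ab i) (ba i) (ab j) (ba j) ai bj ea eb; clear; lia.
Qed.

(** * From connected sets to minors *)

Section Within.
Variables (V : finType) (a : rel V).

Definition adj_in (S : {set V}) : rel V := fun x y => [&& a x y, x \in S & y \in S].

Definition linked (S : {set V}) : Prop :=
  forall x y, x \in S -> y \in S -> connect (adj_in S) x y.

Lemma adj_in_sub (S S' : {set V}) x y :
  S \subset S' -> connect (adj_in S) x y -> connect (adj_in S') x y.
Proof.
move=> sSS'; apply: connect_sub => u v /and3P[auv uS vS]; apply: connect1.
by rewrite /adj_in auv !(subsetP sSS').
Qed.

Hypothesis asym : symmetric a.

Lemma adj_in_sym S : symmetric (adj_in S).
Proof. by move=> x y; rewrite /adj_in asym (andbC (x \in S)). Qed.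

Lemma adj_in_connect_sym S : connect_sym (adj_in S).
Proof. exact/sym_connect_sym/adj_in_sym. Qed.

Lemma linked_adjoin (S : {set V}) x y : linked S -> x \in S -> a x y -> linked (y |: S).
Proof.
move=> lS xS axy; have sub : S \subset y |: S by apply: subsetUr.
have xy : connect (adj_in (y |: S)) x y.
  by apply: connect1; rewrite /adj_in axy !inE xS eqxx orbT.
have toy u : u \in y |: S -> connect (adj_in (y |: S)) u y.
  case/setU1P=> [->//|uS]; apply: connect_trans xy.
  exact: adj_in_sub sub (lS _ _ uS xS).
move=> u v uS vS; apply: connect_trans (toy u uS) _.
by rewrite adj_in_connect_sym; apply: toy.
Qed.

Variable T : finType.

(* Disjoint linked sets can be enlarged to a partition into linked sets. *)
Lemma linked_partition (B : T -> {set V}) (t0 : T) :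
  (forall x y, connect a x y) -> B t0 != set0 -> (forall t, linked (B t)) ->
  (forall t t', t != t' -> [disjoint B t & B t']) ->
  exists phi : V -> T, (forall t x, x \in B t -> phi x = t) /\
    forall t, linked [set x | phi x == t].
Proof.
move=> conn; have [d] := ubnP #|~: \bigcup_t B t|.
elim: d B => // d IH B /ltnSE le_d B0 lB dB.
have [full|/subsetPn[z _ zN]] := boolP (setT \subset \bigcup_t B t).
  have ex x : exists t, x \in B t.
    by have /bigcupP[t _ xt] := subsetP full x (in_setT x); exists t.
  have [phi phiP] := fin_all_exists ex.
  have phiE t x : x \in B t -> phi x = t.
    move=> xt; apply/eqP; apply: contraT => /dB dis.
    by have := disjointFr dis (phiP x); rewrite xt.
  exists phi; split=> // t x y; rewrite !inE => /eqP <- /eqP yx.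
  have yB : y \in B (phi x) by rewrite -yx.
  apply: adj_in_sub (lB _ _ _ (phiP x) yB); apply/subsetP=> w wt; rewrite inE; apply/eqP; exact: phiE.
have [x0 x0B] : exists x0, x0 \in B t0 by apply/set0Pn.
have [/existsP[x /existsP[y /and3P[xU yN axy]]]|none] := boolP
    [exists x, [exists y, [&& x \in \bigcup_t B t, y \notin \bigcup_t B t & a x y]]].
  have /bigcupP[t1 _ xt1] := xU.
  pose B' t := if t == t1 then y |: B t else B t.
  have sB t : B t \subset B' t by rewrite /B'; case: eqP => // _; apply: subsetUr.
  have yNB t : y \notin B t by apply: contra yN => yt; apply/bigcupP; exists t.
  have [||||phi [phiB phiL]] := IH B'.
  - apply: leq_trans le_d; apply: proper_card; apply/properP; split.
      rewrite setCS; apply/subsetP=> w /bigcupP[t _ wt]; apply/bigcupP; exists t => //.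
      exact: (subsetP (sB t)).
    exists y; rewrite ?in_setC //; apply/negPn; apply/bigcupP; exists t1 => //.
    by rewrite /B' eqxx setU11.
  - by apply/set0Pn; exists x0; apply: (subsetP (sB t0)).
  - by move=> t; rewrite /B'; case: eqP => [->|_] //; apply: linked_adjoin axy.
  - have disj1 t : t != t1 -> [disjoint y |: B t1 & B t].
      by move=> nt; rewrite -setI_eq0 setIUl setU_eq0 !setI_eq0 disjoints1 yNB dB // eq_sym.
    move=> t t' ntt'; rewrite /B'; case: (eqVneq t t1) => [tt1|nt]; case: (eqVneq t' t1) => [t't1|nt'].
    + by rewrite tt1 t't1 eqxx in ntt'.
    + by rewrite tt1; apply: disj1.
    + by rewrite disjoint_sym t't1; apply: disj1.
    + exact: dB.
  by exists phi; split=> // t w wt; apply: phiB; apply: (subsetP (sB t)).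
have cl : closed a (mem (\bigcup_t B t)).
  move=> x y axy; apply/idP/idP=> [xU|yU]; apply: contraT => N.
    by case/negP: none; apply/existsP; exists x; apply/existsP; exists y; rewrite xU N.
  by case/negP: none; apply/existsP; exists y; apply/existsP; exists x; rewrite yU N asym.
case/negP: zN; rewrite -(closed_connect cl (conn x0 z)).
by apply/bigcupP; exists t0.
Qed.

Variable e : rel T.
Variables (Bs : T -> {set V}) (Ps : T -> T -> {set V}).
Hypotheses (e_sym : symmetric e).
Hypothesis conn : forall x y, connect a x y.
Hypothesis Bs0 : forall t, Bs t != set0.
Hypothesis Bs_linked : forall t, linked (Bs t).
Hypothesis Bs_disj : forall t t', t != t' -> [disjoint Bs t & Bs t'].
Hypothesis Ps_linked : forall u v, e u v -> linked (Ps u v).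
Hypothesis Ps_l : forall u v, e u v -> Ps u v :&: Bs u != set0.
Hypothesis Ps_r : forall u v, e u v -> Ps u v :&: Bs v != set0.
Hypothesis Ps_Bs : forall u v w, e u v -> w != u -> w != v -> [disjoint Ps u v & Bs w].
Hypothesis Ps_disj : forall u v u' v', e u v -> e u' v' ->
  [set u; v] != [set u'; v'] -> [disjoint Ps u v & Ps u' v'].

Let lt (u v : T) := enum_rank u < enum_rank v.

Let Qs u v := [set y | [exists x in Ps u v :&: Bs u, connect (adj_in (Ps u v :\: Bs v)) x y]].

Let Qs_self u v x : x \in Ps u v -> x \in Bs u -> x \in Qs u v.
Proof. by move=> xP xB; rewrite inE; apply/exists_inP; exists x; rewrite ?inE ?xP. Qed.

Let Qs_sub u v : e u v -> u != v -> Qs u v \subset Ps u v :\: Bs v.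
Proof.
move=> euv nuv; apply/subsetP=> y; rewrite inE => /exists_inP[x /setIP[xP xB] /connectP[p pth ->]].
have xD : x \in Ps u v :\: Bs v.
  by rewrite inE xP andbT (disjointFr (Bs_disj nuv)).
by elim: p x xD pth {xP xB} => //= z p IH x _ /andP[/and3P[_ _ zD]]; apply: IH.
Qed.

Let Qs_step u v x y : x \in Qs u v -> a x y -> y \in Ps u v -> y \notin Bs v ->
  e u v -> u != v -> y \in Qs u v.
Proof.
move=> xQ axy yP yB euv nuv; have xD := subsetP (Qs_sub euv nuv) _ xQ.
move: xQ; rewrite !inE => /exists_inP[x0 x0P cx]; apply/exists_inP; exists x0 => //.
by apply: connect_trans cx _; apply: connect1; rewrite /adj_in axy xD inE yB.
Qed.

(* The edge drawn in [Ps u v] is given to its smaller end up to the point where it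
   enters the set of the larger one. *)
Let B' u := Bs u :|: \bigcup_(v | e u v && lt u v) Qs u v.

Let lt_neq u v : lt u v -> u != v.
Proof. by apply: contraTneq => ->; rewrite /lt ltnn. Qed.

Let B'_linked u : linked (B' u).
Proof.
have sB : Bs u \subset B' u by apply: subsetUl.
have toB y : y \in B' u -> exists2 x, x \in Bs u & connect (adj_in (B' u)) x y.
  case/setUP=> [yB|/bigcupP[v /andP[euv ltuv] yQ]]; first by exists y.
  have sQ : Qs u v \subset B' u.
    by apply: subset_trans (subsetUr _ _); apply: bigcup_sup; rewrite euv.
  move: (yQ); rewrite inE => /exists_inP[x /setIP[xP xB] /connectP[p pth yE]].
  exists x => //; apply: (@adj_in_sub (Qs u v)) => //.
  have xQ := Qs_self xP xB; rewrite {}yE {yQ}; elim: p x xQ pth {xP xB} => //= z p IH x xQ.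
  case/andP=> /and3P[axz xD]; rewrite inE => /andP[zB zP] pth.
  have zQ : z \in Qs u v by apply: Qs_step axz zP zB euv (lt_neq ltuv).
  by apply: connect_trans (connect1 _) (IH _ zQ pth); rewrite /adj_in axz xQ.
move=> x y /toB[x' x'B cx] /toB[y' y'B cy].
rewrite adj_in_connect_sym in cx; apply: connect_trans cx _; apply: connect_trans cy.
exact: adj_in_sub sB (Bs_linked x'B y'B).
Qed.

Let B'_disj u u' : u != u' -> [disjoint B' u & B' u'].
Proof.
move=> nuu'; rewrite -setI_eq0; apply/eqP/setP=> x; rewrite in_setI in_set0.
have QB v w w' : w != w' -> e w v -> lt w v -> x \in Qs w v -> x \in Bs w' -> False.
  move=> nww' ewv ltwv /(subsetP (Qs_sub ewv (lt_neq ltwv))); rewrite inE => /andP[xB xP] xw'.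
  case: (eqVneq w' v) => [wv|nwv]; first by rewrite -wv xw' in xB.
  by have := disjointFr (Ps_Bs ewv (_ : w' != w) nwv) xP; rewrite eq_sym xw' => /(_ nww').
apply/negP=> /andP[/setUP[xB|/bigcupP[v /andP[euv ltuv] xQ]] /setUP[xB'|/bigcupP[v' /andP[euv' ltuv'] xQ']]].
- by have := disjointFr (Bs_disj nuu') xB; rewrite xB'.
- by apply: QB xQ' xB => //; rewrite eq_sym.
- exact: QB xQ xB'.
have /setDP[xP _] := subsetP (Qs_sub euv (lt_neq ltuv)) _ xQ.
have /setDP[xP' _] := subsetP (Qs_sub euv' (lt_neq ltuv')) _ xQ'.
have [same|ndiff] := eqVneq [set u; v] [set u'; v'].
  have uv' : u = v'.
    have : u \in [set u'; v'] by rewrite -same !inE eqxx.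
    by case/set2P=> // uu'; rewrite uu' eqxx in nuu'.
  have vu' : u' = v.
    have : u' \in [set u; v] by rewrite same !inE eqxx.
    by case/set2P=> // u'u; rewrite u'u eqxx in nuu'.
  move: ltuv ltuv'; rewrite -vu' -uv' /lt => h1 h2.
  by have := ltn_trans h1 h2; rewrite ltnn.
by have := disjointFr (Ps_disj euv euv' ndiff) xP; rewrite xP'.
Qed.

(** If nothing in [Qs u v] were adjacent to [Bs v], then [Qs u v] would be closed in the linked set
    [Ps u v], and would contain the points of [Ps u v] in [Bs v]. *)
Let cross u v : e u v -> lt u v -> exists x y, [/\ x \in B' u, y \in Bs v & a x y].
Proof.
move=> euv ltuv; have nuv := lt_neq ltuv.
have QB' x : x \in Qs u v -> x \in B' u.
  by move=> xQ; apply/setUP; right; apply/bigcupP; exists v; rewrite ?euv.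
have [/existsP[x /existsP[y /and3P[? ? ?]]]|none] := boolP
    [exists x, [exists y, [&& x \in Qs u v, y \in Bs v & a x y]]].
  by exists x, y; split=> //; apply: QB'.
have /set0Pn[x0 /setIP[x0P x0B]] := Ps_l euv.
have /set0Pn[y0 /setIP[y0P y0B]] := Ps_r euv.
have step x y : adj_in (Ps u v) x y -> x \in Qs u v -> y \in Qs u v.
  case/and3P=> axy _ yP xQ; have [yB|yB] := boolP (y \in Bs v).
    by case/negP: none; apply/existsP; exists x; apply/existsP; exists y; rewrite xQ yB.
  exact: Qs_step axy yP yB euv nuv.
have cl : closed (adj_in (Ps u v)) (mem (Qs u v)).
  by move=> x y wxy; apply/idP/idP; apply: step; rewrite // adj_in_sym.
have E : (x0 \in Qs u v) = (y0 \in Qs u v) := closed_connect cl (Ps_linked euv x0P y0P).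
rewrite (Qs_self x0P x0B) in E.
by have := subsetP (Qs_sub euv nuv) y0 (esym E); rewrite inE y0B.
Qed.

Hypothesis e_irr : irreflexive e.

Lemma extract_minor (t0 : T) : exists phi : V -> T,
  (forall t, linked [set x | phi x == t]) /\
  forall u v, e u v -> exists x y, [/\ phi x = u, phi y = v & a x y].
Proof.
have B'0 : B' t0 != set0.
  have /set0Pn[x xB] := Bs0 t0; apply/set0Pn; exists x; apply/setUP; by left.
have [phi [phiB phiL]] := linked_partition conn B'0 B'_linked B'_disj.
have cr u v : e u v -> lt u v -> exists x y, [/\ phi x = u, phi y = v & a x y].
  move=> euv ltuv; have [x [y [xB yB axy]]] := cross euv ltuv.
  exists x, y; split=> //; first exact: phiB.
  by apply: phiB; apply/setUP; left.
exists phi; split=> // u v euv.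
have [|lvu|ruv] := ltngtP (enum_rank u) (enum_rank v); first exact: cr.
  have [|x [y [? ? ?]]] := cr v u _ lvu; first by rewrite e_sym.
  by exists y, x; rewrite asym.
by move: euv; rewrite (enum_rank_inj (val_inj ruv)) e_irr.
Qed.

End Within.

(** * Degree sums of a graph drawn on a cell complex *)

Section Drawn.
Variables (V E F T : finType) (en : E -> {set V}) (sd : E -> {set F}).
Hypotheses (en2 : forall e, #|en e| = 2) (sd2 : forall e, #|sd e| = 2).
Hypothesis boundary : forall f v, ~~ odd #|[set e | (f \in sd e) && (v \in en e)]|.
Hypothesis connV : forall u v, connect (adj en predT) u v.
Hypothesis connF : forall f g, connect (adj sd predT) f g.
Hypothesis euler : #|E| <= #|V| + #|F|.
Variables (e : rel T) (Bs : T -> {set V}) (Ps : T -> T -> {set V}).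
Hypotheses (e_sym : symmetric e) (e_irr : irreflexive e).
Hypothesis Bs0 : forall t, Bs t != set0.
Hypothesis Bs_linked : forall t, linked (adj en predT) (Bs t).
Hypothesis Bs_disj : forall t t', t != t' -> [disjoint Bs t & Bs t'].
Hypothesis Ps_linked : forall u v, e u v -> linked (adj en predT) (Ps u v).
Hypothesis Ps_l : forall u v, e u v -> Ps u v :&: Bs u != set0.
Hypothesis Ps_r : forall u v, e u v -> Ps u v :&: Bs v != set0.
Hypothesis Ps_Bs : forall u v w, e u v -> w != u -> w != v -> [disjoint Ps u v & Bs w].
Hypothesis Ps_disj : forall u v u' v', e u v -> e u' v' ->
  [set u; v] != [set u'; v'] -> [disjoint Ps u v & Ps u' v'].

Let pairs := [set p : T * T | e p.1 p.2 && (enum_rank p.1 < enum_rank p.2)].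

Let sum_pairs : \sum_(u in [set: T]) nb e u setT = 2 * #|pairs|.
Proof.
have E1 : \sum_(u in [set: T]) nb e u setT = #|[set p : T * T | e p.1 p.2]|.
  rewrite -sum1_card (eq_bigl (fun p : T * T => e p.1 p.2)); last by move=> p; rewrite inE.
  rewrite -(pair_big_dep xpredT (fun u v => e u v) (fun _ _ => 1)) /=.
  apply: eq_big => [u|u _]; first by rewrite inE.
  by rewrite /nb sum1_card; apply: eq_card => v; rewrite !inE.
rewrite {}E1 -(cardsID [set p : T * T | enum_rank p.1 < enum_rank p.2]) mul2n -addnn.
congr (_ + _); first by apply: eq_card => p; rewrite !inE.
pose swap (p : T * T) := (p.2, p.1).
rewrite -(card_imset (f := swap)); last by move=> [a b] [c d] [-> ->].
apply: eq_card => -[u v]; rewrite [RHS]inE /=; apply/imsetP/andP=> [[[a b]]|[euv ltuv]].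
  rewrite !inE /= -leqNgt => /andP[lt eab] [-> ->]; rewrite e_sym eab; split=> //.
  rewrite ltn_neqAle lt andbT; apply/eqP=> /val_inj/enum_rank_inj ab.
  by rewrite ab e_irr in eab.
exists (v, u) => //; by rewrite !inE /= e_sym euv andbT -leqNgt ltnW.
Qed.

Let minor (t0 : T) : exists phi : V -> T, exists M : {set E},
  [/\ forall u v, phi u = phi v -> connect (adj en (inner en phi)) u v,
      forall e, e \in M -> #|phi @: en e| = 2,
      {in M &, injective (fun e => phi @: en e)},
      #|M| = #|pairs|
    & forall d, d \in M -> exists u v, e u v /\ phi @: en d = [set u; v]].
Proof.
have asym : symmetric (adj en predT) by apply: adj_sym.
have [phi [phiL phiE]] := extract_minor asym e_sym connV Bs0 Bs_linked Bs_disj Ps_linked Ps_l Ps_r Ps_Bs Ps_disj e_irr t0.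
have adjE x y : adj en predT x y -> x != y -> exists d, en d = [set x; y].
  by case/existsP=> d /and3P[_ xd yd] nxy; exists d; apply: card2_set2.
have ex (p : T * T) : exists d : option E,
    p \in pairs -> exists2 d0, d = Some d0 & phi @: en d0 = [set p.1; p.2].
  have [pP|_] := boolP (p \in pairs); last by exists None.
  move: (pP); rewrite inE => /andP[ep ltp].
  have [x [y [px py axy]]] := phiE _ _ ep.
  have [|d dE] := adjE _ _ axy.
    by apply: contraTneq ep => xy; rewrite -px -py xy e_irr.
  by exists (Some d) => _; exists d; rewrite // dE imsetU1 imset_set1 px py.
have [g gP] := fin_all_exists ex.
pose M := [set d | [exists p in pairs, g p == Some d]].
have MP d : d \in M -> exists2 p, p \in pairs & g p = Some d /\ phi @: en d = [set p.1; p.2].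
  rewrite inE => /exists_inP[p pP /eqP gp]; exists p => //.
  by have [d0 + gd0] := gP p pP; rewrite gp => -[->].
have pair_eq p q : p \in pairs -> q \in pairs -> [set p.1; p.2] = [set q.1; q.2] -> p = q.
  case: p q => [a b] [c d] /=; rewrite !inE /= => /andP[_ ltab] /andP[_ ltcd] E1.
  have: a \in [set c; d] by rewrite -E1 !inE eqxx.
  have: b \in [set c; d] by rewrite -E1 !inE eqxx orbT.
  move=> /set2P[] bE /set2P[] aE; move: ltab; rewrite aE bE ?ltnn // => ltdc.
  by have := ltn_trans ltcd ltdc; rewrite ltnn.
have lt_neq (p : T * T) : p \in pairs -> p.1 != p.2.
  by rewrite inE => /andP[_]; apply: contraTneq => ->; rewrite ltnn.
exists phi, M; split.
- move=> u v uv; have := phiL (phi v) u v; rewrite !inE uv eqxx => /(_ isT isT).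
  apply: connect_sub => x y; rewrite /adj_in !inE => /and3P[axy /eqP px /eqP py].
  case: (eqVneq x y) => [->//|nxy]; apply: connect1.
  have [d dE] := adjE _ _ axy nxy; apply/existsP; exists d.
  rewrite dE !inE !eqxx orbT !andbT; apply/forall_inP=> a; rewrite ?dE => ad.
  apply/forall_inP=> b; rewrite ?dE => bd.
  by case/set2P: ad => ->; case/set2P: bd => ->; rewrite ?px ?py.
- by move=> d /MP[p pP [_ ->]]; rewrite cards2 lt_neq.
- move=> d d' /MP[p pP [gp ->]] /MP[q qP [gq ->]] /(pair_eq _ _ pP qP) pq.
  by move: gp; rewrite pq gq => -[].
- apply/eqP; rewrite eqn_leq; apply/andP; split.
    have [f fP] : exists f : E -> option (T * T), forall d, d \in M -> exists2 p, f d = Some p & p \in pairs /\ g p = Some d.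
      pose f d := [pick p in pairs | g p == Some d]; exists f => d /MP[p pP [gp _]].
      by rewrite /f; case: pickP => [q /andP[qP /eqP gq]|/(_ p)]; [exists q|rewrite pP gp eqxx].
    rewrite -(card_in_imset (f := f)); last first.
      move=> d d' /fP[p -> [_ gp]] /fP[q -> [_ gq]] [pq].
      by move: gp; rewrite pq gq => -[].
    rewrite -(card_imset pairs (@Some_inj _)); apply: subset_leq_card.
    by apply/subsetP=> _ /imsetP[d /fP[p -> [pP _]] ->]; apply: imset_f.
  rewrite -(card_imset M (@Some_inj _)) -(card_in_imset (f := g) (D := mem pairs)).
    apply: subset_leq_card; apply/subsetP=> _ /imsetP[p pP ->].
    have [d gd _] := gP p pP; rewrite gd; apply: imset_f.
    by rewrite inE; apply/exists_inP; exists p; rewrite ?gd.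
  move=> p q pP qP; have [d -> dE] := gP p pP; have [d' -> d'E] := gP q qP => -[dd'].
  by apply: pair_eq => //; rewrite -dE -d'E dd'.
- by move=> d /MP[p]; rewrite inE => /andP[ep _] [_ ->]; exists p.1, p.2.
Qed.

Lemma drawn_bound : \sum_(u in [set: T]) nb e u setT <= 6 * #|T|.
Proof.
rewrite sum_pairs; case: (posnP #|pairs|) => [->//|/card_gt0P[[t0 _] _]].
have [phi [M [h1 h2 h3 <- _]]] := minor t0.
by have := minor_bound en2 sd2 boundary connF euler h1 h2 h3; lia.
Qed.

Lemma drawn_bound_bip (B : {set T}) : (forall u v, e u v -> (u \in B) != (v \in B)) ->
  \sum_(u in [set: T]) nb e u setT <= 4 * #|T|.
Proof.
move=> bip; rewrite sum_pairs; case: (posnP #|pairs|) => [->//|/card_gt0P[[t0 _] _]].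
have [phi [M [h1 h2 h3 <- h5]]] := minor t0.
have hB d : d \in M -> #|phi @: en d :&: B| = 1.
  case/h5=> u [v [euv ->]]; have := bip _ _ euv; rewrite setIUl.
  have E1 w : [set w] :&: B = if w \in B then [set w] else set0.
    case: ifP => wB; first by apply/setIidPl; rewrite sub1set.
    by apply/eqP; rewrite setI_eq0 disjoints1 wB.
  by rewrite !E1; case: (u \in B); case: (v \in B); rewrite ?setU0 ?set0U ?cards1.
by have := minor_bound_bip en2 sd2 boundary connF euler h1 h2 h3 hB; lia.
Qed.

End Drawn.

(** * Drawings on the subdivided surface *)

From mathcomp Require Import all_order all_algebra.
From mathcomp Require Import all_classical all_reals all_analysis.
From mathcomp Require Import lra.
Import Order.TTheory GRing.Theory Num.Theory.
Import numFieldNormedType.Exports.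

Section Subdivision.
Local Open Scope classical_set_scope.
Local Open Scope ring_scope.

Section Near.
Variables (R : realType) (n : nat) (F0 : {set {set 'I_n}}) (m : nat).
Implicit Types (p q : 'rV[R]_n) (a b : lat n m.+2).
Hypothesis card3 : forall t, t \in F0 -> #|t| = 3%N.

Definition near_pt a p : Prop := forall i, `|m.+2%:R * p ord0 i - (a i)%:R| < 1.

(* The coordinates of [v] are the increments of the integer parts of the partial
   sums of [(m + 2) p], so that their sum is exactly [m + 2]. *)
Lemma near_cover p : realization R F0 p -> exists v : lvertex F0 m, near_pt (val v) p.
Proof.
case=> p0 p1 [t tF pt].
pose q (k : nat) : R := if insub k is Some i then p ord0 i else 0.
have q0 k : 0 <= q k by rewrite /q; case: insubP => // *.
have qE (i : 'I_n) : q i = p ord0 i by rewrite /q valK.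
pose s k : R := \sum_(j < k) m.+2%:R * q j.
have sS k : s k.+1 = s k + m.+2%:R * q k by rewrite /s big_ord_recr.
have s0 k : 0 <= s k by apply: sumr_ge0 => j _; apply: mulr_ge0.
have sn : s n = m.+2%:R.
  by rewrite /s -mulr_sumr (eq_bigr (fun j => p ord0 j)) ?p1 ?mulr1 // => j _.
pose f k := Num.truncn (s k).
have f_le : {homo f : x y / (x <= y)%N}.
  apply: homo_leq => [x|x y z|k]; [exact: leqnn|exact: leq_trans|].
  apply: le_truncn; rewrite sS lerDl; exact: mulr_ge0.
have f0 : f 0%N = 0%N by rewrite /f /s big_ord0 truncn0.
have fn : f n = m.+2 by rewrite /f sn natrK.
have fN k : (k <= n)%N -> (f k <= m.+2)%N by rewrite -fn; apply: f_le.
pose a : lat n m.+2 := [ffun i : 'I_n => inord (f i.+1 - f i)].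
have aE (i : 'I_n) : a i = (f i.+1 - f i)%N :> nat.
  by rewrite ffunE inordK // ltnS (leq_trans (leq_subr _ _)) // fN.
have ma : mass a = m.+2.
  rewrite /mass (eq_bigr (fun i : 'I_n => f i.+1 - f i)%N) //.
  by rewrite -(big_mkord xpredT (fun i => f i.+1 - f i)%N) telescope_sumn // fn f0 subn0.
have near i : `|m.+2%:R * p ord0 i - (a i)%:R| < 1.
  rewrite aE natrB ?f_le // -qE -[X in X - _](addKr (s i)) -sS.
  have /andP[] := truncn_itv (s0 i); have /andP[] := truncn_itv (s0 i.+1).
  rewrite -/(f i) -/(f i.+1) -!natr1 ltr_norml.
  move: (s i) (s i.+1) (f i) (f i.+1) => x y u v; lra.
have sup : supp a \subset t.
  apply/fintype.subsetP=> i; rewrite inE => ai; apply: pt.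
  apply: contraTneq ai => pi0; rewrite -leqNgt leqn0; have := near i.
  by rewrite pi0 mulr0 sub0r normrN normr_nat (_ : 1 = 1%:R) // ltr_nat ltnS leqn0.
have av : is_vertex F0 a.
  by rewrite /is_vertex ma eqxx; apply/exists_inP; exists t.
by exists (exist _ a av).
Qed.

Lemma near_dist a p q i : near_pt a p -> near_pt a q -> m.+2%:R * `|p ord0 i - q ord0 i| < 2.
Proof.
move=> /(_ i) + /(_ i); rewrite -[X in X * _ < _](@ger0_norm _ m.+2%:R) // -normrM mulrBr.
rewrite !ltr_norml; move: (_ * _) (_ * _) => x y; lra.
Qed.

(** Two lattice points near [p] have supports in the triangle of [p], since a zero coordinate of [p]
    forces zero there, and their coordinates differ by less than 2. So [lat_neighbours] applies. *)
Lemma near_adj (v w : lvertex F0 m) p : realization R F0 p ->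
  near_pt (val v) p -> near_pt (val w) p -> v = w \/ adj (@ends n F0 m) predT v w.
Proof.
move=> [p0 p1 [t tF pt]] vp wp; case: (eqVneq v w) => [|nvw]; [by left|right].
have t3 := card3 tF.
case: v w nvw vp wp => [a av] [b bv]; rewrite -(inj_eq val_inj) /= => nab ap bp.
have sup (c : lat n m.+2) : near_pt c p -> supp c \subset t.
  move=> cp; apply/fintype.subsetP=> i; rewrite inE => ci; apply: pt.
  apply: contraTneq ci => pi0; rewrite -leqNgt leqn0; have := cp i.
  by rewrite pi0 mulr0 sub0r normrN normr_nat (_ : 1 = 1%:R) // ltr_nat ltnS leqn0.
have le2 (c d : lat n m.+2) i : near_pt c p -> near_pt d p -> (c i <= d i + 1)%N.
  move=> /(_ i) + /(_ i); move: (_ * _) (nat_of_ord (c i)) (nat_of_ord (d i)) => x k l.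
  rewrite !ltr_norml -ltnS -(ltr_nat R) -addn1 !natrD; lra.
have [/andP[/eqP ma _] /andP[/eqP mb _]] := (av, bv).
have [c [i [j [it jt nij [mc sc aE bE]]]]] :=
  lat_neighbours t3 ma mb (sup _ ap) (sup _ bp) (fun i => le2 _ _ i ap bp) (fun i => le2 _ _ i bp ap) nab.
have ed : is_edge F0 ([set i; j]%SET, c).
  rewrite /is_edge /= mc eqxx (edge_in tF) //=; apply/exists_inP; exists t => //.
  by rewrite sc andbT finset.subUset !finset.sub1set it.
apply/existsP; exists (exist (fun s => is_edge F0 s) _ ed); rewrite /ends !finset.in_set /= /raw_ends /=.
by rewrite aE bE !imset_f ?inE ?eqxx ?orbT.
Qed.

Lemma near_open a : open (near_pt a).
Proof.
rewrite openE => p ap.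
suff h i : \forall x \near p ord0 i, `|m.+2%:R * x - (a i)%:R| < 1.
  have h' i : nbhs p [set q : 'rV[R]_n | `|m.+2%:R * q ord0 i - (a i)%:R| < 1].
    exact: (@coord_continuous R 1 n ord0 i p _ (h i)).
  exact: filter_forall h'.
have cf : continuous (fun x : R => `|m.+2%:R * x - (a i)%:R|).
  move=> x; apply: cvg_norm; apply: cvgB; last exact: cvg_cst.
  by apply: cvgM; [exact: cvg_cst|exact: cvg_id].
apply: (cf _ [set x | x < 1]); apply: open_nbhs_nbhs.
by split; [exact: open_lt|exact: ap].
Qed.

Definition nearby (S : set 'rV[R]_n) : {set lvertex F0 m} :=
  [set v | `[< exists2 p, S p & near_pt (val v) p >]]%SET.

Lemma nearbyP S v : reflect (exists2 p, S p & near_pt (val v) p) (v \in nearby S).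
Proof. by rewrite finset.in_set; apply: asboolP. Qed.

(** The lattice points reachable from [v] and the others own open sets [C] and [D] that cover [S];
    by [near_adj] they do not meet in [S], so connectedness puts [S] inside [C]. *)
Lemma nearby_linked S : S `<=` realization R F0 -> connected S ->
  linked (adj (@ends n F0 m) predT) (nearby S).
Proof.
move=> SR cS v w vS wS.
pose a := adj_in (adj (@ends n F0 m) predT) (nearby S); pose L u := connect a v u.
have step u u' p : S p -> near_pt (val u) p -> near_pt (val u') p -> L u -> L u'.
  move=> Sp up u'p Lu; have [<-//|uu'] := near_adj (SR _ Sp) up u'p.
  apply: connect_trans Lu (connect1 _); rewrite /a /adj_in uu' /=.
  by apply/andP; split; apply/nearbyP; exists p.
pose C := \bigcup_(u in [set u | L u]) near_pt (val u).
pose D := \bigcup_(u in [set u | ~ L u]) near_pt (val u).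
have SC : S `&` C = S.
  have [p Sp vp] := nearbyP _ _ vS.
  apply: cS.
  - by exists p; split=> //; exists v => //; apply: connect0.
  - by exists C => //; apply: bigcup_open => u _; apply: near_open.
  exists (~` D); first by apply: open_closedC; apply: bigcup_open => u _; apply: near_open.
  apply/seteqP; split=> q [Sq].
    move=> [u Lu uq]; split=> // -[u' nLu' u'q]; apply: nLu'; exact: step uq u'q Lu.
  move=> nDq; split=> //; have [u uq] := near_cover (SR _ Sq); exists u => //.
  by apply: contrapT => nLu; apply: nDq; exists u.
have [p Sp wp] := nearbyP _ _ wS.
by have [_ [u Lu up]] : (S `&` C) p by [rewrite SC]; apply: step up wp Lu.
Qed.
End Near.

Lemma compact_gap (R : realType) (n : nat) (S S' : set 'rV[R]_n) :
  compact S -> compact S' -> S `&` S' = set0 ->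
  exists2 d, 0 < d & forall p q, S p -> S' q -> d <= `|p - q|.
Proof.
move=> cS cS' SS'.
pose g (z : 'rV[R]_n * 'rV[R]_n) := `|z.1 - z.2|.
have cg : continuous g.
  by move=> z; apply: cvg_norm; apply: cvgB; [exact: cvg_fst|exact: cvg_snd].
have cK : compact (g @` (S `*` S')).
  by apply: continuous_compact; [exact: continuous_subspaceT|exact: compact_setX].
have oK := closed_openC (compact_closed (@Rhausdorff R) cK).
have K0 : (~` (g @` (S `*` S'))) 0.
  move=> [[p q] [/= Sp S'q] /eqP]; rewrite /g /= normr_eq0 subr_eq0 => /eqP pq.
  by have : (S `&` S') p by [split; rewrite // pq]; rewrite SS'.
have /nbhs_ballP[d /= d0 dK] := open_nbhs_nbhs (conj oK K0).
exists d => // p q Sp S'q; rewrite leNgt; apply/negP=> lt.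
apply: (dK (g (p, q))); last by exists (p, q).
by rewrite -ball_normE /ball_ /= sub0r normrN /g /= normr_id.
Qed.

Lemma near_oo_forall (I : finType) (P : I -> nat -> Prop) :
  (forall i, \forall m \near \oo, P i m) -> \forall m \near \oo, forall i, P i m.
Proof. exact: filter_forall. Qed.

(** * From an embedding to sets of lattice points *)

Section Embedding.
Variables (R : realType) (n : nat) (F : {set {set 'I_n}}).

(** A common lattice point puts points of [S] and [S'] at distance below [2 / (m + 2)], less than
    the gap between the two compact sets for large [m]. *)
Lemma nearby_disjoint (S S' : set 'rV[R]_n) : compact S -> compact S' -> S `&` S' = set0 ->
  \forall m \near \oo, [disjoint nearby F m S & nearby F m S']%B.
Proof.
move=> cS cS' /(compact_gap cS cS')[d d0 dP].
exists (Num.bound (2 / d)) => // m /= hm; rewrite -finset.setI_eq0; apply/eqP/finset.setP=> v.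
rewrite finset.in_setI finset.in_set0; apply/andP=> -[/nearbyP[p Sp vp] /nearbyP[q S'q vq]].
have := dP p q Sp S'q; rewrite leNgt => /negP; apply.
have : ball p d q.
  split=> // i j; rewrite ord1 -ball_normE /ball_ /=.
  have := near_dist j vp vq; rewrite mulrC -ltr_pdivlMr ?ltr0Sn // => /lt_trans; apply.
  rewrite ltr_pdivrMr ?ltr0Sn // mulrC -ltr_pdivrMr //.
  apply: (lt_le_trans (archi_boundP _)); first by rewrite divr_ge0 // ltW.
  by rewrite ler_nat; apply: leq_trans hm _; rewrite -addn2 leq_addr.
by rewrite -ball_normE.
Qed.

Variables (T : finType) (e : rel T) (pt : T -> 'rV[R]_n) (arc : T -> T -> R -> 'rV[R]_n).
Hypotheses (e_sym : symmetric e) (e_irr : irreflexive e).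
Hypothesis emb : graph_embedding (realization R F) e pt arc.

Let third : R := 1 / 3.
(** The default [[set pt v]] puts [pt v] on every spoke, so stars are connected and the star of an
    isolated vertex is not empty. *)
Let spoke v w : set 'rV[R]_n := if e v w then arc v w @` `[0, third] else [set pt v].
Let star v : set 'rV[R]_n := \bigcup_(w in [set` enum T]) spoke v w.
Let mid u v : set 'rV[R]_n := arc u v @` `[third, 1 - third].

Let arcR u v t : e u v -> t \in `[0, 1] -> arc v u t = arc u v (1 - t).
Proof. by case: emb => _ h _ _ /h[_ _ _ _]; apply. Qed.

Let arc_sub u v (a b : R) : e u v -> 0 <= a -> b <= 1 ->
  [/\ connected (arc u v @` `[a, b]), compact (arc u v @` `[a, b])
    & arc u v @` `[a, b] `<=` realization R F].
Proof.
move=> euv a0 b1; case: emb => _ /(_ _ _ euv)[_ cont _ inX _] _ _.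
have sub : `[a, b] `<=` `[0, 1].
  by move=> x /=; rewrite !in_itv /= => /andP[ax xb]; rewrite (le_trans a0) ?(le_trans xb).
have cw := continuous_subspaceW sub cont.
split.
- by apply: connected_continuous_connected cw; apply: segment_connected.
- by apply: continuous_compact cw _; apply: segment_compact.
by move=> _ [t /sub/= tP <-]; apply: inX.
Qed.

Let spokeP v w : [/\ connected (spoke v w), compact (spoke v w), spoke v w (pt v)
  & spoke v w `<=` realization R F].
Proof.
rewrite /spoke; case: ifP => [evw|_].
  have [||h1 h2 h3] := @arc_sub v w 0 third evw; rewrite /third; [lra..|].
  split=> //; exists 0; first by rewrite /= in_itv /=; lra.
  by case: emb => _ /(_ _ _ evw)[[]].
split=> //; [exact: connected1|exact: compact_set1|].
by move=> _ ->; case: emb => -[_ h] _ _ _; apply: h.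
Qed.

Let starP v : [/\ connected (star v), compact (star v), star v (pt v)
  & star v `<=` realization R F].
Proof.
have pv : star v (pt v) by exists v; [rewrite /= mem_enum|have [] := spokeP v v].
split=> //.
- apply: bigcup_connected; first by exists (pt v) => w _; have [] := spokeP v w.
  by move=> w _; have [] := spokeP v w.
- by rewrite /star bigcup_seq; apply: bigsetU_compact => w _; have [] := spokeP v w.
by move=> p [w _]; have [_ _ _] := spokeP v w; apply.
Qed.

Let star_cases v p : star v p ->
  p = pt v \/ exists w, exists2 s, e v w /\ 0 < s <= third & p = arc v w s.
Proof.
case=> w _; rewrite /spoke; case: ifP => [evw [s sP <-]|_ ->]; last by left.
move: sP; rewrite /= in_itv /= => /andP[s0 s3].
have [s0'|] := boolP (0 < s); first by right; exists w, s; rewrite ?evw ?s0'.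
rewrite -leNgt => s0'; left; have -> : s = 0 by apply: le_anti; rewrite s0 s0'.
by case: emb => _ /(_ _ _ evw)[[]].
Qed.

Let star_disj v v' : v != v' -> star v `&` star v' = set0.
Proof.
move=> nvv'; case: emb => -[pt_inj _] arcP arc_pt arc_arc.
have inn s : 0 < s <= third -> s \in `]0, 1[ by rewrite in_itv /third /=; lra.
apply/seteqP; split=> // p [/star_cases[->|[w [s [evw sP] ->]]] /star_cases[|[w' [s' [evw' s'P]]]]].
- by move/pt_inj/eqP; rewrite (negbTE nvv').
- by move/esym; apply: arc_pt; rewrite ?inn.
- by apply: arc_pt; rewrite ?inn.
case: (eqVneq [set v; w]%SET [set v'; w']%SET) => [E|/eqP nE]; last first.
  by apply: arc_arc; rewrite ?inn.
have v'w : v' = w.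
  have : v' \in [set v; w]%SET by rewrite E !inE eqxx.
  by rewrite !inE eq_sym (negbTE nvv') => /eqP.
have w'v : w' = v.
  have : v \in [set v'; w']%SET by rewrite -E !inE eqxx.
  by rewrite !inE (negbTE nvv') => /eqP.
have I01 x : 0 < x <= third -> x \in `[0, 1] by rewrite in_itv /third /=; lra.
(* Both stars use the same arc, from opposite ends: [s = 1 - s'] is impossible when both parameters
   are at most a third. *)
rewrite v'w w'v (arcR evw) ?I01 //; have [_ _ inj _ _] := arcP _ _ evw.
move=> /(inj _ _ (I01 _ sP)) E'; have : s = 1 - s'.
  by apply: E'; move: s'P; rewrite in_itv /third /=; lra.
by move: sP s'P; rewrite /third; lra.
Qed.

Let mid_in u v p : mid u v p -> exists2 s, s \in `]0, 1[ & p = arc u v s.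
Proof.
case=> s; rewrite /= in_itv /= => sP <-; exists s => //.
by move: sP; rewrite in_itv /third /=; lra.
Qed.

Let mid_star u v w : e u v -> w != u -> w != v -> mid u v `&` star w = set0.
Proof.
move=> euv nwu nwv; case: emb => _ _ arc_pt arc_arc.
apply/seteqP; split=> // p [/mid_in[s sP ->] /star_cases[|[x [s' [ewx s'P]]]]].
  exact: arc_pt.
apply: arc_arc => //; last by move: s'P; rewrite in_itv /third /=; lra.
move=> E; have : w \in [set u; v]%SET by rewrite E !inE eqxx.
by rewrite !inE (negbTE nwu) (negbTE nwv).
Qed.

Let mid_mid u v u' v' : e u v -> e u' v' -> [set u; v]%SET != [set u'; v']%SET ->
  mid u v `&` mid u' v' = set0.
Proof.
move=> euv euv' /eqP nE; case: emb => _ _ _ arc_arc.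
by apply/seteqP; split=> // p [/mid_in[s sP ->] /mid_in[s' sP' ]]; apply: arc_arc.
Qed.

Let midP u v : e u v -> [/\ connected (mid u v), compact (mid u v) & mid u v `<=` realization R F].
Proof. by move=> euv; apply: arc_sub; rewrite // /third; lra. Qed.

Let mid_l u v : e u v -> (mid u v `&` star u) (arc u v third).
Proof.
move=> euv; split; first by exists third; rewrite //= in_itv /third /=; lra.
exists v; first by rewrite /= mem_enum.
by rewrite /spoke euv; exists third; rewrite //= in_itv /third /=; lra.
Qed.

Let mid_r u v : e u v -> (mid u v `&` star v) (arc v u third).
Proof.
move=> euv; split.
  exists (1 - third); first by rewrite //= in_itv /third /=; lra.
  by rewrite -arcR // in_itv /third /=; lra.
exists u; first by rewrite /= mem_enum.
by rewrite /spoke e_sym euv; exists third; rewrite //= in_itv /third /=; lra.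
Qed.

Hypothesis surf : closed_surface F.
Hypothesis chi : 0 <= euler_char F.

Lemma embedded_bound :
  (\sum_(u in [set: T]%SET) nb e u [set: T]%SET <= 6 * #|T|)%N /\
  (forall B : {set T}, (forall u v, e u v -> (u \in B) != (v \in B)) ->
     (\sum_(u in [set: T]%SET) nb e u [set: T]%SET <= 4 * #|T|)%N).
Proof.
case: surf => -[n0 vertF] card3 two_sides linkF skelF.
have eulerF : (#|tri_edges F| <= n + #|F|)%N.
  by move: chi; rewrite /euler_char; lia.
have h1 t t' : \forall m \near \oo, t != t' -> [disjoint nearby F m (star t) & nearby F m (star t')]%B.
  case: (eqVneq t t') => [_|ntt']; first by near=> m.
  have [[_ ct _ _] [_ ct' _ _]] := (starP t, starP t').
  by near=> m => _; near: m; apply: nearby_disjoint => //; apply: star_disj.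
have h2 u v w : \forall m \near \oo, e u v -> w != u -> w != v ->
    [disjoint nearby F m (mid u v) & nearby F m (star w)]%B.
  have [euv|] := boolP (e u v); last by move=> _; near=> m.
  case: (eqVneq w u) => [_|nwu]; first by near=> m.
  case: (eqVneq w v) => [_|nwv]; first by near=> m.
  have [[_ ct _] [_ ct' _ _]] := (midP euv, starP w).
  by near=> m => _ _ _; near: m; apply: nearby_disjoint => //; apply: mid_star.
have h3 u v u' v' : \forall m \near \oo, e u v -> e u' v' ->
    [set u; v]%SET != [set u'; v']%SET ->
    [disjoint nearby F m (mid u v) & nearby F m (mid u' v')]%B.
  have [euv|] := boolP (e u v); last by move=> _; near=> m.
  have [euv'|] := boolP (e u' v'); last by move=> _; near=> m.
  case: (eqVneq [set u; v]%SET [set u'; v']%SET) => [_|nE]; first by near=> m.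
  have [[_ ct _] [_ ct' _]] := (midP euv, midP euv').
  by near=> m => _ _ _; near: m; apply: nearby_disjoint => //; apply: mid_mid.
have h1' := near_oo_forall (fun t => near_oo_forall (h1 t)).
have h2' := near_oo_forall (fun u => near_oo_forall (fun v => near_oo_forall (h2 u v))).
have h3' := near_oo_forall (fun u => near_oo_forall (fun v => near_oo_forall (fun u' => near_oo_forall (h3 u v u')))).
(* There are finitely many pairs of sets to separate, so one [m] serves for all. *)
have [m [[d1 d2] d3]] := filter_ex (filterI (filterI h1' h2') h3').
have sr t : star t `<=` realization R F by have [] := starP t.
have meet S S' p : S `<=` realization R F -> (S `&` S') p ->
    nearby F m S :&: nearby F m S' != finset.set0.
  move=> SR [Sp S'p]; have [v vp] := near_cover m (SR _ Sp).
  by apply/set0Pn; exists v; rewrite finset.in_setI; apply/andP; split; apply/nearbyP; exists p.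
have Bs0 t : nearby F m (star t) != finset.set0.
  have [_ _ pv _] := starP t.
  by have := meet _ _ _ (sr t) (conj pv pv); rewrite finset.setIid.
have Bsl t : linked (adj (@ends n F m) predT) (nearby F m (star t)).
  by have [? _ _ ?] := starP t; apply: nearby_linked.
have Psl u v : e u v -> linked (adj (@ends n F m) predT) (nearby F m (mid u v)).
  by move=> /midP[? _ ?]; apply: nearby_linked.
have Ps_l u v : e u v -> nearby F m (mid u v) :&: nearby F m (star u) != finset.set0.
  by move=> euv; have [_ _ mr] := midP euv; apply: meet mr (mid_l euv).
have Ps_r u v : e u v -> nearby F m (mid u v) :&: nearby F m (star v) != finset.set0.
  by move=> euv; have [_ _ mr] := midP euv; apply: meet mr (mid_r euv).
have e2 := @ends2 n F m.
have s2 := sides2 (m := m) card3 two_sides.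
have bd := even_boundary (m := m) card3.
have cV := conn_vertices (m := m) card3 skelF.
have cF := conn_faces (m := m) card3 linkF skelF.
have eu := euler_lattice m vertF card3 two_sides eulerF.
split=> [|B]; first exact: (drawn_bound e2 s2 bd cV cF eu e_sym e_irr Bs0 Bsl d1 Psl Ps_l Ps_r d2 d3).
exact: (drawn_bound_bip e2 s2 bd cV cF eu e_sym e_irr Bs0 Bsl d1 Psl Ps_l Ps_r d2 d3).
Unshelve. all: by end_near.
Qed.
End Embedding.
End Subdivision.

Lemma graph_embedding_sub (R : realType) (S : topologicalType) (X : set S)
    (T U : finType) (e : rel T) (d : rel U) pt (arc : T -> T -> R -> S) (f : U -> T) :
  injective f -> (forall u v, d u v -> e (f u) (f v)) -> graph_embedding X e pt arc ->
  graph_embedding X d (pt \o f) (fun u v => arc (f u) (f v)).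
Proof.
move=> fI de [[ptI ptX] arcP arc_pt arc_arc]; split=> [|u v duv|u v w t duv|u v u' v' s t duv duv' nE].
- by split=> [u v /ptI/fI//|v]; apply: ptX.
- by have := arcP _ _ (de _ _ duv).
- exact: arc_pt (de _ _ duv).
apply: arc_arc; [exact: de|exact: de|].
move=> E; apply: nE; apply: (imset_inj fI); by rewrite !imsetU1 !imset_set1.
Qed.

(** The subgraph [d] and the vertex set [S] are both arbitrary because embeddings restrict; this
    covers induced subgraphs and the bipartite graph between two sets. *)
Lemma semi_planar_bound (R : realType) (T : finType) (e d : rel T) (S : {set T}) :
  simple_graph e -> semi_planar R e -> symmetric d -> subrel d e ->
  (\sum_(x in S) nb d x S <= 6 * #|S|) /\
  (forall B : {set T}, (forall u v, d u v -> (u \in B) != (v \in B)) ->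
    \sum_(x in S) nb d x S <= 4 * #|S|).
Proof.
move=> [_ e_irr] [n [F [surf chi [pt [arc emb]]]]] d_sym de.
pose U := {x | x \in S}; pose dU : rel U := fun u v => d (val u) (val v).
have embU : graph_embedding (realization R F) dU (pt \o val) (fun u v => arc (val u) (val v)).
  by apply: graph_embedding_sub emb => [|u v /de//]; apply: val_inj.
have dU_sym : symmetric dU by move=> u v; apply: d_sym.
have dU_irr : irreflexive dU by move=> u; apply: contraFF (e_irr (val u)); apply: de.
have cU : #|{: U}| = #|S| by rewrite card_sig; apply: eq_card => x; rewrite !inE.
have nbE x : x \in S -> nb d x S = #|[set u : U | d x (val u)]|.
  move=> xS; rewrite -(card_imset _ val_inj); apply: eq_card => y; rewrite inE.
  apply/andP/imsetP=> [[yS dxy]|[u + ->]]; last by rewrite inE (valP u).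
  by exists (exist (fun x => x \in S) y yS); rewrite ?inE.
have sumE : \sum_(u in [set: U]) nb dU u [set: U] = \sum_(x in S) nb d x S.
  rewrite (eq_bigr (fun x => #|[set u : U | d x (val u)]|)) //.
  rewrite (eq_bigl predT) => [|u]; last by rewrite inE.
  rewrite (eq_bigr (fun u => #|[set v : U | d (val u) (val v)]|)) => [|u _]; last first.
    by apply: eq_card => v; rewrite !inE.
  by rewrite [RHS]big_sub.
have [b6 b4] := embedded_bound dU_sym dU_irr embU surf chi.
rewrite -sumE -cU; split=> [|B bip]; first exact: b6.
by apply: (b4 (val @^-1: B)) => u v /bip; rewrite !inE.
Qed.

Lemma semi_planar_sparse (R : realType) (T : finType) (e : rel T) :
  simple_graph e -> semi_planar R e -> sparse e.
Proof.
move=> sg sp; have [e_sym _] := sg; split=> [X|X Y dXY].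
  by have [] := semi_planar_bound X sg sp e_sym (fun u v => id).
(* The degree sum over [X :|: Y] counts each edge between the two sets twice, which turns the bound
   4 into 2. *)
pose d : rel T := fun u v => e u v && ((u \in X) != (v \in X)).
have d_sym : symmetric d by move=> u v; rewrite /d e_sym eq_sym.
have [|_ /(_ X)] := semi_planar_bound (X :|: Y) sg sp d_sym; first by move=> u v /andP[].
move=> /(_ (fun u v h => proj2 (andP h))).
have YX y : y \in Y -> y \notin X by move=> yY; rewrite (disjointFl dXY yY).
have nbX x : x \in X -> nb d x (X :|: Y) = nb e x Y.
  move=> xX; apply: eq_card => y; rewrite !inE /d xX.
  have [yY|_] := boolP (y \in Y); first by rewrite orbT (negbTE (YX _ yY)) andbT.
  by rewrite orbF; case: (y \in X); rewrite ?andbF.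
have nbY y : y \in Y -> nb d y (X :|: Y) = nb e y X.
  move=> yY; apply: eq_card => x; rewrite !inE /d (negbTE (YX _ yY)).
  have [xX|_] := boolP (x \in X); first by rewrite /= andbT.
  by rewrite /= !andbF.
rewrite (eq_bigl [predU X & Y]) => [|x]; last by rewrite !inE.
rewrite bigU //= (eq_bigr _ nbX) (eq_bigr _ nbY) -sum_nbC //.
have : #|X :|: Y| <= #|X| + #|Y| by rewrite cardsU leq_subr.
lia.
Qed.

Theorem theorem2 (R : realType) (T : finType) (e : rel T) (r : nat)
    (hr : (9 <= r)%N) (hG : simple_graph e) (hsp : semi_planar R e)
    (hdeg : (max_degree e <= r)%N) :
  exists c : T -> 'I_r, equitable_coloring e c.
Proof.
have deg v : nb e v [set: T] <= r.
  apply: leq_trans (leq_trans (leq_bigmax v) hdeg).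
  by rewrite subset_leq_card //; apply/fintype.subsetP=> w; rewrite !inE.
have [e_sym e_irr] := hG.
have [c [c_proper c_eq]] := sparse_equitable hr e_sym e_irr (semi_planar_sparse hG hsp) deg.
exists c; split=> [u v /c_proper/eqP//|i j].
have := c_eq i j; have := c_eq j i; rewrite -![finset (fun v => c v == _)]/(color_class c _).
lia.
Qed.
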